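(* Let $v_\infty\in\mathbb{R}^{n+1,1}$ be such that $(\sigma,v_\infty)$ is nowhere zero for a never-zero section $\sigma$ of $\Lambda$. Then $\Lambda$ is a constrained Willmore surface admitting a polynomial conserved quantity $p(\lambda)=p_{-1}\lambda^{-1}+p_0+p_1\lambda$ of type $1$ (that is, for some multiplier $q$, $p(\lambda)$ is a polynomial conserved quantity of type $1$ of $(\Lambda,q)$) with parallel top term, $\mathcal{D}p_1=0$, and $p(1)=v_\infty$, if and only if the surface $\sigma_\infty$ defined by $\Lambda$ in the space-form $S_{v_\infty}$ has parallel mean curvature vector.
   Context: Ambient setting. Let $n\ge 3$ and let $\mathbb{R}^{n+1,1}$ be Lorentzian space of dimension $n+2$, with inner product $(\,,\,)$, extended complex bilinearly to $\mathbb{C}^{n+2}=(\mathbb{R}^{n+1,1})^{\mathbb{C}}$. Identify $\wedge^2\mathbb{R}^{n+1,1}$ with $o(\mathbb{R}^{n+1,1})$ by $(u\wedge v)(w)=(u,w)v-(v,w)u$. Let $\mathcal{L}$ be the light-cone (nonzero null vectors) and $\mathbb{P}(\mathcal{L})$ its projectivisation, the conformal $n$-sphere. Let $\Lambda:\Sigma\to\mathbb{P}(\mathcal{L})$ be an immersion of an oriented surface (a ''surface''), viewed as a null line subbundle of the trivial bundle $\Sigma\times\mathbb{R}^{n+1,1}$; trivial bundles are underlined. $\Sigma$ carries the conformal structure induced by $\Lambda$ (the class of $g_\sigma(X,Y)=(\mathrm{d}\sigma(X),\mathrm{d}\sigma(Y))$, $\sigma$ a never-zero section of $\Lambda$) and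 the corresponding complex structure. Bundles and their complexifications are not distinguished notationally. Set $\Lambda^{1,0}=\Lambda\oplus\mathrm{d}\sigma(T^{1,0}\Sigma)$, $\Lambda^{0,1}=\Lambda\oplus\mathrm{d}\sigma(T^{0,1}\Sigma)$, $\Lambda^{(1)}=\Lambda^{1,0}+\Lambda^{0,1}$. The central sphere congruence is the rank $4$ subbundle $S=\Lambda^{(1)}\oplus\langle\triangle\sigma\rangle$, of signature $(3,1)$, with $\triangle$ the Laplacian of $g_\sigma$. Write $\mathrm{d}=\mathcal{D}+\mathcal{N}$ for the trivial flat connection, where $\mathcal{D}$ is the sum of the connections induced by $\mathrm{d}$ on $S$ and $S^\perp$. Superscripts $1,0$ and $0,1$ denote type components. Constrained Willmore surfaces. $(\Lambda,q)$ is a constrained Willmore surface (and $q$ a multiplier) if $q\in\Omega^1(\Lambda\wedge\Lambda^{(1)})$ is a real form with $\mathrm{d}^{\mathcal{D}}q=0$ and $\mathrm{d}^{\mathcal{D}}{*\mathcal{N}}=2[q\wedge *\mathcal{N}]$ (where $[\omega_1\wedge\omega_2](X,Y)=[\omega_1(X),\omega_2(Y)]-[\omega_1(Y),\omega_2(X)]$); $\Lambda$ is a constrained Willmore surface if some such $q$ exists. Set, for $\lambda\in\mathbb{C}\setminus\{0\}$, $$\mathrm{d}^\lambda_q=\mathcal{D}+\lambda\mathcal{N}^{1,0}+\lambda^{-1}\mathcal{N}^{0,1}+(\lambda^2-1)q^{1,0}+(\lambda^{-2}-1)q^{0,1}.$$ Polynomial conserved quantities. For $d\in\mathbb{N}_0$,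 a polynomial conserved quantity of type $d$ of a constrained Willmore surface $(\Lambda,q)$ is a Laurent polynomial $p(\lambda)=\sum_{k=-d}^d p_k\lambda^k$ with $p_k\in\Gamma(\underline{\mathbb{C}}^{n+2})$ such that $p_{-k}=\overline{p_k}$ for all $k$; $p_d\in\Gamma(S^\perp)$; $p_k\in\Gamma(S^\perp)$ if $k,d$ have the same parity and $p_k\in\Gamma(S)$ otherwise; $p(1)\neq0$; and $\mathrm{d}^\lambda_q p(\lambda)=0$ for all $\lambda\in\mathbb{C}\setminus\{0\}$. Its top term is $p_d$. Space-forms. For nonzero $v_\infty\in\mathbb{R}^{n+1,1}$, $S_{v_\infty}=\{v\in\mathcal{L}:(v,v_\infty)=-1\}$ with the induced metric is an $n$-dimensional space-form of sectional curvature $-(v_\infty,v_\infty)$. The surface defined by $\Lambda$ in $S_{v_\infty}$ is $\sigma_\infty=-\frac{1}{(\sigma,v_\infty)}\sigma:\Sigma\to S_{v_\infty}$. Its mean curvature vector is parallel if it is parallel for the normal connection of $\sigma_\infty$ in $S_{v_\infty}$. The theory is local: restriction to a suitable non-empty open subset of $\Sigma$ is understood throughout. *)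

(* Defs.v *)
From HB Require Import structures.
From mathcomp Require Import all_boot all_order all_algebra.
From mathcomp Require Import all_classical all_reals all_analysis.
From mathcomp Require Import complex.

Set Implicit Arguments.
Unset Strict Implicit.
Unset Printing Implicit Defensive.

Import Order.TTheory GRing.Theory Num.Theory.
Import numFieldNormedType.Exports.

Local Open Scope classical_set_scope.
Local Open Scope ring_scope.
Local Open Scope complex_scope.

(* The theory is local, so the oriented surface is a nonempty open subset U of
   R^2 = 'rV[R]_2 with its standard orientation.  The coordinates are arbitrary:
   they are not assumed to be isothermal.  Functions are total on R^2; only
   their values on U matter.  A 1-form omega is given by its components
   omega i = omega(e_i) on the coordinate frame e_0, e_1.

   R^(n+1,1) is 'rV[R]_(n.+2), and its complexification is 'rV[R[i]]_(n.+2).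
   Vectors are rows, an endomorphism A acts by w |-> w *m A, and subspaces are
   row spaces. *)

Section Lorentz.
Variables (F : fieldType) (m : nat).

(* Signature (m,1), with the negative direction as coordinate 0. *)
Definition lorentz_gram : 'M[F]_m.+1 :=
  diag_mx (\row_j (if j == 0 then -1 else 1)).

Definition lorentz (u v : 'rV[F]_m.+1) : F := (u *m lorentz_gram *m v^T) 0 0.

Definition perp k (A : 'M[F]_(k, m.+1)) : 'M[F]_m.+1 :=
  kermx (lorentz_gram *m A^T).

(* Projection onto A parallel to its orthogonal complement; meaningful when the
   inner product is nondegenerate on A. *)
Definition oproj (A : 'M[F]_m.+1) : 'M[F]_m.+1 := proj_mx A (perp A).

(* The matrix of w |-> (u,w) v - (v,w) u. *)
Definition wedge (u v : 'rV[F]_m.+1) : 'M[F]_m.+1 :=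
  lorentz_gram *m (u^T *m v - v^T *m u).

(* The commutator A o B - B o A; the products are reversed because
   endomorphisms act on the right of row vectors. *)
Definition commutator (A B : 'M[F]_m.+1) : 'M[F]_m.+1 := B *m A - A *m B.

End Lorentz.

Section RealCalculus.
Variable R : realType.
Local Notation T := ('rV[R]_2).

Definition partial a b (i : 'I_2) (f : T -> 'M[R]_(a.+1, b.+1)) :
    T -> 'M[R]_(a.+1, b.+1) :=
  fun x => 'D_(delta_mx 0 i) f x.

(* C^oo on the open set U: iterated partial derivatives of all orders exist and
   are differentiable. *)
Definition smooth a b (U : set T) (f : T -> 'M[R]_(a.+1, b.+1)) : Prop :=
  forall (s : seq 'I_2) (x : T), U x ->
    differentiable (foldr (@partial a b) f s) x.

Definition jacobian b (f : T -> 'rV[R]_b.+1) (x : T) : 'M[R]_(2, b.+1) :=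
  \matrix_(i < 2) partial i f x.

Variable n : nat.
Local Notation V := ('rV[R]_n.+2).

(* sigma is a never-zero section of Lambda = <sigma>; the last clause says that
   Lambda is an immersion into the projectivised light-cone, i.e. that no
   nonzero X has d sigma(X) in Lambda. *)
Definition lift_of_surface (U : set T) (sigma : T -> V) : Prop :=
  smooth U sigma /\
  forall x, U x ->
    [/\ sigma x != 0, lorentz (sigma x) (sigma x) = 0 &
        forall X : T, X != 0 -> ~~ ('D_X sigma x <= sigma x)%MS].

Definition metric (f : T -> V) (x : T) : 'M[R]_2 :=
  \matrix_(i < 2, j < 2) lorentz (partial i f x) (partial j f x).

Definition area (f : T -> V) (x : T) : R := Num.sqrt (\det (metric f x)).

(* Row i is J e_i, where J is the rotation by a positive right angle for the
   metric of f: J e_0 = (- g_01 e_0 + g_00 e_1) / sqrt (det g) and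
   J e_1 = (- g_11 e_0 + g_01 e_1) / sqrt (det g). *)
Definition complex_structure (f : T -> V) (x : T) : 'M[R]_2 :=
  (area f x)^-1 *:
  (metric f x *m (delta_mx 0 1 - delta_mx 1 0 : 'M[R]_2)).

(* The Laplace-Beltrami operator of the metric of f. *)
Definition laplacian (f : T -> V) (h : T -> V) (x : T) : V :=
  (area f x)^-1 *:
  \sum_(i < 2) \sum_(j < 2)
    partial i (fun y => (area f y * invmx (metric f y) i j) *: partial j h y) x.

Section SpaceForm.
Variable v : V.

Definition surface_in_space_form (sigma : T -> V) (x : T) : V :=
  - (lorentz (sigma x) v)^-1 *: sigma x.

(* In what follows f : U -> S_v is an immersion, where
   S_v = {y in L : (y,v) = -1}, so that T_y S_v = <y, v>^perp.  The Levi-Civita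
   connection of S_v is the orthogonal projection of d onto the tangent spaces
   of S_v. *)
Definition space_form_tangent (y : V) : 'M[R]_n.+2 := perp (col_mx y v).

Definition space_form_connection (f xi : T -> V) (i : 'I_2) (x : T) : V :=
  partial i xi x *m oproj (space_form_tangent (f x)).

Definition normal_space (f : T -> V) (x : T) : 'M[R]_n.+2 :=
  (space_form_tangent (f x) :&: perp (jacobian f x))%MS.

Definition normal_connection (f xi : T -> V) (i : 'I_2) (x : T) : V :=
  space_form_connection f xi i x *m oproj (normal_space f x).

Definition second_fundamental_form (f : T -> V) (i j : 'I_2) (x : T) : V :=
  space_form_connection f (partial j f) i x *m oproj (normal_space f x).

Definition mean_curvature (f : T -> V) (x : T) : V :=
  2^-1 *: \sum_(i < 2) \sum_(j < 2)
    invmx (metric f x) i j *: second_fundamental_form f i j x.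

Definition parallel_mean_curvature (U : set T) (f : T -> V) : Prop :=
  forall x i, U x -> normal_connection f (mean_curvature f) i x = 0.

End SpaceForm.

End RealCalculus.

Section ComplexCalculus.
Variable R : realType.
Local Notation T := ('rV[R]_2).
Local Notation C := (R[i]).

Definition complexify a b (A : 'M[R]_(a, b)) : 'M[C]_(a, b) :=
  map_mx (real_complex R) A.
Definition re_mx a b (A : 'M[C]_(a, b)) : 'M[R]_(a, b) := map_mx (@complex.Re R) A.
Definition im_mx a b (A : 'M[C]_(a, b)) : 'M[R]_(a, b) := map_mx (@complex.Im R) A.
Definition conj_mx a b (A : 'M[C]_(a, b)) : 'M[C]_(a, b) := map_mx (@conjc R) A.

Definition cpartial a b (i : 'I_2) (f : T -> 'M[C]_(a.+1, b.+1)) (x : T) :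
    'M[C]_(a.+1, b.+1) :=
  complexify (partial i (fun y => re_mx (f y)) x)
  + 'i *: complexify (partial i (fun y => im_mx (f y)) x).

Definition csmooth a b (U : set T) (f : T -> 'M[C]_(a.+1, b.+1)) : Prop :=
  smooth U (fun x => re_mx (f x)) /\ smooth U (fun x => im_mx (f x)).

Variables (n : nat) (sigma : T -> 'rV[R]_n.+2).
Local Notation CV := ('rV[C]_n.+2).
Local Notation End := ('M[C]_n.+2).

Section Forms.
Variables a b : nat.
Implicit Type omega : 'I_2 -> T -> 'M[C]_(a, b).

Definition comp_J omega : 'I_2 -> T -> 'M[C]_(a, b) := fun i x =>
  \sum_(j < 2) (complex_structure sigma x i j)%:C *: omega j x.

Definition part10 omega : 'I_2 -> T -> 'M[C]_(a, b) := fun i x =>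
  2^-1 *: (omega i x - 'i *: comp_J omega i x).

Definition part01 omega : 'I_2 -> T -> 'M[C]_(a, b) := fun i x =>
  2^-1 *: (omega i x + 'i *: comp_J omega i x).

(* Hodge star, with * dx = dy in oriented isothermal coordinates. *)
Definition hodge omega : 'I_2 -> T -> 'M[C]_(a, b) := fun i x =>
  - comp_J omega i x.

End Forms.

Definition Lambda (x : T) : CV := complexify (sigma x).

(* d sigma (T^(1,0)) is the complex line spanned by the (1,0)-part of d sigma
   evaluated on any nonzero real tangent vector, here e_0; likewise for the
   type (0,1). *)
Definition Lambda10 (x : T) : End :=
  (Lambda x + part10 (fun i => cpartial i Lambda) 0 x)%MS.
Definition Lambda01 (x : T) : End :=
  (Lambda x + part01 (fun i => cpartial i Lambda) 0 x)%MS.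
Definition Lambda1 (x : T) : End := (Lambda10 x + Lambda01 x)%MS.

Definition csc (x : T) : End :=
  (Lambda1 x + complexify (laplacian sigma sigma x))%MS.
Definition csc_perp (x : T) : End := perp (csc x).

(* The connection D = pi_S o d o pi_S + pi_S^perp o d o pi_S^perp, applied to
   all the rows of a matrix-valued function at once. *)
Definition conn a (i : 'I_2) (f : T -> 'M[C]_(a.+1, n.+2)) (x : T) :
    'M[C]_(a.+1, n.+2) :=
  cpartial i (fun y => f y *m oproj (csc y)) x *m oproj (csc x)
  + cpartial i (fun y => f y *m (1%:M - oproj (csc y))) x
      *m (1%:M - oproj (csc x)).

(* The End-valued form N = d - D; as it is tensorial, it is read off on the
   constant frame formed by the rows of the identity matrix. *)
Definition Nform (i : 'I_2) (x : T) : End :=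
  cpartial i (fun _ => 1%:M : End) x - conn i (fun _ => 1%:M : End) x.

(* The connection induced by D on End: (D A) w = D (A w) - A (D w), with w
   running through the constant frame. *)
Definition conn_End (i : 'I_2) (A : T -> End) (x : T) : End :=
  conn i A x - conn i (fun _ => 1%:M : End) x *m A x.

(* Values of End-valued 2-forms on (e_0, e_1). *)
Definition dD (omega : 'I_2 -> T -> End) (x : T) : End :=
  conn_End 0 (omega 1) x - conn_End 1 (omega 0) x.

Definition bracket (omega1 omega2 : 'I_2 -> T -> End) (x : T) : End :=
  commutator (omega1 0 x) (omega2 1 x) - commutator (omega1 1 x) (omega2 0 x).

(* As Lambda has rank 1, every element of Lambda /\ Lambda^(1) at x is
   sigma(x) /\ w with w in Lambda^(1). *)
Definition multiplier (U : set T) (q : 'I_2 -> T -> End) : Prop :=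
  [/\ forall i, csmooth U (q i),
      forall i x, U x ->
        exists2 w : CV, (w <= Lambda1 x)%MS & q i x = wedge (Lambda x) w,
      forall i x, U x -> conj_mx (q i x) = q i x,
      forall x, U x -> dD q x = 0 &
      forall x, U x ->
        dD (hodge Nform) x = 2 *: bracket q (hodge Nform) x].

Definition dlambda (q : 'I_2 -> T -> End) (l : C) (i : 'I_2)
    (s : T -> CV) (x : T) : CV :=
  conn i s x + l *: (s x *m part10 Nform i x)
  + l^-1 *: (s x *m part01 Nform i x)
  + (l ^ 2 - 1) *: (s x *m part10 q i x)
  + (l ^ (-2) - 1) *: (s x *m part01 q i x).

(* Only the coefficients p_k with -d <= k <= d are relevant. *)
Definition laurent (d : nat) (p : int -> T -> CV) (l : C) (x : T) : CV :=
  \sum_(j < d.*2.+1) l ^ (j%:Z - d%:Z) *: p (j%:Z - d%:Z) x.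

Definition polynomial_conserved_quantity (U : set T) (q : 'I_2 -> T -> End)
    (d : nat) (p : int -> T -> CV) : Prop :=
  (forall k : int, (`|k| <= d)%N ->
    [/\ csmooth U (p k),
        forall x, U x -> p (- k) x = conj_mx (p k x) &
        forall x, U x ->
          (p k x <= if odd `|k| == odd d then csc_perp x else csc x)%MS]) /\
  (* the condition on the top term p_d *)
  (forall x, U x -> (p d%:Z x <= csc_perp x)%MS) /\
  ~ (forall x, U x -> laurent d p 1 x = 0) /\
  (forall l : C, l != 0 -> forall i x, U x ->
    dlambda q l i (laurent d p l) x = 0).

End ComplexCalculus.

(* Main.v *)
(* Let f be the lift of Lambda in S_v, P the orthogonal projection onto the
   central sphere congruence S, and write v = z + w with z in S and w in S^perp.
   With H the mean curvature vector of f, w = - (H + (H,H) f), so H is parallel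
   in the normal bundle of f in S_v if and only if D w = 0.  A conserved quantity
   with p(1) = v has Re p_1 = w/2, whence one direction.  Conversely, if D w = 0,
   then dw takes values in df(T Sigma) and is tracefree, and the
   multiplier q = f /\ dw/2 has the conserved quantity
   w/2 lambda^(-1) + z + w/2 lambda: one has N w = dw, N z = 0, D z = - dw and
   q z = - dw/2.  The equation d^D * N = 2 [q /\ * N] is then checked on f, df
   and z, which span S; both sides are skew and map S^perp to S. *)

Require Import Defs.
From mathcomp Require Import all_boot all_order all_algebra.
From mathcomp Require Import all_classical all_reals all_analysis.
From mathcomp Require Import complex.
From mathcomp Require Import ring lra.

Set Implicit Arguments.
Unset Strict Implicit.
Unset Printing Implicit Defensive.

Import Order.TTheory GRing.Theory Num.Theory.
Import numFieldNormedType.Exports.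

Local Open Scope classical_set_scope.
Local Open Scope ring_scope.
Local Open Scope complex_scope.

(* [jacobian] alone would denote the library's. *)
Local Notation jacobian := Defs.jacobian.

(** * Entrywise differential calculus of matrix-valued functions on the plane *)

Section MatrixCalculus.
Context {R : realType}.
Local Notation T := ('rV[R]_2).
Implicit Types (x : T) (i j : 'I_2) (U : set T).

(** The multiplier is forced. With p_1 = w/2 and p_0 = z, the coefficient of lambda^2 in the
    equation for p reads q^(1,0) z = - N^(1,0) w/2; as (f,z) = -1, the endomorphism f /\ b sends z
    to -b modulo f, whence b = dw/2. In the other direction p(1) = v controls only p_1 + conj p_1,
    which is why real parts are taken. The obstacle is that S is given by complex spans, a Laplacian
    and a projection defined by subspaces, none of which can be differentiated as it stands. So S is
    replaced by a real self-adjoint idempotent P obtained from a Gram matrix, and D and N are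
    written through P: N = dP (1 - 2P) and D s = ds - s N. The curvature computations are then real
    matrix algebra, and complex numbers return only to separate types. As the coordinates are not
    isothermal, the star is carried by the matrix J of the complex structure. Its parallelism, dJ =
    [Gam, J], together with the symmetric tracefree second fundamental form, reduces the values of
    d^D *N on df to the Codazzi equation d^D N = 0. *)

Definition spartial i (h : T -> R) (x : T) : R := 'D_(delta_mx 0 i) h x.

Lemma differentiable_sumf I (r : seq I) (V W : normedModType R) (h : I -> V -> W) (x : V) :
  (forall k, differentiable (h k) x) ->
  differentiable (fun y => \sum_(k <- r) h k y) x.
Proof.
move=> dh; elim: r => [|k r IH].
  under eq_fun do rewrite big_nil; exact: differentiable_cst.
under eq_fun do rewrite big_cons.
exact: (differentiableD (dh k) IH).
Qed.

Lemma derive_sumf I (r : seq I) (V W : normedModType R) (h : I -> V -> W) (x v : V) :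
  (forall k, derivable (h k) x v) ->
  derivable (fun y => \sum_(k <- r) h k y) x v /\
  'D_v (fun y => \sum_(k <- r) h k y) x = \sum_(k <- r) 'D_v (h k) x.
Proof.
move=> dh; elim: r => [|k r [IH1 IH2]].
  under eq_fun do rewrite big_nil.
  by rewrite big_nil; split; [exact: derivable_cst | exact: derive_cst].
under eq_fun do rewrite big_cons; rewrite big_cons -IH2.
by split; [exact: (derivableD (dh k) IH1) | exact: (deriveD (dh k) IH1)].
Qed.

Section Entries.
Variables a b : nat.
Implicit Types M N : T -> 'M[R]_(a.+1, b.+1).

Lemma differentiable_mxP M x :
  differentiable M x <-> forall k l, differentiable (fun y => M y k l) x.
Proof.
split=> [dM k l|dM].
  exact: (differentiable_comp dM (differentiable_coord _ k l)).
have -> : M = fun y => \sum_(kl : 'I_a.+1 * 'I_b.+1) M y kl.1 kl.2 *: delta_mx kl.1 kl.2.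
  apply/funext => y; rewrite [LHS]matrix_sum_delta.
  by rewrite pair_big.
apply: differentiable_sumf => kl; exact: differentiableZl (dM _ _).
Qed.

Lemma partial_entry M i x k l :
  differentiable M x -> partial i M x k l = spartial i (fun y => M y k l) x.
Proof.
by move=> dM; rewrite /partial derive_mx ?mxE//; exact: diff_derivable.
Qed.

Lemma partialD M N i x : differentiable M x -> differentiable N x ->
  partial i (fun y => M y + N y) x = partial i M x + partial i N x.
Proof. by move=> dM dN; rewrite /partial; apply: deriveD; exact: diff_derivable. Qed.

Lemma partialN M i x : differentiable M x ->
  partial i (fun y => - M y) x = - partial i M x.
Proof. by move=> dM; rewrite /partial; apply: deriveN; exact: diff_derivable. Qed.

Lemma partialB M N i x : differentiable M x -> differentiable N x ->
  partial i (fun y => M y - N y) x = partial i M x - partial i N x.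
Proof. by move=> dM dN; rewrite /partial; apply: deriveB; exact: diff_derivable. Qed.

Lemma partial_cst (c : 'M[R]_(a.+1, b.+1)) i x : partial i (fun _ => c) x = 0.
Proof. exact: derive_cst. Qed.

Lemma partialZ (c : R) M i x : differentiable M x ->
  partial i (fun y => c *: M y) x = c *: partial i M x.
Proof. by move=> dM; rewrite /partial; apply: deriveZ; exact: diff_derivable. Qed.

Lemma partial_eq U M N i x : open U -> (forall y, U y -> M y = N y) -> U x ->
  partial i M x = partial i N x.
Proof.
move=> oU MN Ux; apply: near_eq_derive.
by apply: filterS MN _; exact: open_nbhs_nbhs.
Qed.

Lemma differentiable_scale (h : T -> R) M x :
  differentiable h x -> differentiable M x -> differentiable (fun y => h y *: M y) x.
Proof.
move=> dh /(differentiable_mxP _ _).1 dM; apply/differentiable_mxP => k l.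
under eq_fun do rewrite mxE.
exact: differentiableM.
Qed.

Lemma partial_scale (h : T -> R) M i x :
  differentiable h x -> differentiable M x ->
  partial i (fun y => h y *: M y) x = h x *: partial i M x + spartial i h x *: M x.
Proof.
move=> dh dM; have dM' := (differentiable_mxP _ _).1 dM.
apply/matrixP => k l; rewrite partial_entry; last exact: differentiable_scale.
rewrite !mxE partial_entry// /spartial.
under eq_fun do rewrite mxE.
rewrite (_ : (fun y : T => h y * M y k l) = h * (fun y => M y k l))//.
by rewrite deriveM; [rewrite [X in _ + X]mulrC | exact: diff_derivable..].
Qed.

Lemma derive_partial M (X : T) x : differentiable M x ->
  'D_X M x = X 0 0 *: partial 0 M x + X 0 1 *: partial 1 M x.
Proof.
move=> dM; rewrite /partial !deriveE// -!linearZ -linearD; congr ('d M x _).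
by rewrite [LHS]row_sum_delta big_ord_recl big_ord1; congr (_ *: delta_mx _ _ + X _ _ *: delta_mx _ _); apply/val_inj.
Qed.

End Entries.

Lemma differentiable_tr a b (M : T -> 'M[R]_(a.+1, b.+1)) x : differentiable M x -> differentiable (fun y => (M y)^T) x.
Proof.
move=> /(differentiable_mxP _ _).1 dM; apply/differentiable_mxP => k l.
by under eq_fun do rewrite mxE.
Qed.

Lemma partial_tr a b (M : T -> 'M[R]_(a.+1, b.+1)) i x : differentiable M x ->
  partial i (fun y => (M y)^T) x = (partial i M x)^T.
Proof.
move=> dM; apply/matrixP => k l; rewrite mxE !partial_entry//; last exact: differentiable_tr.
by congr (spartial i _ x); apply/funext => y; rewrite mxE.
Qed.

Lemma differentiable_mulmx a b c (M : T -> 'M[R]_(a.+1, b.+1))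
    (N : T -> 'M[R]_(b.+1, c.+1)) x :
  differentiable M x -> differentiable N x -> differentiable (fun y => M y *m N y) x.
Proof.
move=> /(differentiable_mxP _ _).1 dM /(differentiable_mxP _ _).1 dN; apply/differentiable_mxP => k l.
under eq_fun do rewrite mxE.
by apply: differentiable_sumf => p; exact: differentiableM.
Qed.

Lemma partial_mulmx a b c (M : T -> 'M[R]_(a.+1, b.+1))
    (N : T -> 'M[R]_(b.+1, c.+1)) i x :
  differentiable M x -> differentiable N x ->
  partial i (fun y => M y *m N y) x = partial i M x *m N x + M x *m partial i N x.
Proof.
move=> dM dN; have dM' := (differentiable_mxP _ _).1 dM; have dN' := (differentiable_mxP _ _).1 dN.
apply/matrixP => k l; rewrite partial_entry; last exact: differentiable_mulmx.
rewrite !mxE /spartial; under eq_fun do rewrite mxE.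
rewrite (@derive_sumf _ _ _ _ (fun p y => M y k p * N y p l) _ _ _).2; last first.
  by move=> p; apply: derivableM; exact: diff_derivable.
rewrite -big_split/=; apply: eq_bigr => p _.
rewrite (_ : (fun y : T => M y k p * N y p l) = (fun y => M y k p) * (fun y => N y p l))//.
rewrite deriveM; [|exact: diff_derivable..].
rewrite !partial_entry//= addrC; congr (_ + _); exact: mulrC.
Qed.

Lemma partial_mulmxr a b c (M : T -> 'M[R]_(a.+1, b.+1)) (C : 'M[R]_(b.+1, c.+1)) i x :
  differentiable M x -> partial i (fun y => M y *m C) x = partial i M x *m C.
Proof.
move=> dM; rewrite (partial_mulmx i dM (differentiable_cst C x)).
by rewrite (partial_cst C) mulmx0 addr0.
Qed.

Lemma partial_mulmxl a b c (M : T -> 'M[R]_(b.+1, c.+1)) (C : 'M[R]_(a.+1, b.+1)) i x :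
  differentiable M x -> partial i (fun y => C *m M y) x = C *m partial i M x.
Proof.
move=> dM; rewrite (partial_mulmx i (differentiable_cst C x) dM).
by rewrite (partial_cst C) mul0mx add0r.
Qed.

End MatrixCalculus.

(** * Locality of differentiability and symmetry of second partial derivatives *)

Section Smoothness.
Context {R : realType}.
Local Notation T := ('rV[R]_2).
Implicit Types (x : T) (i j : 'I_2) (U : set T) (h g : T -> R).

(** The difference [g - f] vanishes near [x], so it is differentiable there with differential zero.
    This transfers differentiability between total functions that agree only on an open set. *)
Lemma differentiable_near_eq (V W : normedModType R) (f g : V -> W) (x : V) :
  (\near x, f x = g x) -> differentiable f x -> differentiable g x.
Proof.
move=> fg df; pose k := g - f.
have kE : k \o shift x = cst (k x) + \0 +o_ 0 id.
  apply/eqaddoP => _/posnumP[eps] /=.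
  have kx : k x = 0 by rewrite /k !fctE (nbhs_singleton fg) subrr.
  have fg0 : \forall y \near 0, f (y + x) = g (y + x).
    by have := fg; rewrite (near_shift 0) subr0.
  near=> y; rewrite !fctE /= kx addr0 subr0 /k !fctE (_ : f _ = g (y + x)).
    by rewrite subrr normr0 mulr_ge0.
  by near: y.
have dk : differentiable k x.
  have k0 : 'd k x = \0 :> (V -> W) by apply: diff_unique => //; exact: cst_continuous.
  by apply/diff_locallyP; rewrite k0; split=> //; exact: cst_continuous.
have -> : g = f + k by apply/funext => y; rewrite /k !fctE subrKC.
exact: differentiableD.
Unshelve. all: by end_near. Qed.

Lemma is_derive_line h i (a : T) (s : R) : differentiable h (a + s *: delta_mx 0 i) ->
  is_derive s 1 (fun s => h (a + s *: delta_mx 0 i)) (spartial i h (a + s *: delta_mx 0 i)).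
Proof.
move=> /(diff_derivable (v := delta_mx 0 i)) dh.
have E : (fun k : R => k^-1 *: (h (a + (k *: 1 + s) *: delta_mx 0 i) - h (a + s *: delta_mx 0 i)))
   = (fun k : R => k^-1 *: (h (k *: delta_mx 0 i + (a + s *: delta_mx 0 i)) - h (a + s *: delta_mx 0 i))).
  apply/funext => k; congr (_ *: (h _ - _)).
  by rewrite [_ *: 1]mulr1 scalerDl addrCA.
by apply: DeriveDef; rewrite /derivable /spartial /derive E.
Qed.

(** Two mean value theorems: one for the difference of [h] along two parallel sides of the square,
    the other for the resulting partial derivative across it. The left-hand side is symmetric in [i]
    and [j], which is what gives the equality of mixed derivatives. *)
Lemma second_difference h i j x (t : R) (U : set T) : 0 < t ->
  (forall s s', 0 <= s <= t -> 0 <= s' <= t ->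
     U (x + s *: delta_mx 0 i + s' *: delta_mx 0 j)) ->
  (forall y, U y -> differentiable h y) ->
  (forall y, U y -> differentiable (spartial i h) y) ->
  exists s s', [/\ 0 <= s <= t, 0 <= s' <= t &
   h (x + t *: delta_mx 0 i + t *: delta_mx 0 j) - h (x + t *: delta_mx 0 i)
   - (h (x + t *: delta_mx 0 j) - h x)
   = spartial j (spartial i h) (x + s *: delta_mx 0 i + s' *: delta_mx 0 j) * t * t].
Proof.
move=> t0 inU dh dih.
have tt : 0 <= t <= t by apply/andP; split; [exact: ltW | exact: lexx].
have z0 : (0 : R) <= 0 <= t by apply/andP; split; [exact: lexx | exact: ltW].
pose phi := (fun s : R => h (x + t *: delta_mx 0 j + s *: delta_mx 0 i))
            - (fun s => h (x + s *: delta_mx 0 i)).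
pose dphi := fun s : R => spartial i h (x + t *: delta_mx 0 j + s *: delta_mx 0 i)
            - spartial i h (x + s *: delta_mx 0 i).
have Dphi s : 0 <= s <= t -> is_derive s 1 phi (dphi s).
  move=> st; apply: is_deriveB; apply: is_derive_line; apply: dh.
    by rewrite addrAC; apply: inU.
  by rewrite -[X in U X]addr0 -(scale0r (delta_mx 0 j)); apply: inU.
have Cphi : {within `[0, t], continuous phi}.
  apply: derivable_within_continuous => s; rewrite in_itv/= => st.
  by have [] := Dphi s st.
have [s + sE] := MVT t0 (fun s st => Dphi s (subset_itv_oo_cc st)) Cphi.
move=> /subset_itv_oo_cc; rewrite in_itv/= => st.
pose psi := fun s' : R => spartial i h (x + s *: delta_mx 0 i + s' *: delta_mx 0 j).
have Dpsi s' : 0 <= s' <= t -> is_derive s' 1 psi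
   (spartial j (spartial i h) (x + s *: delta_mx 0 i + s' *: delta_mx 0 j)).
  by move=> s't; apply: is_derive_line; apply: dih; exact: inU.
have Cpsi : {within `[0, t], continuous psi}.
  apply: derivable_within_continuous => s'; rewrite in_itv/= => s't.
  by have [] := Dpsi s' s't.
have [s' + s'E] := MVT t0 (fun s st => Dpsi s (subset_itv_oo_cc st)) Cpsi.
move=> /subset_itv_oo_cc; rewrite in_itv/= => s't.
exists s, s'; split=> //.
move: sE; rewrite /phi /dphi !fctE !scale0r !addr0 => sE.
move: s'E; rewrite /psi scale0r addr0 subr0 => <-.
move: sE; rewrite subr0 [x + t *: delta_mx 0 j + t *: _]addrAC.
rewrite [x + t *: delta_mx 0 j + s *: _]addrAC => sE.
by rewrite -sE; ring.
Qed.

Lemma delta_normE i j (s s' t : R) : 0 <= s <= t -> 0 <= s' <= t -> i != j ->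
  `|s *: delta_mx 0 i + s' *: delta_mx 0 j : T| <= t.
Proof.
move=> /andP[s0 st] /andP[s0' st'] ij.
rewrite /Num.Def.normr/= mx_normrE bigmax_le ?(le_trans s0)// => -[k l] _ /=.
rewrite !mxE (ord1 k) /=.
have [->|_] := eqVneq l i; rewrite ?mulr1 ?mulr0 ?add0r.
  by rewrite (negbTE ij) mulr0 addr0 ger0_norm.
by case: (l == j); rewrite ?mulr1 ?mulr0 ?normr0 ?ger0_norm// (le_trans s0).
Qed.

(** Schwarz's theorem: on a small square the same second difference is the squared side times either
    mixed derivative at some point, and both mixed derivatives are continuous at [x]. *)
Lemma spartial_comm h i j x (U : set T) : open U -> U x ->
  (forall y, U y -> differentiable h y) ->
  (forall k y, U y -> differentiable (spartial k h) y) ->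
  (forall k l, differentiable (spartial k (spartial l h)) x) ->
  spartial i (spartial j h) x = spartial j (spartial i h) x.
Proof.
move=> oU Ux dh dih ddh.
have [->//|ij] := eqVneq i j.
apply/eqP; rewrite -subr_eq0 -normr_le0; apply/ler_addgt0Pr => e e0; rewrite add0r.
have e2 : 0 < e / 2 by rewrite divr_gt0.
have near1 k l : \forall y \near x,
    `|spartial k (spartial l h) x - spartial k (spartial l h) y| < e / 2.
  by have /differentiable_continuous/cvgrPdist_lt := ddh k l; apply.
have : \forall y \near x, [/\ U y,
    `|spartial i (spartial j h) x - spartial i (spartial j h) y| < e / 2 &
    `|spartial j (spartial i h) x - spartial j (spartial i h) y| < e / 2].
  by apply: filterS3 (open_nbhs_nbhs (conj oU Ux)) (near1 i j) (near1 j i).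
move=> /nbhs_ballP[r /= r0 rP].
(* The norm is the maximum norm, so a square of side [r / 2] with corner [x] stays inside the open
   ball of radius [r]. *)
pose t := r / 2.
have t0 : 0 < t by rewrite divr_gt0.
have inB k l s s' : k != l -> 0 <= s <= t -> 0 <= s' <= t ->
    ball x r (x + s *: delta_mx 0 k + s' *: delta_mx 0 l).
  move=> kl st st'; rewrite -ball_normE /ball_/= -addrA opprD addrA subrr add0r normrN.
  by rewrite (le_lt_trans (delta_normE st st' kl))// /t ltr_pdivrMr// ltr_pMr// ltr1n.
have ji : j != i by rewrite eq_sym.
have [s1 [s1' [s1t s1t' E1]]] := second_difference (U := U) t0
  (fun s s' st st' => let: And3 a _ _ := rP _ (inB _ _ _ _ ij st st') in a)
  dh (dih i).
have [s2 [s2' [s2t s2t' E2]]] := second_difference (U := U) t0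
  (fun s s' st st' => let: And3 a _ _ := rP _ (inB _ _ _ _ ji st st') in a)
  dh (dih j).
have [_ _ B1] := rP _ (inB _ _ _ _ ij s1t s1t').
have [_ B2 _] := rP _ (inB _ _ _ _ ji s2t s2t').
set p1 := spartial j _ _ in E1 B1; set p2 := spartial i _ _ in E2 B2.
have : p1 = p2.
  apply: (mulIf (lt0r_neq0 t0)); apply: (mulIf (lt0r_neq0 t0)).
  have xE : x + t *: delta_mx 0 j + t *: delta_mx 0 i
      = x + t *: delta_mx 0 i + t *: delta_mx 0 j by rewrite addrAC.
  rewrite {}xE in E2; clear -E1 E2; clearbody p1 p2; rewrite -{}E1 -{}E2.
  move: (h _) (h _) (h _) (h _) => A B C D; ring.
move=> pE; rewrite -pE in B2.
set a := spartial i _ x in B2 *; set b := spartial j _ x in B1 *.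
clearbody a b p1; clear -B1 B2.
have -> : a - b = (a - p1) - (b - p1) by ring.
apply: (le_trans (ler_normB _ _)); apply: ltW.
rewrite [X in _ < X](splitr e); exact: ltrD B2 B1.
Qed.

End Smoothness.

(** * Smooth scalar and matrix functions on an open set, and their closure properties *)

Section SmoothClosure.
Context {R : realType}.
Local Notation T := ('rV[R]_2).
Variables (U : set T) (oU : open U).
Implicit Types (x : T) (i j : 'I_2) (h g : T -> R).

(** The grading by order makes closure under products and inverses inductive: the derivatives of
    these involve the functions themselves, at one order less. *)
Fixpoint ksmooth (k : nat) (h : T -> R) : Prop :=
  (forall x, U x -> differentiable h x) /\
  if k is k'.+1 then forall i, ksmooth k' (spartial i h) else True.

Definition smooth_fun (h : T -> R) : Prop := forall k, ksmooth k h.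

Lemma ksmooth_diff k h x : ksmooth k h -> U x -> differentiable h x.
Proof. by case: k => [|k] [dh _]; exact: dh. Qed.

Lemma near_open (P : T -> Prop) x : U x -> (forall y, U y -> P y) -> \near x, P x.
Proof. by move=> Ux UP; apply: filterS UP _; exact: open_nbhs_nbhs. Qed.

Lemma spartial_eq h g i x : (forall y, U y -> h y = g y) -> U x ->
  spartial i h x = spartial i g x.
Proof. by move=> hg Ux; apply: near_eq_derive; exact: near_open. Qed.

Lemma ksmooth_eq k h g : (forall x, U x -> h x = g x) -> ksmooth k h -> ksmooth k g.
Proof.
move=> hg Hh; have dg x : U x -> differentiable g x.
  by move=> Ux; apply: differentiable_near_eq (ksmooth_diff Hh Ux); exact: near_open.
elim: k h g hg Hh dg => [|k IH] h g hg Hh dg; split=> // i.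
have dih := Hh.2; apply: IH (dih i) _ => [x Ux|x Ux]; first exact: spartial_eq.
apply: differentiable_near_eq (ksmooth_diff (dih i) Ux).
by apply: near_open => // y Uy; exact: spartial_eq.
Qed.

Lemma ksmoothW k h : ksmooth k.+1 h -> ksmooth k h.
Proof.
elim: k h => [|k IH] h [dh dih]; first by split.
by split=> // i; apply: IH.
Qed.

Lemma ksmooth_cst k (c : R) : ksmooth k (fun _ => c).
Proof.
elim: k c => [|k IH] c; first by split=> // x _; exact: differentiable_cst.
split=> [x _|i]; first exact: differentiable_cst.
by apply: ksmooth_eq (IH 0) => x _; rewrite /spartial derive_cst.
Qed.

Lemma ksmoothD k h g : ksmooth k h -> ksmooth k g -> ksmooth k (fun x => h x + g x).
Proof.
elim: k h g => [|k IH] h g [dh dih] [dg dig].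
  by split=> // x Ux; exact: differentiableD (dh x Ux) (dg x Ux).
split=> [x Ux|i]; first exact: differentiableD (dh x Ux) (dg x Ux).
apply: ksmooth_eq (IH _ _ (dih i) (dig i)) => x Ux.
by rewrite /spartial; symmetry; apply: deriveD; apply: diff_derivable; [exact: dh|exact: dg].
Qed.

Lemma spartialM h g i x : differentiable h x -> differentiable g x ->
  spartial i (fun x => h x * g x) x = spartial i h x * g x + h x * spartial i g x.
Proof.
move=> dh dg; rewrite /spartial (_ : (fun x => _) = h * g)//.
rewrite deriveM; [|exact: diff_derivable..].
by rewrite addrC; congr (_ + _); exact: mulrC.
Qed.

Lemma spartialB h g i x : differentiable h x -> differentiable g x ->
  spartial i (fun x => h x - g x) x = spartial i h x - spartial i g x.
Proof. by move=> dh dg; apply: deriveB; exact: diff_derivable. Qed.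

Lemma ksmoothM k h g : ksmooth k h -> ksmooth k g -> ksmooth k (fun x => h x * g x).
Proof.
elim: k h g => [|k IH] h g Hh Hg.
  by case: Hh => dh _; case: Hg => dg _; split=> // x Ux; exact: differentiableM (dh x Ux) (dg x Ux).
have [[dh dih] [dg dig]] := (Hh, Hg).
split=> [x Ux|i]; first exact: differentiableM (dh x Ux) (dg x Ux).
apply: (@ksmooth_eq _ (fun x => spartial i h x * g x + h x * spartial i g x)).
  by move=> x Ux; rewrite spartialM; auto.
by apply: ksmoothD; apply: IH; [exact: dih|exact: ksmoothW|exact: ksmoothW|exact: dig].
Qed.

Lemma ksmoothV k h : (forall x, U x -> h x != 0) -> ksmooth k h ->
  ksmooth k (fun x => (h x)^-1).
Proof.
move=> h0; have dV x : U x -> differentiable h x -> differentiable (fun x => (h x)^-1) x.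
  by move=> Ux dh; exact: differentiableV (h0 x Ux).
elim: k => [|k IH] Hh; have [dh dih] := Hh.
  by split=> // x Ux; apply: dV => //; exact: dh.
split=> [x Ux|i]; first by apply: dV => //; exact: dh.
apply: (@ksmooth_eq _ (fun x => (-1) * ((h x)^-1 * (h x)^-1 * spartial i h x))).
  move=> x Ux; rewrite /spartial.
  have := deriveV (h0 x Ux) (diff_derivable (v := delta_mx 0 i) (dh x Ux)).
  rewrite mulN1r /= => ->; rewrite scaleNr; congr (- (_ * _)).
  by rewrite -invfM -expr2.
have HV : ksmooth k (fun x => (h x)^-1) by apply: IH; exact: ksmoothW.
by apply: ksmoothM; [exact: ksmooth_cst|apply: ksmoothM; [exact: ksmoothM|exact: dih]].
Qed.

Lemma ksmooth_sum k I (r : seq I) (P : pred I) (H : I -> T -> R) :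
  (forall p, P p -> ksmooth k (H p)) -> ksmooth k (fun x => \sum_(p <- r | P p) H p x).
Proof.
move=> HH; elim: r => [|p r IH].
  by under eq_fun do rewrite big_nil; exact: ksmooth_cst.
under eq_fun do rewrite big_cons.
by have [Pp|_] := boolP (P p); rewrite ?Pp//; apply: ksmoothD => //; exact: HH.
Qed.

Lemma ksmooth_prod k I (r : seq I) (H : I -> T -> R) :
  (forall p, ksmooth k (H p)) -> ksmooth k (fun x => \prod_(p <- r) H p x).
Proof.
move=> HH; elim: r => [|p r IH].
  by under eq_fun do rewrite big_nil; exact: ksmooth_cst.
by under eq_fun do rewrite big_cons; apply: ksmoothM.
Qed.

(** Stated on entries, hence available for matrices of any size, such as frames, minors and Gram
    matrices. *)
Definition smooth_mx a b (M : T -> 'M[R]_(a, b)) : Prop :=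
  forall k l, smooth_fun (fun x => M x k l).

Section Bridge.
Variables a b : nat.
Implicit Types M N : T -> 'M[R]_(a.+1, b.+1).

Lemma smooth_diff M x : smooth U M -> U x -> differentiable M x.
Proof. by move=> sM Ux; exact: (sM [::]). Qed.

Lemma smooth_partial M i : smooth U M -> smooth U (partial i M).
Proof. by move=> sM s x Ux; have := sM (rcons s i) x Ux; rewrite foldr_rcons. Qed.

(** [foldr] applies the last letter of a word first, so words grow by [rcons]: the induction then
    passes from [M] to [partial i M]. *)
Lemma smoothP M : smooth U M <-> smooth_mx M.
Proof.
split=> [sM k l n|sM s].
  elim: n M sM => [|n IH] M sM; have dM := smooth_diff sM.
    by split=> // x Ux; exact: ((differentiable_mxP _ _).1 (dM x Ux)).
  split=> [x Ux|i]; first exact: ((differentiable_mxP _ _).1 (dM x Ux)).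
  apply: ksmooth_eq (IH _ (smooth_partial i sM)) => x Ux.
  by rewrite partial_entry//; exact: dM.
elim/last_ind: s M sM => [|s i IH] M sM.
  by move=> x Ux; apply/differentiable_mxP => k l; exact: ksmooth_diff (sM k l 0%N) Ux.
rewrite foldr_rcons; apply: IH => k l n.
have [_ /(_ i)] := sM k l n.+1; apply: ksmooth_eq => x Ux.
rewrite partial_entry//; apply/differentiable_mxP => k' l'.
exact: ksmooth_diff (sM k' l' 0%N) Ux.
Qed.

Lemma smooth_eq M N : (forall x, U x -> M x = N x) -> smooth U M -> smooth U N.
Proof.
move=> MN /smoothP sM; apply/smoothP => k l n.
by apply: ksmooth_eq (sM k l n) => x Ux; rewrite MN.
Qed.

End Bridge.

Lemma smooth_mxcst a b (c : 'M[R]_(a, b)) : smooth_mx (fun _ => c).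
Proof. by move=> k l n; exact: ksmooth_cst. Qed.

Lemma smooth_mxD a b (M N : T -> 'M[R]_(a, b)) :
  smooth_mx M -> smooth_mx N -> smooth_mx (fun x => M x + N x).
Proof.
by move=> sM sN k l n; under eq_fun do rewrite mxE; apply: ksmoothD; [exact: sM|exact: sN].
Qed.

Lemma smooth_mxscale a b h (M : T -> 'M[R]_(a, b)) :
  smooth_fun h -> smooth_mx M -> smooth_mx (fun x => h x *: M x).
Proof.
by move=> sh sM k l n; under eq_fun do rewrite mxE; apply: ksmoothM; [exact: sh|exact: sM].
Qed.

Lemma smooth_mxN a b (M : T -> 'M[R]_(a, b)) : smooth_mx M -> smooth_mx (fun x => - M x).
Proof.
move=> sM; under eq_fun do rewrite -scaleN1r.
by apply: smooth_mxscale => // n; exact: ksmooth_cst.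
Qed.

Lemma smooth_mxB a b (M N : T -> 'M[R]_(a, b)) :
  smooth_mx M -> smooth_mx N -> smooth_mx (fun x => M x - N x).
Proof. by move=> sM sN; apply: smooth_mxD => //; exact: smooth_mxN. Qed.

Lemma smooth_mxsum I (r : seq I) a b (H : I -> T -> 'M[R]_(a, b)) :
  (forall p, smooth_mx (H p)) -> smooth_mx (fun x => \sum_(p <- r) H p x).
Proof.
by move=> sH k l m; under eq_fun do rewrite summxE; apply: ksmooth_sum => p _; exact: sH.
Qed.

Lemma smooth_mxM a b c (M : T -> 'M[R]_(a, b)) (N : T -> 'M[R]_(b, c)) :
  smooth_mx M -> smooth_mx N -> smooth_mx (fun x => M x *m N x).
Proof.
move=> sM sN k l n; under eq_fun do rewrite mxE.
by apply: ksmooth_sum => p _; apply: ksmoothM; [exact: sM|exact: sN].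
Qed.

Lemma smooth_mxtr a b (M : T -> 'M[R]_(a, b)) : smooth_mx M -> smooth_mx (fun x => (M x)^T).
Proof. by move=> sM k l n; under eq_fun do rewrite mxE; exact: sM. Qed.

Lemma smooth_mxcol a1 a2 b (M : T -> 'M[R]_(a1, b)) (N : T -> 'M[R]_(a2, b)) :
  smooth_mx M -> smooth_mx N -> smooth_mx (fun x => col_mx (M x) (N x)).
Proof.
move=> sM sN k l n; under eq_fun do rewrite mxE.
by case: splitP => j _; [exact: sM|exact: sN].
Qed.

Lemma smooth_det a (M : T -> 'M[R]_a) : smooth_mx M -> smooth_fun (fun x => \det (M x)).
Proof.
move=> sM n; rewrite /determinant; apply: ksmooth_sum => s _.
apply: ksmoothM; first exact: ksmooth_cst.
by apply: ksmooth_prod => p; exact: sM.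
Qed.

Lemma smooth_mxinv a (M : T -> 'M[R]_a) : (forall x, U x -> M x \in unitmx) ->
  smooth_mx M -> smooth_mx (fun x => invmx (M x)).
Proof.
move=> uM sM k l n.
apply: (@ksmooth_eq _ (fun x => (\det (M x))^-1 * ((-1) ^+ (l + k) * \det (row' l (col' k (M x)))))).
  by move=> x Ux; rewrite /invmx uM// !mxE.
apply: ksmoothM.
  apply: ksmoothV; last exact: smooth_det.
  by move=> x Ux; have := uM x Ux; rewrite unitmxE unitfE.
apply: ksmoothM; first exact: ksmooth_cst.
apply: smooth_det => k' l' n'; under eq_fun do rewrite !mxE; exact: sM.
Qed.

Lemma smooth_partialC a b (M : T -> 'M[R]_(a.+1, b.+1)) i j x : smooth U M -> U x ->
  partial i (partial j M) x = partial j (partial i M) x.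
Proof.
move=> sM Ux.
have d0 k l : differentiable (partial k (partial l M)) x.
  by apply: smooth_diff => //; do 2!apply: smooth_partial.
apply/matrixP => k l.
have E p q : partial p (partial q M) x k l
    = spartial p (spartial q (fun y => M y k l)) x.
  rewrite partial_entry; last by apply: smooth_diff => //; exact: smooth_partial.
  apply: spartial_eq => // y Uy; rewrite partial_entry//; exact: smooth_diff sM Uy.
have sf := (smoothP _).1 sM k l.
apply: (etrans (E i j)); apply: (etrans _ (esym (E j i))).
apply: (@spartial_comm _ _ _ _ _ U oU Ux).
- by move=> y Uy; have s0 := sf 0%N; exact: ksmooth_diff s0 Uy.
- move=> p y Uy; have s1 : ksmooth 0 (spartial p (fun y => M y k l)) by case: (sf 1%N) => _; exact.
  exact: ksmooth_diff s1 Uy.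
- move=> p q; have s2 : ksmooth 0 (spartial p (spartial q (fun y => M y k l))).
    by case: (sf 2%N) => _ /(_ q)[_]; exact.
  exact: ksmooth_diff s2 Ux.
Qed.

End SmoothClosure.

(** * Lorentzian linear algebra: wedges, orthogonal projections, null frames *)

Section LorentzAlgebra.
Variables (F : fieldType) (m : nat).
Local Notation G := (lorentz_gram F m).
Implicit Types (u v w f : 'rV[F]_m.+1) (P : 'M[F]_m.+1).

Lemma lorentz_gram_tr : G^T = G.
Proof. exact: tr_diag_mx. Qed.

Lemma lorentz_gramK : G *m G = 1%:M.
Proof.
rewrite /lorentz_gram mulmx_diag; apply/matrixP => i j; rewrite !mxE; case: (i =P j) => // _.
by case: ifP => _; rewrite ?mulrNN mulr1.
Qed.

Lemma lorentz_scalar u v : u *m G *m v^T = (lorentz u v)%:M.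
Proof. exact: mx11_scalar. Qed.

Lemma lorentz0P u v : reflect (u *m G *m v^T = 0) (lorentz u v == 0).
Proof.
rewrite lorentz_scalar; apply: (iffP eqP) => [->|/matrixP/(_ 0 0)].
  by rewrite -scalemx1 scale0r.
by rewrite !mxE eqxx mulr1n.
Qed.

Lemma lorentzC u v : lorentz u v = lorentz v u.
Proof.
rewrite /lorentz; transitivity ((v *m G *m u^T)^T 0 0); last by rewrite mxE.
by rewrite !trmx_mul trmxK lorentz_gram_tr mulmxA.
Qed.

Lemma lorentzDl u v w : lorentz (u + v) w = lorentz u w + lorentz v w.
Proof. by rewrite /lorentz !mulmxDl mxE. Qed.

Lemma lorentzZl a u w : lorentz (a *: u) w = a * lorentz u w.
Proof. by rewrite /lorentz -!scalemxAl mxE. Qed.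

Lemma lorentzNl u w : lorentz (- u) w = - lorentz u w.
Proof. by rewrite -scaleN1r lorentzZl mulN1r. Qed.

Lemma lorentzBl u v w : lorentz (u - v) w = lorentz u w - lorentz v w.
Proof. by rewrite lorentzDl lorentzNl. Qed.

Lemma lorentz0l w : lorentz 0 w = 0.
Proof. by rewrite -(scale0r 0) lorentzZl mul0r. Qed.

Lemma lorentzDr u v w : lorentz w (u + v) = lorentz w u + lorentz w v.
Proof. by rewrite !(lorentzC w) lorentzDl. Qed.

Lemma lorentzZr a u w : lorentz w (a *: u) = a * lorentz w u.
Proof. by rewrite !(lorentzC w) lorentzZl. Qed.

Lemma lorentzNr u w : lorentz w (- u) = - lorentz w u.
Proof. by rewrite !(lorentzC w) lorentzNl. Qed.

Lemma lorentzBr u v w : lorentz w (u - v) = lorentz w u - lorentz w v.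
Proof. by rewrite !(lorentzC w) lorentzBl. Qed.

Lemma lorentz0r w : lorentz w 0 = 0.
Proof. by rewrite lorentzC lorentz0l. Qed.

Lemma lorentz_sumr I (r : seq I) (H : I -> 'rV[F]_m.+1) w :
  lorentz w (\sum_(k <- r) H k) = \sum_(k <- r) lorentz w (H k).
Proof. by elim/big_rec2: _ => [|k a b _ <-]; rewrite ?lorentz0r ?lorentzDr. Qed.

Lemma mulmx_wedge w u v : w *m wedge u v = lorentz w u *: v - lorentz w v *: u.
Proof.
by rewrite /wedge mulmxA mulmxBr !mulmxA !lorentz_scalar !mul_scalar_mx.
Qed.

Lemma wedge_skew u v : wedge u v *m G = - (G *m (wedge u v)^T).
Proof.
have sk : (u^T *m v - v^T *m u)^T = - (u^T *m v - v^T *m u).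
  by rewrite linearB /= !trmx_mul !trmxK opprB.
by rewrite /wedge trmx_mul lorentz_gram_tr sk mulNmx mulmxN opprK mulmxA.
Qed.

Lemma wedgeDr u v w : wedge u (v + w) = wedge u v + wedge u w.
Proof. by rewrite /wedge -mulmxDr; congr (_ *m _); rewrite [(_ + _)^T]linearD /= mulmxDr mulmxDl opprD addrACA. Qed.

Lemma wedgeZr a u v : wedge u (a *: v) = a *: wedge u v.
Proof. by rewrite /wedge [(_ *: _)^T]linearZ /= -scalemxAr -scalemxAl -scalerBr -scalemxAr. Qed.

Lemma wedgeZl a u v : wedge (a *: u) v = a *: wedge u v.
Proof. by rewrite /wedge [(_ *: _)^T]linearZ /= -scalemxAr -scalemxAl -scalerBr -scalemxAr. Qed.

Lemma wedgeDl u v w : wedge (u + v) w = wedge u w + wedge v w.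
Proof. by rewrite /wedge -mulmxDr; congr (_ *m _); rewrite [(_ + _)^T]linearD /= mulmxDr mulmxDl opprD addrACA. Qed.

Lemma wedgeC u v : wedge u v = - wedge v u.
Proof. by rewrite /wedge -[RHS]mulmxN opprB. Qed.

Lemma wedge_id u : wedge u u = 0.
Proof. by rewrite /wedge subrr mulmx0. Qed.

Lemma wedgeNr u v : wedge u (- v) = - wedge u v.
Proof. by rewrite -scaleN1r wedgeZr scaleN1r. Qed.

(** A skew endomorphism acts as a derivation on the exterior square: [N, u /\ v] = Nu /\ v + u /\
    Nv. Skewness is what carries [N] through the Gram matrix. *)
Lemma wedge_ad u v (N : 'M[F]_m.+1) : N *m G = - (G *m N^T) ->
  wedge u v *m N - N *m wedge u v = wedge (u *m N) v + wedge u (v *m N).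
Proof.
move=> skew; rewrite /wedge !mulmxA skew mulNmx opprK -!mulmxA -!mulmxDr.
congr (_ *m _); rewrite !trmx_mul mulmxBl mulmxBr !mulmxA.
by rewrite addrACA [RHS]addrACA [u^T *m v *m N + _]addrC.
Qed.

Section Projection.

(** An idempotent that is self-adjoint for the Lorentzian product. No subspace occurs, so such a [P]
    can be differentiated and treated by matrix identities. *)
Definition orthoproj P : Prop := P *m P = P /\ P *m G = G *m P^T.

Lemma orthoprojC P : orthoproj P -> orthoproj (1%:M - P).
Proof.
move=> [PP PG]; split.
  by rewrite mulmxBl mul1mx mulmxBr mulmx1 PP subrr subr0.
by rewrite mulmxBl mul1mx linearB /= trmx1 mulmxBr mulmx1 PG.
Qed.

Lemma orthoproj_lorentz P u v : orthoproj P -> lorentz (u *m P) v = lorentz u (v *m P).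
Proof. by case=> _ PG; rewrite /lorentz trmx_mul -!mulmxA [P *m (G *m _)]mulmxA PG !mulmxA. Qed.

Lemma sub_perp k l (A : 'M[F]_(k, m.+1)) (B : 'M[F]_(l, m.+1)) :
  reflect (B *m G *m A^T = 0) (B <= perp A)%MS.
Proof. by apply: (iffP sub_kermxP); rewrite mulmxA. Qed.

Lemma sub_perp_orthoproj k l (A : 'M[F]_(k, m.+1)) (B : 'M[F]_(l, m.+1)) P :
  orthoproj P -> (A :=: P)%MS -> reflect (B *m P = 0) (B <= perp A)%MS.
Proof.
move=> [PP PG] AP; apply: (iffP (sub_perp _ _)) => BA.
  have [D PD] : exists D, P = D *m A by apply/submxP; rewrite AP.
  have : B *m G *m P^T = 0 by rewrite PD trmx_mul mulmxA BA mul0mx.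
  rewrite -mulmxA -PG mulmxA => /(congr1 (fun C => C *m G)).
  by rewrite mul0mx -mulmxA lorentz_gramK mulmx1.
have [D ->] : exists D, A = D *m P by apply/submxP; rewrite AP.
by rewrite trmx_mul mulmxA -[B *m G *m P^T]mulmxA -PG mulmxA BA !mul0mx.
Qed.

Lemma sub_orthoproj k l (A : 'M[F]_(k, m.+1)) (B : 'M[F]_(l, m.+1)) P :
  orthoproj P -> (A :=: P)%MS -> reflect (B *m P = B) (B <= A)%MS.
Proof.
move=> [PP _] AP; rewrite AP; apply: (iffP submxP) => [[D ->]|<-].
  by rewrite -mulmxA PP.
by exists B.
Qed.

Lemma perp_orthoproj k (A : 'M[F]_(k, m.+1)) P : orthoproj P -> (A :=: P)%MS ->
  (perp A :=: 1%:M - P)%MS.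
Proof.
move=> oP AP; apply/eqmxP; apply/andP; split.
  have /(sub_perp_orthoproj _ oP AP) E : (perp A <= perp A)%MS by [].
  by apply/submxP; exists (perp A); rewrite mulmxBr mulmx1 E subr0.
by apply/(sub_perp_orthoproj _ oP AP); rewrite mulmxBl mul1mx oP.1 subrr.
Qed.

(** A vector in both [A] and [perp A] is fixed and killed by [P], so the two are in direct sum and
    [proj_mx] has its intended meaning; splitting the identity as P + (1 - P) then identifies it. *)
Lemma oprojE (A : 'M[F]_m.+1) P : orthoproj P -> (A :=: P)%MS -> oproj A = P.
Proof.
move=> oP AP; rewrite /oproj.
have AA : (A :&: perp A)%MS = 0.
  apply/eqP; rewrite -submx0; apply/row_subP => i.
  set w := row i _; have : (w <= A :&: perp A)%MS by exact: row_sub.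
  rewrite sub_capmx => /andP[/(sub_orthoproj _ oP AP) <-].
  by move=> /(sub_perp_orthoproj _ oP AP); rewrite -mulmxA oP.1 => ->; exact: sub0mx.
rewrite -[LHS]mul1mx -{1}[1%:M](subrKC P) mulmxDl.
rewrite (proj_mx_id AA) ?AP// (proj_mx_0 AA) ?addr0//.
by rewrite (perp_orthoproj oP AP).
Qed.

Lemma oproj_perp k (A : 'M[F]_(k, m.+1)) P : orthoproj P -> (A :=: P)%MS ->
  oproj (perp A) = 1%:M - P.
Proof. by move=> oP AP; apply: oprojE; [exact: orthoprojC|exact: perp_orthoproj]. Qed.

(** Orthogonal projection onto the span of a frame, through the inverse of its Gram matrix. It is a
    rational expression in the frame, hence smooth wherever the frame is smooth and
    nondegenerate. *)
Definition gram_proj k (E : 'M[F]_(k, m.+1)) : 'M[F]_m.+1 :=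
  G *m E^T *m invmx (E *m G *m E^T) *m E.

Variables (k : nat) (E : 'M[F]_(k, m.+1)).
Hypothesis nondeg : E *m G *m E^T \in unitmx.

Lemma gram_proj_id : E *m gram_proj E = E.
Proof. by rewrite /gram_proj !mulmxA mulmxV// mul1mx. Qed.

Lemma orthoproj_gram : orthoproj (gram_proj E).
Proof.
split; first by rewrite {1}/gram_proj -mulmxA gram_proj_id.
rewrite /gram_proj !trmx_mul trmx_inv !trmx_mul !trmxK lorentz_gram_tr.
by rewrite !mulmxA.
Qed.

Lemma gram_proj_eqmx : (E :=: gram_proj E)%MS.
Proof.
apply/eqmxP/andP; split; last exact: submxMl.
by apply/submxP; exists E; rewrite gram_proj_id.
Qed.

End Projection.

(* The frames adapted to a null line f: a frame of the tangent plane J of a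
   lift of f, and a vector z transverse to the hyperplane orthogonal to f. *)
Definition null_frame k f (J : 'M[F]_(k, m.+1)) z : 'M[F]_(1 + (k + 1), m.+1) :=
  col_mx f (col_mx J z).

Section NullFrame.
Variables (k : nat) (f z : 'rV[F]_m.+1) (J : 'M[F]_(k, m.+1)).
Hypotheses (ff : lorentz f f = 0) (fJ : f *m G *m J^T = 0).
Hypotheses (fz : lorentz f z != 0) (JJ : J *m G *m J^T \in unitmx).

Let Jf : J *m G *m f^T = 0.
Proof. by apply: trmx_inj; rewrite trmx0 !trmx_mul trmxK lorentz_gram_tr mulmxA. Qed.

(** Pairing with [f] isolates the coordinate along [z], because [f] is orthogonal to itself and to
    [J]. *)
Lemma null_frame_coord (c1 c3 : 'M[F]_1) (c2 : 'rV[F]_k) u :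
  u = c1 *m f + (c2 *m J + c3 *m z) -> lorentz u f = 0 -> c3 = 0.
Proof.
move=> uE /eqP/lorentz0P; rewrite uE !mulmxDl -!mulmxA.
rewrite (mulmxA f) (mulmxA J) (mulmxA z) Jf !lorentz_scalar ff.
rewrite -scalemx1 scale0r !mulmx0 !add0r (lorentzC z) mul_mx_scalar => /eqP.
by rewrite scaler_eq0 (negbTE fz) => /eqP.
Qed.

(** The conclusion does not involve [z]: spans built from the same [f] and [J] with different
    transverse vectors share their part orthogonal to [f]. *)
Lemma sub_null_frame_tangent u : lorentz u f = 0 ->
  (u <= null_frame f J z)%MS -> (u <= col_mx f J)%MS.
Proof.
move=> uf /submxP[c]; rewrite -[c]hsubmxK -[rsubmx c]hsubmxK.
move: (lsubmx c) (lsubmx (rsubmx c)) (rsubmx (rsubmx c)) => c1 c2 c3.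
rewrite /null_frame !mul_row_col => uE.
apply/submxP; exists (row_mx c1 c2).
by rewrite mul_row_col uE (null_frame_coord uE uf) mul0mx addr0.
Qed.

(** The Gram matrix is block anti-triangular. For a vector in its kernel, pairing with [f], then
    [J], then [z] kills the coordinates along [z], [J] and [f] in turn. *)
Lemma null_frame_nondeg :
  null_frame f J z *m G *m (null_frame f J z)^T \in unitmx.
Proof.
rewrite -row_free_unit -kermx_eq0; apply/rowV0P => c /sub_kermxP.
rewrite -[c]hsubmxK -[rsubmx c]hsubmxK.
move: (lsubmx c) (lsubmx (rsubmx c)) (rsubmx (rsubmx c)) => c1 c2 c3.
rewrite !mulmxA; set u := row_mx _ _ *m _.
have uE : u = c1 *m f + (c2 *m J + c3 *m z) by rewrite /u /null_frame !mul_row_col.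
rewrite /null_frame !tr_col_mx !mul_mx_row => uE0.
have /eq_row_mx[uf /eq_row_mx[uJ uz]] :
    row_mx (u *m G *m f^T) (row_mx (u *m G *m J^T) (u *m G *m z^T)) = row_mx 0 (row_mx 0 0).
  by rewrite uE0 !row_mx0.
have c30 : c3 = 0.
  by apply: (null_frame_coord uE); apply/eqP/lorentz0P.
have c20 : c2 = 0.
  move: uJ; rewrite uE c30 mul0mx addr0 !mulmxDl -!mulmxA (mulmxA f) fJ mulmx0 add0r.
  by rewrite (mulmxA J) => /(congr1 (fun A => A *m invmx (J *m G *m J^T))); rewrite mulmxK// mul0mx.
have c10 : c1 = 0.
  move: uz; rewrite uE c30 c20 !mul0mx !addr0 -!mulmxA (mulmxA f) lorentz_scalar.
  by rewrite mul_mx_scalar => /eqP; rewrite scaler_eq0 (negbTE fz) => /eqP.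
by rewrite c10 c20 c30 !row_mx0.
Qed.

End NullFrame.

End LorentzAlgebra.

Lemma det2 (F : comNzRingType) (g : 'M[F]_2) : \det g = g 0 0 * g 1 1 - g 0 1 * g 1 0.
Proof.
rewrite (expand_det_row _ 0) !big_ord_recl big_ord0 /cofactor !det_mx11 !mxE /=.
rewrite (_ : lift ord0 ord0 = 1 :> 'I_2); last exact/val_inj.
rewrite (_ : lift 1 0 = 0 :> 'I_2); last exact/val_inj.
rewrite (_ : ord0 = 0 :> 'I_2)// expr0 expr1 mul1r mulN1r addr0 mulrN //.
Qed.

(** * Positivity on the orthogonal complement of a null vector *)

Section LorentzPositivity.
Variables (F : realFieldType) (m : nat).
Implicit Types (u v w f : 'rV[F]_m.+1).

Lemma lorentzE u v : lorentz u v = - (u 0 0 * v 0 0)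
  + \sum_(j < m) u 0 (lift ord0 j) * v 0 (lift ord0 j).
Proof.
rewrite /lorentz mxE big_ord_recl; congr (_ + _).
  by rewrite /lorentz_gram mul_mx_diag !mxE eqxx mulrN1 mulNr.
by apply: eq_bigr => j _; rewrite /lorentz_gram mul_mx_diag !mxE /= mulr1.
Qed.

(* Modulo the null vector f, one may assume u 0 0 = 0. *)
Lemma lorentz_null_perp_gt0 f u : f != 0 -> lorentz f f = 0 -> lorentz u f = 0 ->
  ~~ (u <= f)%MS -> 0 < lorentz u u.
Proof.
move=> f0 ff uf nuf.
have pos w : w 0 0 = 0 -> lorentz w w = \sum_(j < m) w 0 (lift ord0 j) ^+ 2.
  by move=> w0; rewrite lorentzE w0 mul0r oppr0 add0r.
have pos0 w : w 0 0 = 0 -> lorentz w w <= 0 -> w = 0.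
  move=> w0; rewrite pos// => le0.
  have : \sum_(j < m) w 0 (lift ord0 j) ^+ 2 == 0.
    by rewrite eq_le le0 sumr_ge0// => j _; exact: sqr_ge0.
  rewrite psumr_eq0; last by move=> j _; exact: sqr_ge0.
  move=> /allP w0'; apply/rowP => j; rewrite mxE.
  case: (unliftP ord0 j) => [k ->|->]//.
  by have := w0' k (mem_index_enum _); rewrite /= sqrf_eq0 => /eqP.
have f00 : f 0 0 != 0 by apply: contraNneq f0 => e; rewrite (pos0 f)// ff.
pose r := u - (u 0 0 / f 0 0) *: f.
have r0 : r 0 0 = 0 by rewrite /r !mxE divfK// subrr.
have -> : lorentz u u = lorentz r r.
  rewrite /r !(lorentzBl, lorentzBr, lorentzZl, lorentzZr) ff uf (lorentzC f) uf.
  by rewrite !mulr0 !subr0.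
rewrite ltNge; apply: contra nuf => /(pos0 _ r0) => /eqP.
by rewrite subr_eq0 => /eqP ->; exact: scalemx_sub.
Qed.

Lemma det2_gt0 (g : 'M[F]_2) : g^T = g ->
  (forall X : 'rV[F]_2, X != 0 -> 0 < (X *m g *m X^T) 0 0) -> 0 < \det g.
Proof.
move=> gT pos; have g01 : g 1 0 = g 0 1 by rewrite -[in LHS]gT mxE.
have qE a b (X := \row_j (if j == 0 then a else b) : 'rV[F]_2) :
    (X *m g *m X^T) 0 0 = a * a * g 0 0 + 2 * a * b * g 0 1 + b * b * g 1 1.
  rewrite !(mxE, big_ord_recl, big_ord0) /= .
  rewrite (_ : lift ord0 ord0 = 1 :> 'I_2); last exact/val_inj.
  rewrite (_ : ord0 = 0 :> 'I_2)//= g01; ring.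
have g00 : 0 < g 0 0.
  have := pos (\row_j (if j == 0 then 1 else 0)).
  rewrite qE !mulr1 !mulr0 !mul0r !addr0 mul1r; apply.
  by apply/eqP => /rowP/(_ 0); rewrite !mxE eqxx => /eqP; rewrite oner_eq0.
(* At the vector (- g01, g00) the quadratic form takes the value g00 det g. *)
have := pos (\row_j (if j == 0 then - g 0 1 else g 0 0)).
rewrite qE det2 g01 => H; rewrite -(pmulr_rgt0 _ g00).
rewrite (_ : _ * _ = - g 0 1 * - g 0 1 * g 0 0 + 2 * - g 0 1 * g 0 0 * g 0 1
   + g 0 0 * g 0 0 * g 1 1); last by ring.
apply: H; apply/eqP => /rowP/(_ 1); rewrite !mxE /= => e.
by rewrite e ltxx in g00.
Qed.

End LorentzPositivity.

(** * The central sphere congruence of a null immersion as a smooth real projection *)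

Section RealCore.
Variables (R : realType) (n : nat).
Local Notation T := ('rV[R]_2).
Local Notation V := ('rV[R]_n.+2).
Local Notation G := (lorentz_gram R n.+1).
Variables (U : set T) (oU : open U).
Implicit Types (x : T) (i j k l : 'I_2).

Lemma smooth_lorentz (a b : T -> V) : smooth U a -> smooth U b ->
  smooth_fun U (fun x => lorentz (a x) (b x)).
Proof.
move=> /(smoothP oU _).1 sa /(smoothP oU _).1 sb; apply: smooth_mxM => //.
  by apply: smooth_mxM => //; exact: smooth_mxcst.
exact: smooth_mxtr.
Qed.

Lemma spartial_lorentz (a b : T -> V) i x : differentiable a x -> differentiable b x ->
  spartial i (fun x => lorentz (a x) (b x)) x
  = lorentz (partial i a x) (b x) + lorentz (a x) (partial i b x).
Proof.
move=> da db; have dG : differentiable (fun x => a x *m G) x.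
  by apply: differentiable_mulmx => //; exact: differentiable_cst.
rewrite -(partial_entry i 0 0 (differentiable_mulmx dG (differentiable_tr db))).
rewrite partial_mulmx//; last exact: differentiable_tr.
rewrite partial_mulmx//.
by rewrite partial_cst mulmx0 addr0 partial_tr// mxE.
Qed.

Lemma spartial_cst i (c : R) x : spartial i (fun _ => c) x = 0.
Proof. exact: derive_cst. Qed.

Lemma spartial_cst_eq (h : T -> R) (c : R) i x : (forall y, U y -> h y = c) -> U x ->
  spartial i h x = 0.
Proof. by move=> hc Ux; rewrite (spartial_eq oU i (g := fun _ => c))// spartial_cst. Qed.

Lemma ord2_cases i : i = 0 \/ i = 1.
Proof. by case: i => -[|[|//]] p; [left|right]; exact/val_inj. Qed.

Lemma ord2_sum (W : nmodType) (F : 'I_2 -> W) : \sum_(i < 2) F i = F 0 + F 1.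
Proof.
rewrite big_ord_recl big_ord1; congr (F _ + F _).
by apply: val_inj.
Qed.

Lemma jacobian_gram (f : T -> V) x (u : V) i :
  (u *m G *m (jacobian f x)^T) 0 i = lorentz u (partial i f x).
Proof.
by rewrite /lorentz !mxE; apply: eq_bigr => k _; rewrite !mxE.
Qed.

Lemma metricE (f : T -> V) x : metric f x = jacobian f x *m G *m (jacobian f x)^T.
Proof.
apply/matrixP => i j; rewrite mxE -jacobian_gram [RHS]mxE [LHS]mxE.
apply: eq_bigr => k _; congr (_ * _); rewrite !mxE.
by apply: eq_bigr => l _; rewrite !mxE.
Qed.

Lemma metric_tr (f : T -> V) x : (metric f x)^T = metric f x.
Proof. by apply/matrixP => i j; rewrite !mxE; exact: lorentzC. Qed.

Lemma row_jacobian (f : T -> V) x i : row i (jacobian f x) = partial i f x.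
Proof. by apply/rowP => k; rewrite !mxE. Qed.

Lemma metric_entry (f : T -> V) x i j :
  metric f x i j = lorentz (partial i f x) (partial j f x).
Proof. by rewrite mxE. Qed.

Opaque partial lorentz metric Defs.jacobian.

Lemma smooth_gram_proj (p : nat) (E : T -> 'M[R]_(p, n.+2)) : smooth_mx U E ->
  (forall x, U x -> E x *m G *m (E x)^T \in unitmx) ->
  smooth_mx U (fun x => gram_proj (E x)).
Proof.
move=> sE nd; have sG : smooth_mx U (fun=> G) by exact: smooth_mxcst.
apply: (smooth_mxM oU) => //; apply: (smooth_mxM oU).
  by apply: (smooth_mxM oU) => //; exact: smooth_mxtr.
apply: (smooth_mxinv oU nd).
by do 2?apply: (smooth_mxM oU) => //; exact: smooth_mxtr.
Qed.

(** The data of a lift into S_v. The immersion condition is kept as positivity of the determinant of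
    the metric, which yields both the inverse metric and a nonzero area density. *)
Record null_immersion (f : T -> V) (v : V) : Prop := NullImmersion {
  null_immersion_smooth : smooth U f;
  null_immersion_null : forall x, U x -> lorentz (f x) (f x) = 0;
  null_immersion_height : forall x, U x -> lorentz (f x) v = -1;
  null_immersion_det : forall x, U x -> 0 < \det (metric f x) }.

Section Surface.
Variables (f : T -> V) (v : V).
Hypothesis Hf : null_immersion f v.

Let sf : smooth U f. Proof. exact: null_immersion_smooth Hf. Qed.
Let ff x : U x -> lorentz (f x) (f x) = 0. Proof. exact: (null_immersion_null Hf). Qed.
Let fv x : U x -> lorentz (f x) v = -1. Proof. exact: (null_immersion_height Hf). Qed.
Let detg x : U x -> 0 < \det (metric f x). Proof. exact: (null_immersion_det Hf). Qed.
Let sp i : smooth U (partial i f). Proof. exact: smooth_partial. Qed.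
Let df x : U x -> differentiable f x. Proof. exact: smooth_diff. Qed.
Let dfi i x : U x -> differentiable (partial i f) x. Proof. exact: smooth_diff. Qed.

Lemma lorentz_f_df i x : U x -> lorentz (f x) (partial i f x) = 0.
Proof.
move=> Ux; have := spartial_lorentz i (df Ux) (df Ux).
rewrite (spartial_cst_eq i ff Ux) lorentzC => /esym/eqP.
by rewrite -mulr2n mulrn_eq0 /= => /eqP.
Qed.

Lemma lorentz_f_ddf i j x : U x ->
  lorentz (f x) (partial i (partial j f) x) = - metric f x i j.
Proof.
move=> Ux; have := spartial_lorentz i (df Ux) (dfi j Ux).
rewrite (spartial_cst_eq i (lorentz_f_df j) Ux) -metric_entry => /esym/eqP.
by rewrite addrC addr_eq0 => /eqP.
Qed.

Lemma lorentz_v_df i x : U x -> lorentz v (partial i f x) = 0.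
Proof.
move=> Ux; have := spartial_lorentz i (df Ux) (differentiable_cst v x).
by rewrite (spartial_cst_eq i fv Ux) partial_cst lorentz0r addr0 lorentzC.
Qed.

Lemma ddf_sym i j x : U x -> partial i (partial j f) x = partial j (partial i f) x.
Proof. by move=> Ux; exact: (smooth_partialC oU). Qed.

Lemma unit_metric x : U x -> metric f x \in unitmx.
Proof. by move=> Ux; rewrite unitmxE unitfE gt_eqF// detg. Qed.

Lemma f_jacobian x : U x -> f x *m G *m (jacobian f x)^T = 0.
Proof. by move=> Ux; apply/rowP => i; rewrite jacobian_gram mxE lorentz_f_df. Qed.

(** The Laplacian of [f] up to tangent terms: no derivative of the area density or of the inverse
    metric appears. Modulo <f, df> this loses nothing, so together with [f] and [df] it spans the
    same space. *)
Definition trace_ddf x : V :=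
  \sum_(i < 2) \sum_(j < 2) invmx (metric f x) i j *: partial i (partial j f) x.

(** Contract (f, d_i d_j f) = - g_ij with the inverse metric, the trace of the identity being 2. In
    particular the trace vector is transverse to the hyperplane orthogonal to [f]. *)
Lemma lorentz_f_trace x : U x -> lorentz (f x) (trace_ddf x) = - 2.
Proof.
move=> Ux; rewrite /trace_ddf lorentz_sumr.
have -> : (2 : R) = \tr (invmx (metric f x) *m metric f x).
  by rewrite mulVmx ?unit_metric// mxtrace1.
rewrite /mxtrace -sumrN; apply: eq_bigr => i _.
rewrite lorentz_sumr mxE -sumrN; apply: eq_bigr => j _.
rewrite lorentzZr lorentz_f_ddf// mulrN; congr (- (_ * _)).
by rewrite -[in LHS](metric_tr f x) mxE.
Qed.

Definition csc_frame x := null_frame (f x) (jacobian f x) (trace_ddf x).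
Definition csc_proj x := gram_proj (csc_frame x).
Local Notation P := csc_proj.

Lemma csc_frame_nondeg x : U x -> csc_frame x *m G *m (csc_frame x)^T \in unitmx.
Proof.
move=> Ux; apply: null_frame_nondeg; rewrite ?ff ?f_jacobian//.
  by rewrite lorentz_f_trace// oppr_eq0 pnatr_eq0.
by rewrite -metricE unit_metric.
Qed.

Lemma orthoproj_csc x : U x -> orthoproj (P x).
Proof. by move=> Ux; apply: orthoproj_gram; exact: csc_frame_nondeg. Qed.

Lemma sub_csc_proj x p (A : 'M[R]_(p, n.+2)) : U x -> reflect (A *m P x = A) (A <= csc_frame x)%MS.
Proof.
move=> Ux; apply: sub_orthoproj; first exact: orthoproj_csc.
by apply: gram_proj_eqmx; exact: csc_frame_nondeg.
Qed.

Lemma csc_proj_tangent x p (A : 'M[R]_(p, n.+2)) : U x ->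
  (A <= col_mx (f x) (jacobian f x))%MS -> A *m P x = A.
Proof.
move=> Ux /submxP[D ->]; apply/(sub_csc_proj _ Ux)/submxP.
exists (row_mx (lsubmx D) (row_mx (rsubmx D) 0)).
by rewrite /csc_frame /null_frame !mul_row_col mul0mx addr0 -{1}[D]hsubmxK mul_row_col.
Qed.

Lemma sub_tangent_f x : (f x <= col_mx (f x) (jacobian f x))%MS.
Proof. by rewrite -addsmxE addsmxSl. Qed.

Lemma sub_tangent_df i x : (partial i f x <= col_mx (f x) (jacobian f x))%MS.
Proof.
by rewrite -addsmxE -(row_jacobian f x i); apply: submx_trans (row_sub _ _) (addsmxSr _ _).
Qed.

Lemma csc_proj_f x : U x -> f x *m P x = f x.
Proof. by move=> Ux; apply: csc_proj_tangent => //; exact: sub_tangent_f. Qed.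

Lemma csc_proj_df i x : U x -> partial i f x *m P x = partial i f x.
Proof. by move=> Ux; apply: csc_proj_tangent => //; exact: sub_tangent_df. Qed.

Lemma csc_proj_trace x : U x -> trace_ddf x *m P x = trace_ddf x.
Proof.
move=> Ux; apply/(sub_csc_proj _ Ux)/submxP; exists (row_mx 0 (row_mx 0 1%:M)).
by rewrite /csc_frame /null_frame !mul_row_col !mul0mx !add0r mul1mx.
Qed.

Lemma smooth_jacobian : smooth_mx U (jacobian f).
Proof.
by move=> k l; under eq_fun do rewrite mxE; exact: (smoothP oU _).1 (sp k) 0 l.
Qed.

Lemma smooth_invmetric : smooth_mx U (fun x => invmx (metric f x)).
Proof.
apply: (smooth_mxinv oU unit_metric).
have -> : metric f = fun x => jacobian f x *m G *m (jacobian f x)^T.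
  by apply/funext => x; exact: metricE.
apply: (smooth_mxM oU); last exact: smooth_mxtr smooth_jacobian.
by apply: (smooth_mxM oU); [exact: smooth_jacobian|exact: smooth_mxcst].
Qed.

Lemma smooth_trace : smooth_mx U trace_ddf.
Proof.
apply: (smooth_mxsum oU) => i; apply: (smooth_mxsum oU) => j.
by apply: (smooth_mxscale oU); [exact: smooth_invmetric|exact/(smoothP oU _)/smooth_partial].
Qed.

Lemma smooth_csc_proj : smooth U P.
Proof.
apply/(smoothP oU _); apply: smooth_gram_proj csc_frame_nondeg.
apply: smooth_mxcol; first exact/(smoothP oU _).
by apply: smooth_mxcol; [exact: smooth_jacobian|exact: smooth_trace].
Qed.

End Surface.

End RealCore.

(** * The mean curvature vector in the space form and the component of v normal to S *)

Section MeanCurvature.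
Variables (R : realType) (n : nat).
Local Notation T := ('rV[R]_2).
Local Notation V := ('rV[R]_n.+2).
Local Notation G := (lorentz_gram R n.+1).
Variables (U : set T) (oU : open U) (f : T -> V) (v : V).
Hypothesis Hf : null_immersion U f v.
Implicit Types (x : T) (i j : 'I_2).

Local Notation P := (csc_proj f).
Let ff x : U x -> lorentz (f x) (f x) = 0. Proof. exact: (null_immersion_null Hf). Qed.
Let fv x : U x -> lorentz (f x) v = -1. Proof. exact: (null_immersion_height Hf). Qed.
Let df x : U x -> differentiable f x.
Proof. by move=> Ux; apply: (smooth_diff (U := U)) => //; exact: null_immersion_smooth Hf. Qed.

(** Its image <f, df, v> is the orthogonal complement of the normal bundle of [f] in S_v. *)
Definition space_proj x := gram_proj (null_frame (f x) (jacobian f x) v).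
Local Notation Q := space_proj.

(** [J] is kept general because two cases occur: the Jacobian of [f], and a matrix without rows,
    which gives the plane <f, v> orthogonal to S_v. *)
Lemma space_frame_nondeg k (J : 'M[R]_(k, n.+2)) x : U x -> f x *m G *m J^T = 0 ->
  J *m G *m J^T \in unitmx ->
  null_frame (f x) J v *m G *m (null_frame (f x) J v)^T \in unitmx.
Proof. by move=> Ux fJ JJ; apply: null_frame_nondeg; rewrite ?ff ?fv ?oppr_eq0 ?oner_eq0. Qed.

Lemma space_frame_nondeg2 x : U x ->
  null_frame (f x) (jacobian f x) v *m G *m (null_frame (f x) (jacobian f x) v)^T \in unitmx.
Proof.
move=> Ux; apply: space_frame_nondeg => //; first exact: f_jacobian Hf _ Ux.
by rewrite -metricE; exact: unit_metric Hf _ Ux.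
Qed.

Lemma orthoproj_space x : U x -> orthoproj (Q x).
Proof. by move=> Ux; apply: orthoproj_gram; exact: space_frame_nondeg2. Qed.

Lemma sub_space_proj x p (A : 'M[R]_(p, n.+2)) : U x ->
  reflect (A *m Q x = A) (A <= null_frame (f x) (jacobian f x) v)%MS.
Proof.
move=> Ux; apply: sub_orthoproj; first exact: orthoproj_space.
by apply: gram_proj_eqmx; exact: space_frame_nondeg2.
Qed.

Lemma null_frame_sub k (u w : V) (J : 'M[R]_(k, n.+2)) :
  (null_frame u J w :=: u + J + w)%MS.
Proof.
rewrite /null_frame -addsmxA; apply: eqmx_trans (eqmx_sym (addsmxE _ _)) _.
by apply: adds_eqmx => //; apply: eqmx_sym; exact: addsmxE.
Qed.

Lemma space_proj_f x : U x -> f x *m Q x = f x.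
Proof.
move=> Ux; apply/(sub_space_proj _ Ux); rewrite null_frame_sub.
by rewrite -addsmxA addsmxSl.
Qed.

Lemma space_proj_jacobian x : U x -> jacobian f x *m Q x = jacobian f x.
Proof.
move=> Ux; apply/(sub_space_proj _ Ux); rewrite null_frame_sub.
by apply: submx_trans (addsmxSl _ _); exact: addsmxSr.
Qed.

Lemma space_proj_v x : U x -> v *m Q x = v.
Proof.
move=> Ux; apply/(sub_space_proj _ Ux); rewrite null_frame_sub; exact: addsmxSr.
Qed.

(* Both the central sphere congruence and <f, v, df> are obtained from
   <f, df> by adding a vector transverse to the hyperplane f^perp. *)
Lemma csc_space_projE x (u : V) : U x -> lorentz u (f x) = 0 ->
  (u *m P x = u) <-> (u *m Q x = u).
Proof.
move=> Ux uf; have [fJ JJ] := (f_jacobian oU Hf Ux, unit_metric Hf Ux).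
split=> [/(sub_csc_proj oU Hf _ Ux)|/(sub_space_proj _ Ux)].
  move/(sub_null_frame_tangent (ff Ux) fJ); rewrite (lorentz_f_trace oU Hf Ux).
  move=> /(_ _ uf) H; apply/(sub_space_proj _ Ux).
  rewrite null_frame_sub; apply: submx_trans (addsmxSl _ _).
  by rewrite addsmxE; apply: H; rewrite oppr_eq0 pnatr_eq0.
move/(sub_null_frame_tangent (ff Ux) fJ); rewrite (fv Ux) => /(_ _ uf) H.
by apply: (csc_proj_tangent oU Hf) => //; apply: H; rewrite oppr_eq0 oner_eq0.
Qed.

Let perp_sum k l (A : 'M[R]_(k, n.+2)) (B : 'M[R]_(l, n.+2)) :
  (perp A :&: perp B :=: perp (col_mx A B))%MS.
Proof.
apply/eqmxP/andP; split.
  apply/sub_perp; rewrite tr_col_mx mul_mx_row.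
  have /sub_perp -> := capmxSl (perp A) (perp B).
  by have /sub_perp -> := capmxSr (perp A) (perp B); rewrite row_mx0.
have /sub_perp : (perp (col_mx A B) <= perp (col_mx A B))%MS by [].
rewrite tr_col_mx mul_mx_row -[0]row_mx0 => /eq_row_mx[/sub_perp a /sub_perp b].
by rewrite sub_capmx a b.
Qed.

(** Since <f, v> lies in the image of [Q], the normal bundle of [f] lies in the tangent space of
    S_v: the Levi-Civita projection may be dropped in front of the normal one. *)
Lemma oproj_tangent x : U x -> oproj (space_form_tangent v (f x)) *m (1%:M - Q x) = 1%:M - Q x.
Proof.
move=> Ux; pose E0 := null_frame (f x) (0 : 'M[R]_(0, n.+2)) v.
have nd : E0 *m G *m E0^T \in unitmx.
  apply: space_frame_nondeg => //; first by rewrite trmx0 mulmx0.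
  by rewrite unitmxE det_mx00 unitr1.
have E0E : (col_mx (f x) v :=: E0)%MS.
  apply: eqmx_trans (eqmx_sym (addsmxE _ _)) _.
  apply: eqmx_trans _ (eqmx_sym (null_frame_sub _ _ _)).
  by apply: adds_eqmx => //; apply: eqmx_sym; exact: addsmx0.
rewrite /space_form_tangent (oproj_perp (orthoproj_gram nd)); last first.
  exact: eqmx_trans E0E (gram_proj_eqmx nd).
suff E : gram_proj E0 *m Q x = gram_proj E0.
  by rewrite mulmxBl mul1mx mulmxBr mulmx1 E subrr subr0.
apply/(sub_space_proj _ Ux); rewrite -(gram_proj_eqmx nd) !null_frame_sub.
rewrite !addsmx_sub sub0mx andbT -addsmxA addsmxSl /= addsmxA.
exact: addsmxSr.
Qed.

Lemma oproj_normal x : U x -> oproj (Defs.normal_space v f x) = 1%:M - Q x.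
Proof.
move=> Ux; have nd := space_frame_nondeg2 Ux; apply: oprojE.
  by apply: orthoprojC; exact: orthoproj_space.
rewrite /Defs.normal_space /space_form_tangent; apply: eqmx_trans (perp_sum _ _) _.
apply: perp_orthoproj; first exact: orthoproj_space.
apply: eqmx_trans _ (gram_proj_eqmx nd).
apply: eqmx_trans _ (eqmx_sym (null_frame_sub _ _ _)).
apply: eqmx_trans (eqmx_sym (addsmxE _ _)) _.
apply: eqmx_trans (adds_eqmx (eqmx_sym (addsmxE _ _)) (eqmx_refl _)) _.
by rewrite -!addsmxA [(v + _)%MS]addsmxC; exact: eqmx_refl.
Qed.

Lemma second_fundamental_formE i j x : U x ->
  second_fundamental_form v f i j x = partial i (partial j f) x *m (1%:M - Q x).
Proof.
move=> Ux; rewrite /second_fundamental_form /space_form_connection.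
by rewrite oproj_normal// -mulmxA oproj_tangent.
Qed.

Lemma mean_curvatureE x : U x ->
  mean_curvature v f x = 2^-1 *: (trace_ddf f x *m (1%:M - Q x)).
Proof.
move=> Ux; congr (_ *: _); rewrite /trace_ddf mulmx_suml; apply: eq_bigr => i _.
rewrite mulmx_suml; apply: eq_bigr => j _.
by rewrite second_fundamental_formE// -scalemxAl.
Qed.

Lemma normal_connectionE (xi : T -> V) i x : U x ->
  normal_connection v f xi i x = partial i xi x *m (1%:M - Q x).
Proof.
move=> Ux; rewrite /normal_connection /space_form_connection.
by rewrite oproj_normal// -mulmxA oproj_tangent.
Qed.

Let sf : smooth_mx U f. Proof. exact: (smoothP oU _).1 (null_immersion_smooth Hf). Qed.

Lemma smooth_space_proj : smooth_mx U Q.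
Proof.
apply: (smooth_gram_proj oU); last exact: space_frame_nondeg2.
by do 2?apply: smooth_mxcol => //; [exact: smooth_jacobian Hf|exact: smooth_mxcst].
Qed.

Lemma smooth_mean_curvature : smooth U (mean_curvature v f).
Proof.
apply: (smooth_eq oU (M := fun x => 2^-1 *: (trace_ddf f x *m (1%:M - Q x)))).
  by move=> x Ux; rewrite mean_curvatureE.
apply/(smoothP oU _); apply: (smooth_mxscale oU) => [p|]; first exact: ksmooth_cst.
apply: (smooth_mxM oU); first exact: smooth_trace Hf.
by apply: (smooth_mxB oU); [exact: smooth_mxcst|exact: smooth_space_proj].
Qed.

Local Notation H := (mean_curvature v f).

Lemma mean_curvature_perp (w : V) x : U x -> w *m Q x = w -> lorentz (H x) w = 0.
Proof.
move=> Ux wQ; rewrite mean_curvatureE// lorentzZl.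
rewrite (orthoproj_lorentz _ _ (orthoprojC (orthoproj_space Ux))).
by rewrite mulmxBr mulmx1 wQ subrr lorentz0r mulr0.
Qed.

Lemma mean_curvature_trace x : U x -> lorentz (H x) (trace_ddf f x) = 2 * lorentz (H x) (H x).
Proof.
move=> Ux; have oQ := orthoprojC (orthoproj_space Ux).
have HQ : H x *m (1%:M - Q x) = H x.
  by rewrite mean_curvatureE// -scalemxAl -mulmxA oQ.1.
rewrite {3}mean_curvatureE// lorentzZr mulrA divff ?pnatr_eq0// mul1r.
by rewrite -(orthoproj_lorentz _ _ oQ) HQ.
Qed.

Definition vperp x : V := v *m (1%:M - P x).

(** Shown by checking that [xi] is orthogonal to S and that [v + xi] lies in S. The coefficient of
    [f] is fixed by orthogonality to the trace vector, which pairs to 2 (H,H) with H and to -2 with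
    [f]. *)
Lemma vperpE x : U x -> vperp x = - (H x + lorentz (H x) (H x) *: f x).
Proof.
move=> Ux; set xi := H x + _.
have xiP : xi *m P x = 0.
  apply/(sub_perp_orthoproj _ (orthoproj_csc oU Hf Ux) (gram_proj_eqmx (csc_frame_nondeg oU Hf Ux))).
  apply/sub_perp; rewrite /csc_frame /null_frame !tr_col_mx !mul_mx_row.
  rewrite -[RHS]row_mx0; congr row_mx.
    apply/lorentz0P; rewrite lorentzDl lorentzZl (ff Ux) mulr0 addr0.
    by rewrite (mean_curvature_perp Ux (space_proj_f Ux)).
  rewrite -[RHS]row_mx0; congr row_mx.
    apply/rowP => i; rewrite jacobian_gram mxE lorentzDl lorentzZl.
    rewrite (lorentz_f_df oU Hf _ Ux) mulr0 addr0 (mean_curvature_perp Ux)//.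
    by rewrite -(row_jacobian f x i) -row_mul space_proj_jacobian.
  apply/lorentz0P; rewrite lorentzDl lorentzZl (lorentz_f_trace oU Hf Ux).
  by rewrite mean_curvature_trace// mulrN mulrC subrr.
have vxi : (v + xi) *m P x = v + xi.
  have oQ := orthoproj_space Ux.
  (* Both the trace vector and 2v pair to -2 with [f], so [u] is orthogonal to [f]; lying in <f, df,
     v>, it is therefore in <f, df>, hence in S. *)
  pose u := trace_ddf f x *m Q x - 2 *: v.
  have uQ : u *m Q x = u by rewrite mulmxBl -mulmxA oQ.1 -scalemxAl space_proj_v.
  have uf : lorentz u (f x) = 0.
    rewrite lorentzBl (orthoproj_lorentz _ _ oQ) space_proj_f// lorentzZl.
    by rewrite lorentzC (lorentz_f_trace oU Hf Ux) (lorentzC v) fv// mulrN1 opprK addNr.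
  have uP := (csc_space_projE Ux uf).2 uQ.
  have -> : v + xi = 2^-1 *: trace_ddf f x - 2^-1 *: u + lorentz (H x) (H x) *: f x.
    rewrite addrA; congr (_ + _); rewrite mean_curvatureE// /u mulmxBr mulmx1.
    rewrite !scalerBr scalerA mulVf ?pnatr_eq0// scale1r opprB addrC.
    by rewrite -addrA [- _ + v]addrC.
  rewrite !mulmxDl mulNmx -!scalemxAl uP.
  by rewrite (csc_proj_trace oU Hf Ux) (csc_proj_f oU Hf Ux).
have -> : vperp x = (v + xi) *m (1%:M - P x) - xi *m (1%:M - P x).
  by rewrite -mulmxBl addrK.
by rewrite !mulmxBr !mulmx1 vxi xiP subrr sub0r subr0.
Qed.

Lemma smooth_vperp : smooth U vperp.
Proof.
apply/(smoothP oU _); apply: (smooth_mxM oU); first exact: smooth_mxcst.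
apply: (smooth_mxB oU); first exact: smooth_mxcst.
exact/(smoothP oU _)/(smooth_csc_proj oU Hf).
Qed.

Lemma lorentz_dmean_f i x : U x -> lorentz (partial i H x) (f x) = 0.
Proof.
move=> Ux; have dH := smooth_diff smooth_mean_curvature Ux.
have Hf0 y : U y -> lorentz (H y) (f y) = 0.
  by move=> Uy; exact: mean_curvature_perp Uy (space_proj_f Uy).
have := spartial_lorentz i dH (df Ux); rewrite (spartial_cst_eq oU i Hf0 Ux).
rewrite (mean_curvature_perp Ux) ?addr0 // -(row_jacobian f x i).
by rewrite -row_mul space_proj_jacobian.
Qed.

(** In the derivative of -(H + (H,H) f) the terms in [f] and [df] lie in S, so only dH leaves a
    component in S^perp. *)
Lemma dvperp_normal i x : U x ->
  partial i vperp x *m (1%:M - P x) = - (partial i H x *m (1%:M - P x)).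
Proof.
move=> Ux; have dH := smooth_diff smooth_mean_curvature Ux.
have dHH : differentiable (fun x => lorentz (H x) (H x)) x.
  exact: ksmooth_diff (smooth_lorentz oU smooth_mean_curvature smooth_mean_curvature 0) Ux.
have dHf : differentiable (fun x => lorentz (H x) (H x) *: f x) x.
  by apply: differentiable_scale => //; exact: df.
rewrite (partial_eq i oU vperpE Ux) partialN; last exact: differentiableD.
rewrite (partialD i dH dHf) (partial_scale i dHH (df Ux)).
have : f x *m (1%:M - P x) = 0 by rewrite mulmxBr mulmx1 (csc_proj_f oU Hf Ux) subrr.
have : partial i f x *m (1%:M - P x) = 0.
  by rewrite mulmxBr mulmx1 (csc_proj_df oU Hf _ Ux) subrr.
move: (1%:M - P x) (partial i f x) (f x) (partial i H x) => N a b c aN bN.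
by rewrite mulNmx !mulmxDl -!scalemxAl aN bN !scaler0 !addr0.
Qed.

(** The two sides project dH along different complements, by 1 - P and by 1 - Q. As dH is orthogonal
    to [f], it lies in the image of P exactly when it lies in that of Q. *)
Lemma parallel_mean_curvatureP :
  parallel_mean_curvature v U f <->
  forall i x, U x -> partial i vperp x *m (1%:M - P x) = 0.
Proof.
have E i x : U x -> partial i vperp x *m (1%:M - P x) = 0 <-> normal_connection v f H i x = 0.
  move=> Ux; rewrite dvperp_normal// normal_connectionE// !mulmxBr !mulmx1.
  have := csc_space_projE Ux (lorentz_dmean_f i Ux).
  set a := _ *m _; set b := _ *m _ => ab.
  split=> [/eqP|/eqP]; rewrite ?oppr_eq0 subr_eq0 => /eqP e.
    by rewrite ab.1 ?subrr.
  by rewrite ab.2 ?subrr ?oppr0.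
by split=> pm ? ? Ux; apply/E => //; exact: pm.
Qed.

End MeanCurvature.

(** * The connection D and the form N of an orthogonal splitting, through its projection *)

Section Splitting.
Variables (R : realType) (m : nat).
Local Notation T := ('rV[R]_2).
Local Notation End := ('M[R]_m.+1).
Local Notation G := (lorentz_gram R m).
Variables (U : set T) (oU : open U) (P : T -> End).
Hypotheses (oP : forall x, U x -> orthoproj (P x)) (sP : smooth U P).
Implicit Types (x : T) (i j : 'I_2).

Definition split_conn a i (s : T -> 'M[R]_(a.+1, m.+1)) x : 'M[R]_(a.+1, m.+1) :=
  partial i (fun y => s y *m P y) x *m P x
  + partial i (fun y => s y *m (1%:M - P y)) x *m (1%:M - P x).

(** This is d - D read on constant vectors. Up to sign 1 - 2P is the reflection in S, so N equals dP
    on S and - dP on S^perp. *)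
Definition split_form i x : End := partial i P x *m (1%:M - 2 *: P x).
Local Notation N := split_form.

(** The signs come from D s = ds - s N and from the right action: s (D A) = D (s A) - (D s) A. *)
Definition split_connEnd i (A : T -> End) x : End :=
  partial i A x - A x *m N i x + N i x *m A x.

Definition split_dD (omega : 'I_2 -> T -> End) x : End :=
  split_connEnd 0 (omega 1) x - split_connEnd 1 (omega 0) x.

Let dP x : U x -> differentiable P x. Proof. exact: smooth_diff. Qed.
Let PP x : U x -> P x *m P x = P x. Proof. by case/oP. Qed.

Lemma dprojE i x : U x -> partial i P x *m P x + P x *m partial i P x = partial i P x.
Proof.
move=> Ux; rewrite -(partial_mulmx i (dP Ux) (dP Ux)).
exact: (partial_eq i oU PP Ux).
Qed.

(** Multiply the derivative of P P = P by P on the left: the derivative of a projection maps the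
    image into the kernel. *)
Lemma proj_dproj_proj i x : U x -> P x *m partial i P x *m P x = 0.
Proof.
move=> Ux; have /(congr1 (mulmx (P x))) := dprojE i Ux; rewrite mulmxDr !mulmxA PP//.
by move/(canRL (addrK _)); rewrite subrr.
Qed.

Lemma dproj_adj i x : U x -> partial i P x *m G = G *m (partial i P x)^T.
Proof.
move=> Ux; have dG : differentiable (fun=> G) x by exact: differentiable_cst.
have := partial_mulmx i (dP Ux) dG; rewrite partial_cst mulmx0 addr0 => <-.
rewrite -(partial_tr i (dP Ux)).
have := partial_mulmx i dG (differentiable_tr (dP Ux)); rewrite partial_cst mul0mx add0r => <-.
by apply: (partial_eq i oU _ Ux) => y /oP[].
Qed.

Lemma split_connE a i (s : T -> 'M[R]_(a.+1, m.+1)) x : U x -> differentiable s x ->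
  split_conn i s x = partial i s x - s x *m N i x.
Proof.
move=> Ux ds; have dC : differentiable (fun y => 1%:M - P y) x.
  by apply: differentiableB; [exact: differentiable_cst|exact: dP].
rewrite /split_conn /N (partial_mulmx i ds (dP Ux)) (partial_mulmx i ds dC).
rewrite partialB; [|exact: differentiable_cst|exact: dP].
rewrite partial_cst sub0r; move: (partial i s x) (partial i P x) (s x) => d p w.
have C2 := (orthoprojC (oP Ux)).1.
rewrite mulmxN !mulmxDl mulNmx -[d *m _ *m _]mulmxA PP// -[d *m _ *m _]mulmxA C2.
rewrite [w *m (p *m _)]mulmxA !mulmxBr !mulmx1 -scalemxAr.
move: (d *m P x) (w *m p *m P x) (w *m p) => a1 a2 a3.
by apply/matrixP => k l; rewrite !mxE; ring.
Qed.

Lemma dproj_split i x : U x ->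
  (1%:M - 2 *: P x) *m partial i P x = - (partial i P x *m (1%:M - 2 *: P x)).
Proof.
move=> Ux; have := dprojE i Ux; move: (partial i P x) => p pE.
rewrite mulmxBl mulmxBr mul1mx mulmx1 -scalemxAl -scalemxAr.
rewrite -{1 3}pE; move: (p *m _) (_ *m p) => a b.
by apply/matrixP => k l; rewrite !mxE; ring.
Qed.

Lemma split_invol x : U x -> (1%:M - 2 *: P x) *m (1%:M - 2 *: P x) = 1%:M.
Proof.
move=> Ux; rewrite mulmxBl mul1mx -scalemxAl mulmxBr mulmx1 -scalemxAr PP//.
by move: (P x) => p; apply/matrixP => k l; rewrite !mxE; ring.
Qed.

(** N is the product of dP and 1 - 2P, both self-adjoint and anticommuting with each other. *)
Lemma split_form_skew i x : U x -> N i x *m G = - (G *m (N i x)^T).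
Proof.
move=> Ux; have [_ PG] := oP Ux.
have RG : (1%:M - 2 *: P x) *m G = G *m (1%:M - 2 *: P x)^T.
  rewrite mulmxBl mul1mx -scalemxAl PG [(_ - _)^T]linearB /= trmx1 mulmxBr mulmx1.
  by rewrite [(_ *: _)^T]linearZ /= -scalemxAr.
rewrite /N trmx_mul mulmxA -RG -!mulmxA -dproj_adj// [in RHS]mulmxA dproj_split//.
by rewrite mulNmx opprK -!mulmxA RG.
Qed.

Lemma split_form_proj a i (w : 'M[R]_(a, m.+1)) x : U x -> w *m P x = w ->
  w *m N i x = w *m partial i P x.
Proof.
move=> Ux wP; rewrite /N mulmxA mulmxBr mulmx1 -scalemxAr -{2}wP -!mulmxA.
by rewrite (mulmxA (P x)) proj_dproj_proj// mulmx0 scaler0 subr0.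
Qed.

Lemma split_form_section a i (s : T -> 'M[R]_(a.+1, m.+1)) x :
  (forall y, U y -> s y *m P y = s y) -> U x -> differentiable s x ->
  s x *m N i x = partial i s x *m (1%:M - P x).
Proof.
move=> sPE Ux ds; rewrite split_form_proj; [|by []|exact: sPE].
have := partial_mulmx i ds (dP Ux); rewrite (partial_eq i oU sPE Ux) => /esym E.
by rewrite mulmxBr mulmx1 -{1}E addrAC subrr add0r.
Qed.

Lemma split_form_perp a i (w : 'M[R]_(a, m.+1)) x : U x -> w *m P x = w ->
  w *m N i x *m P x = 0.
Proof.
move=> Ux wP; rewrite split_form_proj// -{1}wP -!mulmxA (mulmxA (P x)).
by rewrite proj_dproj_proj// mulmx0.
Qed.

Lemma split_form_tangent a i (w : 'M[R]_(a, m.+1)) x : U x -> w *m P x = 0 ->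
  w *m N i x *m P x = w *m N i x.
Proof.
move=> Ux wP; have := congr1 (mulmx w) (dprojE i Ux).
rewrite mulmxDr [w *m (P x *m _)]mulmxA wP mul0mx addr0 => wp.
have wN : w *m N i x = - (w *m partial i P x).
  rewrite /N mulmxBr mulmx1 -scalemxAr mulmxBr -scalemxAr wp.
  by move: (w *m _) => b; apply/matrixP => k l; rewrite !mxE; ring.
by rewrite wN mulNmx -mulmxA wp.
Qed.

Lemma smooth_split_form i : smooth U (N i).
Proof.
have sP' := (smoothP oU _).1 sP.
apply/(smoothP oU _); apply: (smooth_mxM oU).
  by apply/(smoothP oU _); exact: smooth_partial.
apply: (smooth_mxB oU); first exact: smooth_mxcst.
by apply: (smooth_mxscale oU) => // k; exact: ksmooth_cst.
Qed.

Lemma split_connEnd_mul a i (s : T -> 'M[R]_(a.+1, m.+1)) (A : T -> End) x :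
  differentiable s x -> differentiable A x ->
  s x *m split_connEnd i A x
  = partial i (fun y => s y *m A y) x - s x *m A x *m N i x
    - (partial i s x - s x *m N i x) *m A x.
Proof.
move=> ds dA; rewrite (partial_mulmx i ds dA) /split_connEnd.
move: (partial i A x) (N i x) (partial i s x) (A x) (s x) => A' N' s' A0 s0.
rewrite mulmxDr mulmxBr mulmxBl !mulmxA.
move: (s0 *m A') (s0 *m A0 *m N') (s0 *m N' *m A0) (s' *m A0) => b1 b2 b3 b4.
by apply/matrixP => k l; rewrite !mxE; ring.
Qed.

(* The Codazzi equation of the splitting, from the flatness of d. *)
Lemma split_dD_form x : U x -> split_dD N x = 0.
Proof.
move=> Ux; have dR : differentiable (fun y => 1%:M - 2 *: P y) x.
  apply: differentiableB; first exact: differentiable_cst.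
  by apply: differentiableZ; exact: dP.
have dp i : differentiable (partial i P) x by apply: smooth_diff Ux; exact: smooth_partial.
have dN i j : partial i (N j) x
    = partial i (partial j P) x *m (1%:M - 2 *: P x) - 2 *: (partial j P x *m partial i P x).
  rewrite (partial_mulmx i (dp j) dR); congr (_ + _).
  rewrite partialB; [|exact: differentiable_cst|by apply: differentiableZ; exact: dP].
  by rewrite partial_cst sub0r partialZ ?mulmxN -?scalemxAr//; exact: dP.
(* Moving one reflection past dP costs a sign, and the two reflections then cancel. *)
have NN i j : N i x *m N j x = - (partial i P x *m partial j P x).
  have := dproj_split j Ux; have := split_invol Ux; rewrite /split_form.
  move: (partial i P x) (partial j P x) (1%:M - 2 *: P x) => p p' r rr pr.
  by rewrite -mulmxA [r *m (p' *m r)]mulmxA pr mulNmx mulmxN -[p' *m r *m r]mulmxA rr mulmx1.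
have alg (n01 n10 q q' r a b c d : End) :
    n01 = q' *m r - 2 *: a -> n10 = q *m r - 2 *: b -> q = q' ->
    c = - b -> d = - a -> n01 - d + c - (n10 - c + d) = 0.
  move=> -> -> -> -> ->; move: (q' *m r) => b1.
  by apply/matrixP => k l; rewrite !mxE; ring.
exact (alg _ _ _ _ _ _ _ _ _ (dN 0 1) (dN 1 0) (smooth_partialC oU 1 0 sP Ux) (NN 0 1) (NN 1 0)).
Qed.

End Splitting.

(** * Two-by-two matrices: the area form and rotation of tracefree tensors *)

Section TwoByTwo.
Variable (F : fieldType).
Implicit Types (g A : 'M[F]_2).

Definition eps2 : 'M[F]_2 := delta_mx 0 1 - delta_mx 1 0.

Lemma mul_eps2 g i : ((g *m eps2) i 0 = - g i 1) * ((g *m eps2) i 1 = g i 0).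
Proof.
by split; rewrite !mxE !ord2_sum !mxE /=; ring.
Qed.

Lemma eps2_mul A i : ((eps2 *m A) 0 i = A 1 i) * ((eps2 *m A) 1 i = - A 0 i).
Proof.
by split; rewrite !mxE !ord2_sum !mxE /=; ring.
Qed.

Lemma matrix2P (A B : 'M[F]_2) :
  A 0 0 = B 0 0 -> A 0 1 = B 0 1 -> A 1 0 = B 1 0 -> A 1 1 = B 1 1 -> A = B.
Proof.
move=> e00 e01 e10 e11; apply/matrixP => i j.
by have [-> | ->] := ord2_cases i; have [-> | ->] := ord2_cases j.
Qed.

(** [eps2] is the area form of the plane, on which a linear map acts infinitesimally by its
    trace. *)
Lemma tr_eps2 A : A^T *m eps2 + eps2 *m A = \tr A *: eps2.
Proof.
rewrite /mxtrace ord2_sum.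
by apply: matrix2P; rewrite [LHS]mxE !mul_eps2 !eps2_mul !mxE /=; ring.
Qed.

Lemma invmx2 g : \det g != 0 ->
  [/\ invmx g 0 0 = (\det g)^-1 * g 1 1, invmx g 0 1 = - ((\det g)^-1 * g 0 1),
      invmx g 1 0 = - ((\det g)^-1 * g 1 0) & invmx g 1 1 = (\det g)^-1 * g 0 0].
Proof.
move=> d0; have ug : g \in unitmx by rewrite unitmxE unitfE.
pose B : 'M[F]_2 := \matrix_(i, j) ((\det g)^-1 *
  (if i == 0 then if j == 0 then g 1 1 else - g 0 1 else if j == 0 then - g 1 0 else g 0 0)).
have Bg : B *m g = 1%:M.
  have := d0; rewrite /B det2 => d0'.
  by apply: matrix2P; rewrite [LHS]mxE ord2_sum !mxE /=; field.
have -> : invmx g = B by rewrite -[LHS]mul1mx -Bg mulmxK.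
by rewrite /B; split; rewrite !mxE /= ?mulrN.
Qed.

(* In dimension 2 the rotation is self-adjoint for a symmetric tracefree h. *)
Lemma rotate_tracefree (V : lmodType F) g (h : 'I_2 -> 'I_2 -> V) :
  g^T = g -> \det g != 0 -> (forall i j, h i j = h j i) ->
  \sum_i \sum_j invmx g i j *: h i j = 0 ->
  forall i j, \sum_l (g *m eps2) i l *: h j l = \sum_l (g *m eps2) j l *: h i l.
Proof.
move=> gT d0 hs tr0.
have g01 : g 1 0 = g 0 1 by rewrite -[in LHS]gT mxE.
have tr1 : g 1 1 *: h 0 0 - g 0 1 *: h 0 1 - g 1 0 *: h 1 0 + g 0 0 *: h 1 1 = 0.
  have := congr1 ( *:%R (\det g)) tr0; rewrite scaler0 !ord2_sum.
  have [-> -> -> ->] := invmx2 d0; rewrite !scalerDr !scalerA !mulrN !mulrA divff// !mul1r.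
  by rewrite !scaleNr addrA.
have key : g 0 1 *: h 1 0 - g 0 0 *: h 1 1 = g 1 1 *: h 0 0 - g 1 0 *: h 0 1.
  move: tr1; rewrite (hs 1 0) => /eqP tr1.
  apply/esym/eqP; rewrite -subr_eq0 opprB addrA addrAC.
  by rewrite [X in X + _ == _]addrAC.
have main : \sum_l (g *m eps2) 0 l *: h 1 l = \sum_l (g *m eps2) 1 l *: h 0 l.
  rewrite !ord2_sum !mul_eps2 !scaleNr -[LHS]opprK opprD opprK key opprB addrC.
  by rewrite g01.
move=> i j; have [-> | ->] := ord2_cases i; have [-> | ->] := ord2_cases j => //.
Qed.

End TwoByTwo.

(** * Levi-Civita calculus in arbitrary coordinates: the complex structure is parallel *)

Section ComplexStructure.
Variables (R : realType) (n : nat).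
Local Notation T := ('rV[R]_2).
Local Notation V := ('rV[R]_n.+2).
Local Notation G := (lorentz_gram R n.+1).
Variables (U : set T) (oU : open U) (f : T -> V) (v : V).
Hypothesis Hf : null_immersion U f v.
Implicit Types (x : T) (i j k : 'I_2).

Local Notation jac := (jacobian f).
Local Notation g := (metric f).

Lemma smooth_jac : smooth U jac.
Proof. by apply/(smoothP oU _); exact: smooth_jacobian Hf. Qed.

(** Entry (j,k) of [christoffel i] is the Christoffel symbol with lower indices i, j and upper index
    k: row j holds the tangential coefficients of d_i d_j f. *)
Definition christoffel i x : 'M[R]_2 :=
  partial i jac x *m G *m (jac x)^T *m invmx (g x).
Local Notation Gam := christoffel.

Lemma smooth_metric : smooth U g.
Proof.
have -> : g = fun x => jac x *m G *m (jac x)^T by apply/funext => x; exact: metricE.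
have sj := smooth_jacobian oU Hf.
apply/(smoothP oU _); apply: (smooth_mxM oU); last exact: smooth_mxtr.
by apply: (smooth_mxM oU) => //; exact: smooth_mxcst.
Qed.

Lemma dmetric i x : U x ->
  partial i g x = Gam i x *m g x + (Gam i x *m g x)^T.
Proof.
move=> Ux; have ug := unit_metric Hf Ux.
have dj := smooth_diff smooth_jac Ux.
have dG : differentiable (fun=> G) x by exact: differentiable_cst.
have djG := differentiable_mulmx dj dG.
have gE y : U y -> g y = jac y *m G *m (jac y)^T by move=> _; exact: metricE.
rewrite (partial_eq i oU gE Ux) (partial_mulmx i djG (differentiable_tr dj)).
rewrite (partial_tr i dj) (partial_mulmx i dj dG) partial_cst mulmx0 addr0.
rewrite /christoffel mulmxKV//; congr (_ + _).
by rewrite !trmx_mul trmxK lorentz_gram_tr mulmxA.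
Qed.

Let detg x : U x -> 0 < \det (g x). Proof. exact: (null_immersion_det Hf). Qed.

Lemma area_gt0 x : U x -> 0 < area f x.
Proof. by move=> Ux; rewrite /area sqrtr_gt0; exact: detg. Qed.

Lemma differentiable_det x : U x -> differentiable (fun y => \det (g y)) x.
Proof.
move=> Ux; have sg := (smoothP oU _).1 smooth_metric.
exact: ksmooth_diff (smooth_det oU sg 0) Ux.
Qed.

Lemma differentiable_area x : U x -> differentiable (area f) x.
Proof.
move=> Ux; apply: (differentiable_comp (differentiable_det Ux)).
apply/derivable1_diffP.
by have [] := is_derive1_sqrt (detg Ux).
Qed.

(** Differentiate area^2 = det g and insert metric compatibility; this is the formula for the
    logarithmic derivative of the volume density. *)
Lemma darea i x : U x -> spartial i (area f) x = area f x * \tr (Gam i x).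
Proof.
move=> Ux; have dA := differentiable_area Ux; have A0 := area_gt0 Ux.
have dg k l : differentiable (fun y => g y k l) x.
  exact: (differentiable_mxP _ _).1 (smooth_diff smooth_metric Ux) k l.
have AA y : U y -> area f y * area f y = g y 0 0 * g y 1 1 - g y 0 1 * g y 1 0.
  by move=> Uy; rewrite -det2 -expr2; apply: sqr_sqrtr; exact: ltW (detg Uy).
have E : spartial i (fun y => area f y * area f y) x
    = spartial i (fun y => g y 0 0 * g y 1 1 - g y 0 1 * g y 1 0) x.
  exact (spartial_eq oU i AA Ux).
have dgE k l : spartial i (fun y => g y k l) x
    = (Gam i x *m g x) k l + (Gam i x *m g x) l k.
  by rewrite -(partial_entry i k l (smooth_diff smooth_metric Ux)) (dmetric i Ux) mxE [X in _ + X]mxE.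
have dM k l k' l' : differentiable (fun y => g y k l * g y k' l') x.
  exact: (differentiableM (dg k l) (dg k' l')).
have dd := etrans (spartialB i (dM 0 0 1 1) (dM 0 1 1 0))
  (congr2 (fun a b => a - b) (spartialM i (dg 0 0) (dg 1 1)) (spartialM i (dg 0 1) (dg 1 0))).
have alg (a da g00 g01 g10 g11 d00 d01 d10 d11 c00 c01 c10 c11 : R) : 0 < a -> g10 = g01 ->
    a * a = g00 * g11 - g01 * g10 ->
    d00 = (c00 * g00 + c01 * g10) + (c00 * g00 + c01 * g10) ->
    d01 = (c00 * g01 + c01 * g11) + (c10 * g00 + c11 * g10) ->
    d10 = (c10 * g00 + c11 * g10) + (c00 * g01 + c01 * g11) ->
    d11 = (c10 * g01 + c11 * g11) + (c10 * g01 + c11 * g11) ->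
    da * a + a * da = d00 * g11 + g00 * d11 - (d01 * g10 + g01 * d10) ->
    da = a * (c00 + c11).
  move=> a0 -> aa -> -> -> -> E'.
  apply: (mulfI (lt0r_neq0 a0)); apply: (mulfI (_ : 2 != 0)); first by rewrite pnatr_eq0.
  transitivity (da * a + a * da); first by ring.
  by rewrite E' (_ : 2 * _ = 2 * (a * a) * (c00 + c11)); [rewrite aa; ring | ring].
have g01 : g x 1 0 = g x 0 1 by rewrite -[in LHS](metric_tr f x) mxE.
rewrite /mxtrace ord2_sum.
have mE k l : (Gam i x *m g x) k l = Gam i x k 0 * g x 0 l + Gam i x k 1 * g x 1 l.
  by rewrite mxE ord2_sum.
have dgE' k l := etrans (dgE k l) (congr2 (fun a b => a + b) (mE k l) (mE l k)).
exact (alg _ _ _ _ _ _ _ _ _ _ _ _ _ _ (area_gt0 Ux) g01 (AA x Ux) (dgE' 0 0) (dgE' 0 1)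
  (dgE' 1 0) (dgE' 1 1) (etrans (esym (spartialM i dA dA)) (etrans E dd))).
Qed.

Local Notation Jc := (complex_structure f).

Lemma scalerKV_neq0 (W : lmodType R) (w : W) (a : R) : a != 0 -> a *: (a^-1 *: w) = w.
Proof. by move=> a0; rewrite scalerA divff ?scale1r. Qed.

Lemma differentiable_complex_structure x : U x -> differentiable Jc x.
Proof.
move=> Ux; apply: (differentiable_scale (h := fun y => (area f y)^-1)).
  have A0 := lt0r_neq0 (area_gt0 Ux); have dA := differentiable_area Ux.
  exact: differentiableV.
apply: differentiable_mulmx; last exact: differentiable_cst.
exact: smooth_diff smooth_metric Ux.
Qed.

(** The covariant derivative of J vanishes. In area J = g eps2, metric compatibility differentiates
    g, and the term in which the transpose of Gam meets [eps2] produces the trace that cancels the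
    derivative of the area. *)
Lemma dcomplex_structure i x : U x ->
  partial i Jc x = Gam i x *m Jc x - Jc x *m Gam i x.
Proof.
move=> Ux; have dA := differentiable_area Ux; have A0 := lt0r_neq0 (area_gt0 Ux).
have dJ := differentiable_complex_structure Ux.
have AJ y : U y -> area f y *: Jc y = g y *m eps2 R.
  move=> Uy; exact: (scalerKV_neq0 (g y *m eps2 R) (lt0r_neq0 (area_gt0 Uy))).
have dg := smooth_diff smooth_metric Ux.
have pm : partial i (fun y => g y *m eps2 R) x = partial i g x *m eps2 R.
  exact: (partial_mulmxr (eps2 R) i dg).
have alg (h dh c J dJ' e : 'M[R]_2) (a da : R) : a != 0 -> h^T = h ->
    c^T *m e + e *m c = \tr c *: e -> a *: J = h *m e ->
    a *: dJ' + da *: J = dh *m e -> dh = c *m h + (c *m h)^T -> da = a * \tr c ->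
    dJ' = c *m J - J *m c.
  move=> a0 hT ce aJ E dhE daE; apply: (scalerI a0).
  move/(canRL (addrK _)): E => ->; rewrite dhE daE mulmxDl trmx_mul hT.
  rewrite [a * _]mulrC -scalerA aJ scalerBr.
  rewrite [a *: (c *m J)]scalemxAr [a *: (J *m c)]scalemxAl aJ -!mulmxA.
  by rewrite [\tr c *: _]scalemxAr -ce mulmxDr opprD addrA addrK.
exact (alg _ _ _ _ _ _ _ _ A0 (metric_tr f x) (tr_eps2 _) (AJ x Ux)
  (etrans (esym (partial_scale i dA dJ)) (etrans (partial_eq i oU AJ Ux) pm))
  (dmetric i Ux) (darea i Ux)).
Qed.

End ComplexStructure.

(** * The connection induced by D on endomorphisms: wedges, skewness, block types *)

Section SplittingWedge.
Variables (R : realType) (m : nat).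
Local Notation T := ('rV[R]_2).
Local Notation V := ('rV[R]_m.+1).
Local Notation End := ('M[R]_m.+1).
Local Notation G := (lorentz_gram R m).
Variables (U : set T) (oU : open U) (P : T -> End).
Hypotheses (oP : forall x, U x -> orthoproj (P x)) (sP : smooth U P).
Implicit Types (x : T) (i j : 'I_2) (s t : T -> V).
Local Notation N := (split_form P).

Lemma differentiable_wedge s t x : differentiable s x -> differentiable t x ->
  differentiable (fun y => wedge (s y) (t y)) x.
Proof.
move=> ds dt; apply: differentiable_mulmx; first exact: differentiable_cst.
by apply: differentiableB; apply: differentiable_mulmx => //; exact: differentiable_tr.
Qed.

Lemma partial_wedge i s t x : differentiable s x -> differentiable t x ->
  partial i (fun y => wedge (s y) (t y)) x
  = wedge (partial i s x) (t x) + wedge (s x) (partial i t x).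
Proof.
move=> ds dt; have [ds' dt'] := (differentiable_tr ds, differentiable_tr dt).
have d1 := differentiable_mulmx ds' dt; have d2 := differentiable_mulmx dt' ds.
rewrite (partial_mulmxl G i (differentiableB d1 d2)) (partialB i d1 d2).
rewrite (partial_mulmx i ds' dt) (partial_mulmx i dt' ds).
rewrite (partial_tr i ds) (partial_tr i dt) /wedge -mulmxDr.
by congr (_ *m _); rewrite addrACA opprD [- _ - _]addrC.
Qed.

(** Leibniz rule for D on wedges. It holds because N is skew, so its commutator acts on wedges as a
    derivation. *)
Lemma split_connEnd_wedge i s t x : U x -> differentiable s x -> differentiable t x ->
  split_connEnd P i (fun y => wedge (s y) (t y)) x
  = wedge (partial i s x - s x *m N i x) (t x)
    + wedge (s x) (partial i t x - t x *m N i x).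
Proof.
move=> Ux ds dt; rewrite /split_connEnd (partial_wedge i ds dt).
have := wedge_ad (s x) (t x) (split_form_skew oU oP sP i Ux).
move: (N i x) (partial i s x) (partial i t x) (s x) (t x) => A a b c d E.
rewrite -addrA [- _ + _]addrC -opprB E opprD.
have wedgeNl (u w : V) : wedge (- u) w = - wedge u w.
  by rewrite wedgeC wedgeNr opprK wedgeC.
by rewrite wedgeDr wedgeDl wedgeNr wedgeNl [RHS]addrACA.
Qed.

Lemma split_connEnd_skew i (A : T -> End) x : U x -> differentiable A x ->
  (forall y, U y -> A y *m G = - (G *m (A y)^T)) ->
  split_connEnd P i A x *m G = - (G *m (split_connEnd P i A x)^T).
Proof.
move=> Ux dA skA; have := partial_mulmxr G i dA.
have dGA : differentiable (fun y => G *m (A y)^T) x.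
  by apply: differentiable_mulmx; [exact: differentiable_cst|exact: differentiable_tr].
rewrite (partial_eq i oU skA Ux) (partialN i dGA).
rewrite (partial_mulmxl G i (differentiable_tr dA)) (partial_tr i dA).
have := split_form_skew oU oP sP i Ux; have := skA x Ux; rewrite /split_connEnd.
move: (N i x) (partial i A x) (A x) => N' A' A0 sA sN sA'.
have tr3 (a b c : End) : (a - b + c)^T = a^T - b^T + c^T.
  by rewrite [(_ + _)^T]linearD /= [(_ - _)^T]linearB.
rewrite tr3 !trmx_mul mulmxDl mulmxBl mulmxDr mulmxBr -sA' -!mulmxA sA sN.
rewrite !mulmxN !mulmxA sA sN !mulNmx !opprK.
move: (G *m _) (_ *m _) (_ *m _ *m _) => a b c.
by apply/matrixP => k l; rewrite !mxE; ring.
Qed.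

(** The hypothesis says that [A] maps S^perp into S. D preserves both bundles, so D A does the same
    and has no S^perp to S^perp block. *)
Lemma split_connEnd_perp_perp i (A : T -> End) x : U x -> differentiable A x ->
  (forall y, U y -> (1%:M - P y) *m A y *m P y = (1%:M - P y) *m A y) ->
  (1%:M - P x) *m split_connEnd P i A x *m (1%:M - P x) = 0.
Proof.
move=> Ux dA AP; have dC : differentiable (fun y => 1%:M - P y) x.
  by apply: differentiableB; [exact: differentiable_cst|exact: smooth_diff sP Ux].
have dCA := differentiable_mulmx dC dA.
rewrite (split_connEnd_mul P i dC dA).
have := split_form_section oU oP sP i AP Ux dCA.
have : (partial i (fun y => 1%:M - P y) x - (1%:M - P x) *m N i x) *m P x = 0.
  have E2 y : U y -> (1%:M - P y) *m P y = 0.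
    by move=> Uy; rewrite mulmxBl mul1mx (oP Uy).1 subrr.
  have E3 y : U y -> (1%:M - P y) *m (1%:M - P y) = (1%:M - P y).
    by move=> Uy; exact: (orthoprojC (oP Uy)).1.
  rewrite -(split_connE oP sP i Ux dC) /split_conn.
  rewrite (partial_eq i oU E2 Ux) (partial_eq i oU E3 Ux) partial_cst mul0mx add0r.
  by rewrite -mulmxA E2// mulmx0.
have := AP x Ux; have CC := (orthoprojC (oP Ux)).1.
move: (partial i (fun y => (1%:M - P y) *m A y) x) (partial i (fun y => 1%:M - P y) x) => d e.
move: (N i x) (A x) => N' A0 E E' E''.
rewrite 2!mulmxBl -{1}E'' E'' -mulmxA CC subrr sub0r.
move: (e - _) E' => y yP.
have yE : y = y *m (1%:M - P x) by rewrite mulmxBr mulmx1 yP subr0.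
by rewrite yE -(mulmxA y) -mulmxA mulmxBr mulmx1 E subrr mulmx0 oppr0.
Qed.

End SplittingWedge.

(** * The constrained Willmore equation when the component of v normal to S is parallel *)

Section ParallelVperp.
Variables (R : realType) (n : nat).
Local Notation T := ('rV[R]_2).
Local Notation V := ('rV[R]_n.+2).
Local Notation End := ('M[R]_n.+2).
Local Notation G := (lorentz_gram R n.+1).
Variables (U : set T) (oU : open U) (f : T -> V) (v : V).
Hypothesis Hf : null_immersion U f v.
Implicit Types (x : T) (i j k l : 'I_2).

Local Notation jac := (jacobian f).
Local Notation g := (metric f).
Local Notation P := (csc_proj f).
Local Notation vp := (vperp f v).
Local Notation N := (split_form P).
Local Notation Jc := (complex_structure f).
Local Notation Gam := (christoffel f).

Let oP x : U x -> orthoproj (P x). Proof. exact: (orthoproj_csc oU Hf). Qed.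
Let sP : smooth U P. Proof. exact: (smooth_csc_proj oU Hf). Qed.
Let ff x : U x -> lorentz (f x) (f x) = 0. Proof. exact: (null_immersion_null Hf). Qed.
Let fv x : U x -> lorentz (f x) v = -1. Proof. exact: (null_immersion_height Hf). Qed.
Let sf : smooth U f. Proof. exact: (null_immersion_smooth Hf). Qed.
Let df x : U x -> differentiable f x. Proof. exact: smooth_diff. Qed.
Let dfi i x : U x -> differentiable (partial i f) x.
Proof. by apply: smooth_diff; exact: smooth_partial. Qed.
Let dj x : U x -> differentiable jac x.
Proof. exact: smooth_diff (smooth_jac oU Hf). Qed.
Let Pf x : U x -> f x *m P x = f x. Proof. exact: (csc_proj_f oU Hf). Qed.
Let Pdf i x : U x -> partial i f x *m P x = partial i f x.
Proof. exact: (csc_proj_df oU Hf). Qed.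
Let Pjac x : U x -> jac x *m P x = jac x.
Proof.
move=> Ux; apply/row_matrixP => i.
by rewrite row_mul (row_jacobian f x i) Pdf.
Qed.

Definition vtan x : V := v *m P x.

Lemma vtan_proj x : U x -> vtan x *m P x = vtan x.
Proof. by move=> Ux; rewrite /vtan -mulmxA (oP Ux).1. Qed.

Lemma vperp_proj x : U x -> vp x *m P x = 0.
Proof. by move=> Ux; rewrite /vperp mulmxBr mulmx1 mulmxBl -mulmxA (oP Ux).1 subrr. Qed.

Lemma vtanD x : vtan x + vp x = v.
Proof. by rewrite /vtan /vperp mulmxBr mulmx1 subrKC. Qed.

Lemma lorentz_proj_vtan (w : V) x : U x -> w *m P x = w ->
  lorentz w (vtan x) = lorentz w v.
Proof. by move=> Ux wP; rewrite /vtan -(orthoproj_lorentz _ _ (oP Ux)) wP. Qed.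

Lemma lorentz_vperp (w : V) x : U x -> w *m P x = w -> lorentz (vp x) w = 0.
Proof.
by move=> Ux wP; rewrite -wP -(orthoproj_lorentz _ _ (oP Ux)) vperp_proj// lorentz0l.
Qed.

Lemma lorentz_f_vtan x : U x -> lorentz (f x) (vtan x) = -1.
Proof. by move=> Ux; rewrite lorentz_proj_vtan ?fv ?Pf. Qed.

Lemma lorentz_df_vtan i x : U x -> lorentz (partial i f x) (vtan x) = 0.
Proof. by move=> Ux; rewrite lorentz_proj_vtan ?Pdf// lorentzC (lorentz_v_df oU Hf). Qed.

Definition tangent_coord (p : nat) (w : 'M[R]_(p, n.+2)) x : 'M[R]_(p, 2) :=
  w *m G *m (jac x)^T *m invmx (g x).

(** Adding (w,f) z makes [w] orthogonal to [f], as (f,z) = -1; the result lies in <f, df>. The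
    coefficients along [df] are then read off, because [f] and z are both orthogonal to [df]. *)
Lemma csc_decomposition (w : V) x : U x -> w *m P x = w ->
  exists a c, w = a *: f x + tangent_coord w x *m jac x + c *: vtan x.
Proof.
move=> Ux wP; have fJ := f_jacobian oU Hf Ux.
pose w' := w + lorentz w (f x) *: vtan x.
have w'P : w' *m P x = w' by rewrite mulmxDl -scalemxAl wP vtan_proj.
have w'f : lorentz w' (f x) = 0.
  by rewrite lorentzDl lorentzZl (lorentzC (vtan x)) lorentz_f_vtan// mulrN1 subrr.
have y0 : lorentz (f x) (trace_ddf f x) != 0.
  by rewrite (lorentz_f_trace oU Hf)// oppr_eq0 pnatr_eq0.
have /(sub_null_frame_tangent (ff Ux) fJ y0 w'f) : (w' <= csc_frame f x)%MS.
  exact/(sub_csc_proj oU Hf _ Ux).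
case/submxP => D; rewrite -[D]hsubmxK mul_row_col => w'E.
have wE : w = lsubmx D *m f x + rsubmx D *m jac x - lorentz w (f x) *: vtan x.
  by rewrite -w'E /w' addrK.
have zJ : vtan x *m G *m (jac x)^T = 0.
  by apply/rowP => i; rewrite jacobian_gram mxE lorentzC lorentz_df_vtan.
have CE : tangent_coord w x = rsubmx D.
  have E1 : lsubmx D *m f x *m G *m (jac x)^T = 0.
    by rewrite -!mulmxA (mulmxA (f x)) fJ mulmx0.
  have E2 : rsubmx D *m jac x *m G *m (jac x)^T = rsubmx D *m g x.
    by rewrite -!mulmxA (mulmxA (jac x)) -metricE.
  rewrite /tangent_coord wE !(mulmxBl, mulmxDl) E1 E2 mul0mx add0r.
  by rewrite mulmxK ?(unit_metric Hf)// -!scalemxAl zJ mul0mx scaler0 subr0.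
exists (lsubmx D 0 0), (- lorentz w (f x)).
by rewrite CE scaleNr -mul_scalar_mx -mx11_scalar.
Qed.

Lemma csc_mulE (r p : nat) (w : 'M[R]_(r, n.+2)) (A : 'M[R]_(n.+2, p)) x : U x ->
  w *m P x = w -> f x *m A = 0 -> vtan x *m A = 0 ->
  w *m A = tangent_coord w x *m (jac x *m A).
Proof.
move=> Ux wP fA zA; apply/row_matrixP => i.
have : row i w *m P x = row i w by rewrite -row_mul wP.
case/(csc_decomposition Ux) => a [c E].
rewrite [RHS]row_mul /tangent_coord !row_mul -/(tangent_coord _ x) {1}E.
by rewrite !mulmxDl -!scalemxAl fA zA !scaler0 addr0 add0r mulmxA.
Qed.

Lemma christoffelE i x : Gam i x = tangent_coord (partial i jac x) x.
Proof. by []. Qed.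

Lemma csc_conn_f i x : U x -> f x *m N i x = 0.
Proof.
move=> Ux; rewrite (split_form_section oU oP sP i Pf Ux (df Ux)).
by rewrite mulmxBr mulmx1 Pdf// subrr.
Qed.

Lemma jac_split_form j l x : U x ->
  partial j f x *m N l x = partial l (partial j f) x *m (1%:M - P x).
Proof.
by move=> Ux; exact (split_form_section oU oP sP l (Pdf j) Ux (dfi j Ux)).
Qed.

Definition hodge_form i x : End := - \sum_j Jc x i j *: N j x.
Local Notation K := hodge_form.

(** Its rows are the values of the Hodge star of df on the coordinate frame. *)
Definition rotated_jacobian x : 'M[R]_(2, n.+2) := - (Jc x *m jac x).
Local Notation F := rotated_jacobian.

(* The second fundamental form of f in S^perp is symmetric and tracefree. *)
Lemma jac_hodge_form i x : U x -> jac x *m K i x = F x *m N i x.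
Proof.
move=> Ux; have d0 : \det (g x) != 0 by rewrite gt_eqF ?(null_immersion_det Hf).
pose h j l := partial j f x *m N l x.
have hs j l : h j l = h l j.
    exact (etrans (jac_split_form j l Ux)
      (etrans (congr1 (fun w => w *m (1%:M - P x)) (ddf_sym oU Hf l j Ux))
        (esym (jac_split_form l j Ux)))).
have htr : \sum_j \sum_l invmx (g x) j l *: h j l = 0.
  transitivity (trace_ddf f x *m (1%:M - P x)); last first.
    by rewrite mulmxBr mulmx1 (csc_proj_trace oU Hf)// subrr.
  rewrite /trace_ddf mulmx_suml; apply: eq_bigr => j _.
  rewrite mulmx_suml; apply: eq_bigr => l _; rewrite -scalemxAl hs.
  by congr (_ *: _); exact: jac_split_form.
have rot := rotate_tracefree (metric_tr f x) d0 hs htr.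
apply/row_matrixP => j; rewrite !row_mul (row_jacobian f x j) /K /F mulmxN mulmx_sumr.
rewrite [row j (- _)]linearN /= mulNmx; congr (- _).
transitivity ((area f x)^-1 *: \sum_l (g x *m eps2 R) i l *: h j l).
  rewrite scaler_sumr; apply: eq_bigr => l _; rewrite -scalemxAr scalerA.
  by rewrite /complex_structure mxE.
rewrite rot row_mul /complex_structure [row j (_ *: _)]linearZ /= -!scalemxAl.
congr (_ *: _); rewrite -mulmxA mulmx_sum_row; apply: eq_bigr => l _.
rewrite row_mul (row_jacobian f x l) hs; congr (_ *: _); by rewrite [RHS]mxE.
Qed.

Lemma hodge_form_f i x : U x -> f x *m K i x = 0.
Proof.
move=> Ux; rewrite mulmxN mulmx_sumr big1 ?oppr0// => j _.
by rewrite -scalemxAr csc_conn_f// scaler0.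
Qed.

Lemma hodge_form_skew i x : U x -> K i x *m G = - (G *m (K i x)^T).
Proof.
move=> Ux; rewrite /K mulNmx [(- _)^T]linearN /= mulmxN; congr (- _).
rewrite mulmx_suml [(\sum_j _)^T]linear_sum /= mulmx_sumr -sumrN; apply: eq_bigr => j _.
rewrite -scalemxAl (split_form_skew oU oP sP)// [(_ *: _)^T]linearZ /= -scalemxAr.
by rewrite scalerN.
Qed.

Lemma hodge_form_perp i (p : nat) (w : 'M[R]_(p, n.+2)) x : U x -> w *m P x = w ->
  w *m K i x *m P x = 0.
Proof.
move=> Ux wP; rewrite mulmxN mulmx_sumr mulNmx mulmx_suml big1 ?oppr0// => j _.
by rewrite -scalemxAr -scalemxAl (split_form_perp oU oP sP)// scaler0.
Qed.

Lemma hodge_form_tangent i (p : nat) (w : 'M[R]_(p, n.+2)) x : U x -> w *m P x = 0 ->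
  w *m K i x *m P x = w *m K i x.
Proof.
move=> Ux wP; rewrite mulmxN mulmx_sumr mulNmx mulmx_suml; congr (- _).
apply: eq_bigr => j _.
by rewrite -scalemxAr -scalemxAl (split_form_tangent oU oP sP).
Qed.

Lemma differentiable_split_form i x : U x -> differentiable (N i) x.
Proof. exact: smooth_diff (smooth_split_form oU sP i). Qed.

Lemma differentiable_hodge_form i x : U x -> differentiable (K i) x.
Proof.
move=> Ux; apply: differentiableN; apply: differentiable_sumf => j.
apply: differentiable_scale; last exact: differentiable_split_form.
exact: (differentiable_mxP _ _).1 (differentiable_complex_structure oU Hf Ux) i j.
Qed.

Lemma differentiable_rotated x : U x -> differentiable F x.
Proof.
move=> Ux; apply: differentiableN; apply: differentiable_mulmx; last exact: dj.
exact: (differentiable_complex_structure oU Hf).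
Qed.

Local Notation z := vtan.
Hypothesis par : forall i x, U x -> partial i vp x *m (1%:M - P x) = 0.

Let svp : smooth U vp. Proof. exact: (smooth_vperp oU Hf). Qed.
Let dvp x : U x -> differentiable vp x. Proof. exact: smooth_diff. Qed.

Lemma dvperp_proj i x : U x -> partial i vp x *m P x = partial i vp x.
Proof. by move=> Ux; have /eqP := par i Ux; rewrite mulmxBr mulmx1 subr_eq0 => /eqP. Qed.

Lemma vtanE : z = fun x => v - vp x.
Proof. by apply/funext => x; exact (canRL (addrK _) (vtanD x)). Qed.

Lemma smooth_vtan : smooth U z.
Proof.
rewrite vtanE; apply/(smoothP oU _); apply: (smooth_mxB oU); first exact: smooth_mxcst.
exact/(smoothP oU _).
Qed.

Lemma dvtan i x : U x -> partial i z x = - partial i vp x.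
Proof.
move=> Ux; rewrite vtanE (partialB i (differentiable_cst v x) (dvp Ux)).
by rewrite partial_cst sub0r.
Qed.

Lemma dvperp_perp_f i x : U x -> lorentz (partial i vp x) (f x) = 0.
Proof.
move=> Ux; have := spartial_lorentz i (dvp Ux) (df Ux).
have vf y : U y -> lorentz (vp y) (f y) = 0.
  by move=> Uy; exact (lorentz_vperp Uy (Pf Uy)).
have vdf : lorentz (vp x) (partial i f x) = 0.
  exact (lorentz_vperp Ux (Pdf i Ux)).
by rewrite (spartial_cst_eq oU i vf Ux) vdf addr0.
Qed.

Lemma dvperp_df i j x : U x ->
  lorentz (partial i vp x) (partial j f x) = - lorentz (vp x) (partial i (partial j f) x).
Proof.
move=> Ux; have := spartial_lorentz i (dvp Ux) (dfi j Ux).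
have vf y : U y -> lorentz (vp y) (partial j f y) = 0.
  by move=> Uy; exact (lorentz_vperp Uy (Pdf j Uy)).
by rewrite (spartial_cst_eq oU i vf Ux) => /esym/eqP; rewrite addr_eq0 => /eqP.
Qed.

(** Differentiating (w,z) = 0 with dz = - dw leaves (w,dw), which vanishes since w is in S^perp and,
    w being parallel, dw is in S. *)
Lemma dvperp_perp_vtan i x : U x -> lorentz (partial i vp x) (z x) = 0.
Proof.
move=> Ux; have := spartial_lorentz i (dvp Ux) (smooth_diff smooth_vtan Ux).
have vz y : U y -> lorentz (vp y) (z y) = 0.
  by move=> Uy; exact (lorentz_vperp Uy (vtan_proj Uy)).
have vb : lorentz (vp x) (partial i vp x) = 0.
  exact (lorentz_vperp Ux (dvperp_proj i Ux)).
by rewrite (spartial_cst_eq oU i vz Ux) dvtan// lorentzNr vb oppr0 addr0.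
Qed.

Local Notation B i x := (tangent_coord (partial i vp x) x).

(** In the frame f, df, z of S, orthogonality of dw to [f] kills its z-coefficient, and then
    orthogonality to z kills its f-coefficient. *)
Lemma dvperp_tangent i x : U x -> partial i vp x = B i x *m jac x.
Proof.
move=> Ux; have [a [c E]] := csc_decomposition Ux (dvperp_proj i Ux).
have C0 (w : V) : (forall j, lorentz (partial j f x) w = 0) ->
    lorentz (B i x *m jac x) w = 0.
  move=> jw; rewrite /lorentz -!mulmxA.
  suff -> : jac x *m (G *m w^T) = 0 by rewrite !mulmx0 mxE.
  apply/row_matrixP => j; rewrite row_mul (row_jacobian f x j) mulmxA lorentz_scalar jw.
  by apply/rowP => k; rewrite !mxE mul0rn.
have c0 : c = 0.
  have := congr1 (fun w => lorentz w (f x)) E; rewrite dvperp_perp_f//.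
  rewrite !lorentzDl !lorentzZl ff// C0; last first.
    by move=> j; rewrite lorentzC (lorentz_f_df oU Hf).
  rewrite (lorentzC (z x)) (lorentz_f_vtan)// mulr0 !add0r mulrN1.
  by move/esym/eqP; rewrite oppr_eq0 => /eqP.
have a0 : a = 0.
  have := congr1 (fun w => lorentz w (z x)) E; rewrite dvperp_perp_vtan//.
  rewrite !lorentzDl !lorentzZl c0 mul0r addr0 C0; last first.
    by move=> j; exact: (lorentz_df_vtan).
  rewrite (lorentz_f_vtan)// addr0 mulrN1.
  by move/esym/eqP; rewrite oppr_eq0 => /eqP.
by rewrite {1}E a0 c0 !scale0r add0r addr0.
Qed.

(** From (dw, df) = - (w, ddf), the trace is minus the product of w with the trace vector, which
    lies in S. This is where the choice of S as the central sphere congruence enters. *)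
Lemma dvperp_tracefree x : U x -> B 0 x 0 0 + B 1 x 0 1 = 0.
Proof.
move=> Ux; rewrite -(ord2_sum (fun i => B i x 0 i)).
transitivity (- lorentz (vp x) (trace_ddf f x)); last first.
  have -> := lorentz_vperp Ux (csc_proj_trace oU Hf Ux); exact: oppr0.
rewrite /trace_ddf lorentz_sumr -sumrN; apply: eq_bigr => i _.
rewrite lorentz_sumr -sumrN /tangent_coord mxE; apply: eq_bigr => j _.
rewrite jacobian_gram lorentzZr dvperp_df// mulNr mulrC; congr (- (_ * _)).
by rewrite -[in LHS](metric_tr f x) -trmx_inv mxE.
Qed.

Lemma vtan_split_form i x : U x -> z x *m N i x = 0.
Proof.
move=> Ux; rewrite (split_form_section oU oP sP i (vtan_proj) Ux (smooth_diff smooth_vtan Ux)).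
by rewrite dvtan// mulNmx par// oppr0.
Qed.

Lemma split_conn_vperp i x : U x -> split_conn P i vp x = 0.
Proof.
move=> Ux; rewrite /split_conn.
have E1 y : U y -> vp y *m P y = 0 by exact: (vperp_proj).
have E2 y : U y -> vp y *m (1%:M - P y) = vp y.
  by move=> Uy; rewrite mulmxBr mulmx1 E1// subr0.
rewrite (partial_eq i oU E1 Ux) (partial_eq i oU E2 Ux) partial_cst mul0mx add0r.
exact: par.
Qed.

Lemma vperp_split_form i x : U x -> vp x *m N i x = partial i vp x.
Proof.
move=> Ux; have := split_connE oP sP i Ux (dvp Ux).
by rewrite split_conn_vperp// => /esym/eqP; rewrite subr_eq0 => /eqP.
Qed.

Let sdvp i : smooth U (partial i vp). Proof. exact: smooth_partial. Qed.
Local Notation D s i x := (partial i s x - s x *m N i x).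

Definition pmc_multiplier i x : End := wedge (f x) (2^-1 *: partial i vp x).
Local Notation q := pmc_multiplier.

Let hb i x : V := 2^-1 *: partial i vp x.

Let shb i : smooth U (hb i).
Proof.
apply/(smoothP oU _); apply: (smooth_mxscale oU) => [p|]; first exact: ksmooth_cst.
exact/(smoothP oU _).
Qed.

Let hbP i x : U x -> hb i x *m P x = hb i x.
Proof.
by move=> Ux; have E := dvperp_proj i Ux; rewrite -scalemxAl E.
Qed.

Lemma differentiable_pmc_multiplier i x : U x -> differentiable (q i) x.
Proof. by move=> Ux; exact (differentiable_wedge (df Ux) (smooth_diff (shb i) Ux)). Qed.

Lemma dpartial_half i j x : U x -> partial i (hb j) x = 2^-1 *: partial i (partial j vp) x.
Proof. by move=> Ux; exact (partialZ 2^-1 i (smooth_diff (sdvp j) Ux)). Qed.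

(** With b = dw/2, the exterior derivative of f /\ b has a term f /\ d^D b, zero because mixed
    derivatives of w commute, and a term df /\ b, zero because dw is tracefree. *)
Lemma split_dD_pmc_multiplier x : U x -> split_dD P q x = 0.
Proof.
move=> Ux; have E i j : split_connEnd P i (q j) x
    = wedge (partial i f x) (hb j x) + wedge (f x) (partial i (hb j) x *m P x).
  have := split_connEnd_wedge oU oP sP i Ux (df Ux) (smooth_diff (shb j) Ux).
  have := split_form_section oU oP sP i (hbP j) Ux (smooth_diff (shb j) Ux).
  have := csc_conn_f i Ux.
  rewrite /q -/(hb _ _); move: (N i x) (partial i (hb j) x) => N' d -> ->.
  by rewrite subr0 mulmxBr mulmx1 subKr.
have half (w : 'rV[R]_2) (J : 'M[R]_(2, n.+2)) :
    2^-1 *: (w *m J) = (2^-1 * w 0 0) *: row 0 J + (2^-1 * w 0 1) *: row 1 J.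
  by rewrite mulmx_sum_row ord2_sum scalerDr !scalerA.
have bE i : hb i x = (2^-1 * B i x 0 0) *: partial 0 f x + (2^-1 * B i x 0 1) *: partial 1 f x.
  exact (etrans (congr1 ( *:%R 2^-1) (dvperp_tangent i Ux))
    (etrans (half _ _) (congr2 (fun a b => _ *: a + _ *: b)
      (row_jacobian f x 0) (row_jacobian f x 1)))).
have alg (a b c d : V) (t00 t01 t10 t11 : R) :
    c = (2^-1 * t00) *: a + (2^-1 * t01) *: b -> d = (2^-1 * t10) *: a + (2^-1 * t11) *: b ->
    t00 + t11 = 0 -> wedge a d = wedge b c.
  move=> -> -> tr0; rewrite !wedgeDr !wedgeZr !wedge_id !scaler0 add0r addr0 [wedge b a]wedgeC.
  have /(canRL (addKr _)) -> := tr0.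
  by rewrite addr0 scalerN mulrN scaleNr.
have w0 := alg _ _ _ _ _ _ _ _ (bE 0) (bE 1) (dvperp_tracefree Ux).
have sch : partial 0 (hb 1) x = partial 1 (hb 0) x.
  exact (etrans (dpartial_half 0 1 Ux) (etrans (congr1 ( *:%R 2^-1)
    (smooth_partialC oU 0 1 svp Ux)) (esym (dpartial_half 1 0 Ux)))).
have diff (X Y w w' e e' : End) : X = w + e -> Y = w' + e' -> w = w' -> e = e' -> X - Y = 0.
  by move=> -> -> -> ->; exact: subrr.
exact (diff _ _ _ _ _ _ (E 0 1) (E 1 0) w0
  (congr1 (fun d => wedge (f x) (d *m P x)) sch)).
Qed.

(** Vanishing on the frame f, df, z gives P X = 0, and skewness turns this into X P = 0; only the
    S^perp to S^perp block is left. *)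
Lemma skew_csc_eq0 (X : End) x : U x -> X *m G = - (G *m X^T) ->
  f x *m X = 0 -> jac x *m X = 0 -> z x *m X = 0 ->
  (1%:M - P x) *m X *m (1%:M - P x) = 0 -> X = 0.
Proof.
move=> Ux skX fX jX zX CXC.
have PX : P x *m X = 0.
  by rewrite (csc_mulE Ux (oP Ux).1 fX zX) jX mulmx0.
have XP : X *m P x = 0.
  have : G *m (P x *m X)^T *m G = 0 by rewrite PX trmx0 mulmx0 mul0mx.
  have GX : G *m X^T = - (X *m G) by rewrite skX opprK.
  rewrite trmx_mul mulmxA GX !mulNmx -(mulmxA X) -(oP Ux).2 -(mulmxA X) -(mulmxA (P x)) lorentz_gramK mulmx1.
  by move/eqP; rewrite oppr_eq0 => /eqP.
by move: CXC; rewrite mulmxBl mul1mx PX subr0 mulmxBr mulmx1 XP subr0.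
Qed.

Let skq i y : q i y *m G = - (G *m (q i y)^T). Proof. exact: wedge_skew. Qed.
Let skK i y (Uy : U y) : K i y *m G = - (G *m (K i y)^T).
Proof. exact (hodge_form_skew i Uy). Qed.

Lemma commutator_skew (A B' : End) : A *m G = - (G *m A^T) -> B' *m G = - (G *m B'^T) ->
  commutator A B' *m G = - (G *m (commutator A B')^T).
Proof.
move=> sA sB; rewrite /commutator [(_ - _)^T]linearB /= !trmx_mul mulmxBl mulmxBr -!mulmxA.
by rewrite sA sB !mulmxN !mulmxA sA sB !mulNmx !opprK opprB.
Qed.

Lemma commutator_diff_skew (A B' C D' : End) : A *m G = - (G *m A^T) ->
  B' *m G = - (G *m B'^T) -> C *m G = - (G *m C^T) -> D' *m G = - (G *m D'^T) ->
  (commutator A B' - commutator C D') *m G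
  = - (G *m (commutator A B' - commutator C D')^T).
Proof.
move=> sA sB sC sD; have [s1 s2] := (commutator_skew sA sB, commutator_skew sC sD).
by rewrite [(_ - _)^T]linearB /= mulmxBl mulmxBr s1 s2 opprK [RHS]opprB [LHS]addrC.
Qed.

Lemma mul_split_connEnd_hodge a i j (s : T -> 'M[R]_(a.+1, n.+2)) x :
  U x -> differentiable s x ->
  s x *m split_connEnd P i (K j) x
  = partial i (fun y => s y *m K j y) x - s x *m K j x *m N i x - D s i x *m K j x.
Proof.
by move=> Ux ds; rewrite (split_connEnd_mul P i ds (differentiable_hodge_form j Ux)).
Qed.

(** The star in [K] passes to df by [jac_hodge_form], the symmetry of the second fundamental form
    exchanges the two slots, and the star goes back to [N]. *)
Lemma df_hodge_sym i j x : U x -> partial i f x *m K j x = partial j f x *m K i x.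
Proof.
move=> Ux; have key (J : 'M[R]_2) (M : 'M[R]_(2, n.+2)) (A : 'I_2 -> End) :
    (forall l k, row l M *m A k = row k M *m A l) ->
    row i (- (J *m M) *m A j) = row j M *m - (\sum_l J i l *: A l).
  move=> sym; rewrite mulmxN mulmx_sumr mulNmx [row i (- _)]linearN /=; congr (- _).
  rewrite row_mul row_mul -mulmxA mulmx_sum_row; apply: eq_bigr => l _.
  by rewrite row_mul (sym l j) -scalemxAr [row i _ 0 l]mxE.
have sym l k : row l (jac x) *m N k x = row k (jac x) *m N l x.
  rewrite !(row_jacobian f x).
  exact (etrans (jac_split_form l k Ux)
    (etrans (congr1 (fun w => w *m (1%:M - P x)) (ddf_sym oU Hf k l Ux))
      (esym (jac_split_form k l Ux)))).
have E k l : partial k f x *m K l x = row k (jac x *m K l x).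
  by rewrite [RHS]row_mul; congr (_ *m _); exact: esym (row_jacobian f x k).
exact (etrans (E i j) (etrans (congr1 (row i) (jac_hodge_form j Ux))
  (etrans (key (Jc x) (jac x) (fun l => N l x) sym)
    (congr1 (mulmx^~ (K i x)) (row_jacobian f x j))))).
Qed.

Lemma f_split_dD_hodge x : U x -> f x *m split_dD P K x = 0.
Proof.
move=> Ux; have fK i y : U y -> f y *m K i y = 0 by exact: (hodge_form_f).
have E i j : f x *m split_connEnd P i (K j) x = - (partial i f x *m K j x).
  rewrite (mul_split_connEnd_hodge i j Ux (df Ux)) (partial_eq i oU (fK j) Ux).
  by rewrite partial_cst fK// mul0mx subr0 (csc_conn_f)// subr0 sub0r.
rewrite /split_dD mulmxBr.
have diff (a b c d : V) : a = - c -> b = - d -> c = d -> a - b = 0.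
  by move=> -> -> ->; exact: subrr.
exact (diff _ _ _ _ (E 0 1) (E 1 0) (df_hodge_sym 0 1 Ux)).
Qed.

Lemma vtan_hodge_form i x : U x -> z x *m K i x = 0.
Proof.
move=> Ux; rewrite mulmxN mulmx_sumr big1 ?oppr0// => j _.
by rewrite -scalemxAr (vtan_split_form)// scaler0.
Qed.

Lemma vtan_split_dD_hodge x : U x -> z x *m split_dD P K x
  = partial 0 vp x *m K 1 x - partial 1 vp x *m K 0 x.
Proof.
move=> Ux; have dz := smooth_diff (smooth_vtan) Ux.
have E i j : z x *m split_connEnd P i (K j) x = partial i vp x *m K j x.
  rewrite (mul_split_connEnd_hodge i j Ux dz) (partial_eq i oU (vtan_hodge_form j) Ux).
  rewrite partial_cst vtan_hodge_form// mul0mx subr0 (vtan_split_form)// subr0.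
  by rewrite (dvtan i Ux) mulNmx opprK add0r.
by rewrite /split_dD mulmxBr (E 0 1) (E 1 0).
Qed.

(* Since the complex structure is parallel, this follows from the Codazzi equation for N. *)
Lemma jac_split_dD_hodge x : U x -> jac x *m split_dD P K x = 0.
Proof.
move=> Ux; have dF := differentiable_rotated Ux.
have dJ := differentiable_complex_structure oU Hf Ux.
have tang i (A : End) : f x *m A = 0 -> z x *m A = 0 ->
    D jac i x *m A = Gam i x *m (jac x *m A).
  move=> fA zA; have DP : D jac i x *m P x = D jac i x.
    rewrite (split_form_section oU oP sP i Pjac Ux (dj Ux)) mulmxBr mulmx1 subKr.
    by rewrite -mulmxA (oP Ux).1.
  rewrite (csc_mulE Ux DP fA zA) christoffelE; congr (_ *m _).
  rewrite /tangent_coord (split_form_section oU oP sP i Pjac Ux (dj Ux)).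
  rewrite mulmxBr mulmx1 subKr -[_ *m P x *m G]mulmxA (oP Ux).2 -!mulmxA.
  by rewrite (mulmxA (P x)^T) -trmx_mul Pjac.
(* The correction terms agree: on endomorphisms killing [f] and z, D_i acts on [jac] as
   multiplication by Gam_i, and parallelism of J gives the same for [F]. Both become Gam_i F N_j. *)
have E i j : jac x *m split_connEnd P i (K j) x = F x *m split_connEnd P i (N j) x.
  rewrite (mul_split_connEnd_hodge i j Ux (dj Ux)).
  rewrite (split_connEnd_mul P i dF (differentiable_split_form j Ux)).
  rewrite (partial_eq i oU (fun y => jac_hodge_form j (x := y)) Ux).
  rewrite (jac_hodge_form j Ux); congr (_ - _ - _).
  rewrite (tang _ _ (hodge_form_f j Ux) (vtan_hodge_form j Ux)) (jac_hodge_form j Ux).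
  have DF : D F i x = - ((Gam i x *m Jc x - Jc x *m Gam i x) *m jac x + Jc x *m D jac i x).
    have alg (d J0 : 'M[R]_2) (j0 d0 : 'M[R]_(2, n.+2)) (A : End) :
        - (d *m j0 + J0 *m d0) - (- (J0 *m j0)) *m A = - (d *m j0 + J0 *m (d0 - j0 *m A)).
      by rewrite mulNmx opprK mulmxBr mulmxA addrA [RHS]opprB [LHS]addrC.
    rewrite /F (partialN i (differentiable_mulmx dJ (dj Ux))).
    by rewrite (partial_mulmx i dJ (dj Ux)) (dcomplex_structure oU Hf i Ux); exact: alg.
  have := tang i _ (csc_conn_f j Ux) (vtan_split_form j Ux).
  rewrite {}DF /F; move: (jac x) (Gam i x) (Jc x) (N j x) (D jac i x) => J0 c J1 N' d dE.
  by rewrite !(mulNmx, mulmxDl) mulmxN -(mulmxA J1 d) dE !mulmxA subrK.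
rewrite /split_dD mulmxBr (E 0 1) (E 1 0) -mulmxBr.
by have := split_dD_form oU oP sP Ux; rewrite /split_dD => ->; rewrite mulmx0.
Qed.

Lemma perp_split_dD_hodge x : U x ->
  (1%:M - P x) *m split_dD P K x *m (1%:M - P x) = 0.
Proof.
move=> Ux; have E i j : (1%:M - P x) *m split_connEnd P i (K j) x *m (1%:M - P x) = 0.
  apply: (split_connEnd_perp_perp oU oP sP i Ux (differentiable_hodge_form j Ux)).
  move=> y Uy; apply: (hodge_form_tangent j Uy).
  by rewrite mulmxBl mul1mx (oP Uy).1 subrr.
have := (E 0 1); have := (E 1 0); rewrite /split_dD; move: (1%:M - P x) => C c10 c01.
by rewrite mulmxBr mulmxBl c10 c01 subr0.
Qed.

Lemma split_dD_hodge_skew x : U x ->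
  split_dD P K x *m G = - (G *m (split_dD P K x)^T).
Proof.
move=> Ux; have E i j := split_connEnd_skew oU oP sP i Ux
  (differentiable_hodge_form j Ux) (hodge_form_skew j).
rewrite /split_dD [(_ - _)^T]linearB /= mulmxBl mulmxBr (E 0 1) (E 1 0).
by rewrite opprK [RHS]opprB [LHS]addrC.
Qed.

Lemma mul_q (w : V) i x : lorentz w (f x) = 0 -> w *m q i x = - (lorentz w (hb i x) *: f x).
Proof. by move=> wf; rewrite mulmx_wedge wf scale0r sub0r. Qed.

Lemma perp_q i x p (w : 'M[R]_(p, n.+2)) : U x -> w *m P x = 0 -> w *m q i x = 0.
Proof.
move=> Ux wP; apply/row_matrixP => r; rewrite row_mul row0 mul_q.
  have wP' : row r w *m P x = 0 by rewrite -row_mul wP row0.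
  rewrite -(hbP i Ux) -(orthoproj_lorentz _ _ (oP Ux)) wP' lorentz0l scale0r.
  exact: oppr0.
rewrite -(Pf Ux) -(orthoproj_lorentz _ _ (oP Ux)) -row_mul wP row0.
exact: lorentz0l.
Qed.

Lemma q_perp i x : U x -> q i x *m (1%:M - P x) = 0.
Proof.
move=> Ux; rewrite /q /wedge -mulmxA mulmxBl -!mulmxA.
have E1 : f x *m (1%:M - P x) = 0 by rewrite mulmxBr mulmx1 Pf// subrr.
have E2 : hb i x *m (1%:M - P x) = 0 by rewrite mulmxBr mulmx1 hbP// subrr.
by rewrite -/(hb i x) E1 E2 !mulmx0 subr0 mulmx0.
Qed.

(** On [f] and [df] both sides vanish. On z the left side is dw_0 K_1 - dw_1 K_0 in right-action
    notation, and the factor 2 on the right cancels the half in q z = - dw/2. *)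
Theorem pmc_constrained_willmore x : U x -> split_dD P K x
  = 2 *: (commutator (q 0 x) (K 1 x) - commutator (q 1 x) (K 0 x)).
Proof.
move=> Ux; apply/eqP; rewrite -subr_eq0; apply/eqP.
have CE0 p (w : 'M[R]_(p, n.+2)) (q0 K1 q1 K0 : End) :
    w *m (commutator q0 K1 - commutator q1 K0) = w *m K1 *m q0 - w *m q0 *m K1
    - (w *m K0 *m q1 - w *m q1 *m K0).
  by rewrite /commutator !mulmxBr !mulmxA.
have CE p (w : 'M[R]_(p, n.+2)) := CE0 p w (q 0 x) (K 1 x) (q 1 x) (K 0 x).
have sC := commutator_diff_skew (skq 0 x) (skK 1 Ux) (skq 1 x) (skK 0 Ux).
move: (commutator (q 0 x) (K 1 x) - _) CE sC => C CE sC.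
have XE p (w : 'M[R]_(p, n.+2)) (Y : End) :
    w *m Y = 2 *: (w *m C) -> w *m (Y - 2 *: C) = 0.
  by rewrite mulmxBr -scalemxAr => ->; rewrite subrr.
have two0 p (A : 'M[R]_(p, n.+2)) : A = 0 -> 2 *: A = 0 by move=> ->; exact: scaler0.
have mul0 p (A : 'M[R]_(p, n.+2)) (Y : End) : A = 0 -> A *m Y = 0 by move=> ->; exact: mul0mx.
have four0 p (a b c d : 'M[R]_(p, n.+2)) : a = 0 -> b = 0 -> c = 0 -> d = 0 ->
    a - b - (c - d) = 0 by move=> -> -> -> ->; rewrite !subr0.
have fK i : f x *m K i x = 0 by exact: (hodge_form_f).
have zK i : z x *m K i x = 0 by exact: vtan_hodge_form.
apply: (skew_csc_eq0 Ux).
- rewrite [(_ - _)^T]linearB /= [(2 *: C)^T]linearZ /= mulmxBl mulmxBr -scalemxAl -scalemxAr.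
  by rewrite split_dD_hodge_skew// sC scalerN opprK [RHS]opprB [LHS]addrC.
- have fq i : f x *m q i x = 0.
    have fh : lorentz (f x) (hb i x) = 0.
      by rewrite lorentzZr lorentzC (dvperp_perp_f i Ux) mulr0.
    by rewrite (mul_q i (ff Ux)) fh scale0r; exact: oppr0.
  apply: XE; apply: (etrans (f_split_dD_hodge Ux)); apply: esym.
  apply: two0; apply: (etrans (CE _ (f x))).
  by apply: four0; [exact: mul0 (fK 1)|exact: mul0 (fq 0)|exact: mul0 (fK 0)|exact: mul0 (fq 1)].
(* Both orders of composition vanish on df: K sends S to S^perp, which q kills, and q sends df to
   multiples of [f], which K kills. *)
- have jKq i j : jac x *m K i x *m q j x = 0.
    exact (perp_q j Ux (hodge_form_perp i Ux (Pjac Ux))).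
  have jqK i j : jac x *m q i x *m K j x = 0.
    apply/row_matrixP => r; rewrite row_mul row_mul row0.
    have fj : lorentz (row r (jac x)) (f x) = 0.
      by rewrite (row_jacobian f x r) lorentzC; exact: (lorentz_f_df oU Hf).
    by rewrite (mul_q i fj) mulNmx -scalemxAl fK scaler0 oppr0.
  apply: XE; apply: (etrans (jac_split_dD_hodge Ux)); apply: esym.
  by apply: two0; apply: (etrans (CE _ (jac x))); apply: four0.
- have zq i : z x *m q i x = - hb i x.
    rewrite mulmx_wedge lorentzC (lorentz_f_vtan)// lorentzZr lorentzC.
    by rewrite (dvperp_perp_vtan)// mulr0 scale0r subr0 scaleN1r.
  apply: XE; apply: (etrans (vtan_split_dD_hodge Ux)); apply: esym.
  have alg (a0 a1 b0 b1 h0 h1 : V) (q0 q1 K0 K1 : End) : a1 = 0 -> a0 = 0 ->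
      b0 = - (2^-1 *: h0) -> b1 = - (2^-1 *: h1) ->
      2 *: (a1 *m q0 - b0 *m K1 - (a0 *m q1 - b1 *m K0)) = h0 *m K1 - h1 *m K0.
    move=> -> -> -> ->; rewrite !mul0mx !sub0r !mulNmx !opprK -!scalemxAl -scalerBr.
    by rewrite scalerA divff ?scale1r// pnatr_eq0.
  apply: (etrans (congr1 ( *:%R 2) (CE _ (z x)))).
  exact: alg (zK 1) (zK 0) (zq 0) (zq 1).
- have Cq i : (1%:M - P x) *m q i x = 0.
    by apply: perp_q => //; rewrite mulmxBl mul1mx (oP Ux).1 subrr.
  have := perp_split_dD_hodge Ux; have := CE _ (1%:M - P x).
  have := q_perp 0 Ux; have := q_perp 1 Ux; have := Cq 0; have := Cq 1.
  move: (split_dD P K x) (1%:M - P x) (q 0 x) (q 1 x) (K 0 x) (K 1 x).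
  move=> Y D q0 q1 K0 K1 Dq1 Dq0 qD1 qD0 DC DY.
  rewrite mulmxBr mulmxBl DY sub0r -scalemxAr -scalemxAl DC Dq0 Dq1 !mul0mx !subr0.
  by rewrite mulmxBl -!mulmxA qD0 qD1 !mulmx0 subr0 scaler0 oppr0.
Qed.

End ParallelVperp.

(** * Complexification of real matrices *)

Section Complexification.
Variable R : realType.
Local Notation C := (R[i]).

Lemma complexify_re a b (A : 'M[R]_(a, b)) : re_mx (complexify A) = A.
Proof. by apply/matrixP => k l; rewrite !mxE. Qed.

Lemma complexify_im a b (A : 'M[R]_(a, b)) : im_mx (complexify A) = 0.
Proof. by apply/matrixP => k l; rewrite !mxE. Qed.

Lemma complexify_inj a b : injective (@complexify R a b).
Proof. by move=> A B /(congr1 (@re_mx R a b)); rewrite !complexify_re. Qed.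

Lemma complexifyD a b (A B : 'M[R]_(a, b)) : complexify (A + B) = complexify A + complexify B.
Proof. exact: map_mxD. Qed.

Lemma complexifyB a b (A B : 'M[R]_(a, b)) : complexify (A - B) = complexify A - complexify B.
Proof. exact: map_mxB. Qed.

Lemma complexifyN a b (A : 'M[R]_(a, b)) : complexify (- A) = - complexify A.
Proof. exact: map_mxN. Qed.

Lemma complexifyM a b c (A : 'M[R]_(a, b)) (B : 'M[R]_(b, c)) :
  complexify (A *m B) = complexify A *m complexify B.
Proof. exact: map_mxM. Qed.

Lemma complexifyZ a b (c : R) (A : 'M[R]_(a, b)) : complexify (c *: A) = (c%:C) *: complexify A.
Proof. exact: map_mxZ. Qed.

Lemma complexify0 a b : complexify (0 : 'M[R]_(a, b)) = 0.
Proof. exact: map_mx0. Qed.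

Lemma complexify1 a : complexify (1%:M : 'M[R]_a) = 1%:M.
Proof. exact: map_mx1. Qed.

Lemma complexify_sum a b I (r : seq I) (A : I -> 'M[R]_(a, b)) :
  complexify (\sum_(k <- r) A k) = \sum_(k <- r) complexify (A k).
Proof. exact: (big_morph _ (@complexifyD a b) (@complexify0 a b)). Qed.

Lemma complexify_tr a b (A : 'M[R]_(a, b)) : complexify A^T = (complexify A)^T.
Proof. by rewrite /complexify map_trmx. Qed.

Lemma complexify_gram m : complexify (lorentz_gram R m) = lorentz_gram C m.
Proof.
rewrite /lorentz_gram /complexify map_diag_mx; congr diag_mx; apply/rowP => j.
by rewrite !mxE; case: ifP => _; rewrite ?rmorphN rmorph1.
Qed.

Lemma complexify_wedge m (u w : 'rV[R]_m.+1) :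
  complexify (wedge u w) = wedge (complexify u) (complexify w).
Proof. by rewrite /wedge complexifyM complexify_gram complexifyB !complexifyM !complexify_tr. Qed.

Lemma complexify_commutator m (A B : 'M[R]_m.+1) :
  complexify (commutator A B) = commutator (complexify A) (complexify B).
Proof. by rewrite /commutator complexifyB !complexifyM. Qed.

Lemma complexify_conj a b (A : 'M[R]_(a, b)) : conj_mx (complexify A) = complexify A.
Proof. by apply/matrixP => k l; rewrite !mxE conjc_real. Qed.

Lemma orthoproj_complexify m (P : 'M[R]_m.+1) : orthoproj P -> orthoproj (complexify P).
Proof.
case=> PP PG; split; first by rewrite -complexifyM PP.
by rewrite -complexify_gram -complexify_tr -!complexifyM PG.
Qed.

Let ReD : {morph @complex.Re R : x y / x + y}. Proof. by case=> ? ? [? ?]. Qed.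
Let ImD : {morph @complex.Im R : x y / x + y}. Proof. by case=> ? ? [? ?]. Qed.

Lemma re_mulmxC a b c (A : 'M[C]_(a, b)) (B : 'M[R]_(b, c)) :
  re_mx (A *m complexify B) = re_mx A *m B.
Proof.
apply/matrixP => k l; rewrite !mxE (big_morph _ ReD (erefl _)); apply: eq_bigr => j _.
by rewrite !mxE; case: (A k j) => r s /=; rewrite mulr0 subr0.
Qed.

Lemma im_mulmxC a b c (A : 'M[C]_(a, b)) (B : 'M[R]_(b, c)) :
  im_mx (A *m complexify B) = im_mx A *m B.
Proof.
apply/matrixP => k l; rewrite !mxE (big_morph _ ImD (erefl _)); apply: eq_bigr => j _.
by rewrite !mxE; case: (A k j) => r s /=; rewrite mulr0 add0r.
Qed.

End Complexification.

(** * The complex connection and its forms as complexifications of the real ones *)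

Section ComplexSplitting.
Variables (R : realType) (n : nat).
Local Notation T := ('rV[R]_2).
Local Notation C := (R[i]).
Variables (U : set T) (oU : open U) (sigma : T -> 'rV[R]_n.+2) (P : T -> 'M[R]_n.+2).
Hypotheses (oP : forall x, U x -> orthoproj (P x)) (sP : smooth U P).
Hypothesis cscP : forall x, U x -> oproj (csc sigma x) = complexify (P x).
Implicit Types (x : T) (i j : 'I_2).
Local Notation N := (split_form P).

Lemma cpartial_complexify a b i (A : T -> 'M[R]_(a.+1, b.+1)) x :
  cpartial i (fun y => complexify (A y)) x = complexify (partial i A x).
Proof.
have E1 : (fun y => re_mx (complexify (A y))) = A by apply/funext => y; exact: complexify_re.
have E2 : (fun y => im_mx (complexify (A y))) = fun=> 0.
  by apply/funext => y; exact: complexify_im.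
by rewrite /cpartial E1 E2 partial_cst complexify0 scaler0 addr0.
Qed.

Lemma csmooth_complexify a b (A : T -> 'M[R]_(a.+1, b.+1)) : smooth U A ->
  csmooth U (fun y => complexify (A y)).
Proof.
move=> sA; split.
  by rewrite (_ : (fun y => _) = A)//; apply/funext => y; exact: complexify_re.
rewrite (_ : (fun y => _) = fun=> 0); first exact/(smoothP oU _)/smooth_mxcst.
by apply/funext => y; exact: complexify_im.
Qed.

(** The projection onto S is real, so D acts separately on real and imaginary parts. *)
Lemma connE a i (F : T -> 'M[C]_(a.+1, n.+2)) x : U x ->
  conn sigma i F x = complexify (split_conn P i (fun y => re_mx (F y)) x)
    + 'i *: complexify (split_conn P i (fun y => im_mx (F y)) x).
Proof.
move=> Ux; have CE y : U y -> 1%:M - oproj (csc sigma y) = complexify (1%:M - P y).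
  by move=> Uy; rewrite cscP// complexifyB complexify1.
have r1 y : U y -> re_mx (F y *m oproj (csc sigma y)) = re_mx (F y) *m P y.
  by move=> Uy; rewrite cscP// re_mulmxC.
have i1 y : U y -> im_mx (F y *m oproj (csc sigma y)) = im_mx (F y) *m P y.
  by move=> Uy; rewrite cscP// im_mulmxC.
have r2 y : U y -> re_mx (F y *m (1%:M - oproj (csc sigma y))) = re_mx (F y) *m (1%:M - P y).
  by move=> Uy; rewrite CE// re_mulmxC.
have i2 y : U y -> im_mx (F y *m (1%:M - oproj (csc sigma y))) = im_mx (F y) *m (1%:M - P y).
  by move=> Uy; rewrite CE// im_mulmxC.
have alg (b1 b2 c1 c2 : 'M[R]_(a.+1, n.+2)) (p1 p2 : 'M[R]_n.+2) :
    (complexify b1 + 'i *: complexify c1) *m complexify p1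
    + (complexify b2 + 'i *: complexify c2) *m complexify p2
    = complexify (b1 *m p1 + b2 *m p2) + 'i *: complexify (c1 *m p1 + c2 *m p2).
  rewrite !complexifyD !complexifyM !mulmxDl -!scalemxAl scalerDr.
  by rewrite addrACA.
rewrite /conn /cpartial (partial_eq i oU r1 Ux) (partial_eq i oU i1 Ux).
rewrite (partial_eq i oU r2 Ux) (partial_eq i oU i2 Ux) (CE x Ux) (cscP Ux).
exact: alg.
Qed.

Lemma conn_complexify a i (A : T -> 'M[R]_(a.+1, n.+2)) (F : T -> 'M[C]_(a.+1, n.+2)) x :
  (forall y, U y -> F y = complexify (A y)) -> U x ->
  conn sigma i F x = complexify (split_conn P i A x).
Proof.
move=> FA Ux; rewrite connE//.
have r1 y : U y -> re_mx (F y) *m P y = A y *m P y.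
  by move=> Uy; rewrite FA// complexify_re.
have r2 y : U y -> re_mx (F y) *m (1%:M - P y) = A y *m (1%:M - P y).
  by move=> Uy; rewrite FA// complexify_re.
have i1 y : U y -> im_mx (F y) *m P y = 0.
  by move=> Uy; rewrite FA// complexify_im mul0mx.
have i2 y : U y -> im_mx (F y) *m (1%:M - P y) = 0.
  by move=> Uy; rewrite FA// complexify_im mul0mx.
rewrite /split_conn (partial_eq i oU r1 Ux) (partial_eq i oU r2 Ux).
rewrite (partial_eq i oU i1 Ux) (partial_eq i oU i2 Ux) !partial_cst !mul0mx addr0.
by rewrite complexify0 scaler0 addr0.
Qed.

Lemma conn1 i x : U x -> conn sigma i (fun=> 1%:M : 'M[C]_n.+2) x = - complexify (N i x).
Proof.
move=> Ux; rewrite (conn_complexify i (A := fun=> 1%:M) _ Ux); last first.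
  by move=> y _; rewrite complexify1.
rewrite (split_connE oP sP i Ux (differentiable_cst _ _)) partial_cst mul1mx sub0r.
exact: complexifyN.
Qed.

Lemma NformE i x : U x -> Nform sigma i x = complexify (N i x).
Proof.
move=> Ux; rewrite /Nform conn1// opprK.
have -> : (fun=> 1%:M : 'M[C]_n.+2) = fun y : T => complexify (1%:M : 'M[R]_n.+2).
  by apply/funext => y; rewrite complexify1.
by rewrite cpartial_complexify partial_cst complexify0 add0r.
Qed.

Lemma conn_EndE i (A : T -> 'M[R]_n.+2) (F : T -> 'M[C]_n.+2) x :
  (forall y, U y -> F y = complexify (A y)) -> U x -> differentiable A x ->
  conn_End sigma i F x = complexify (split_connEnd P i A x).
Proof.
move=> FA Ux dA; rewrite /conn_End (conn_complexify i FA Ux) conn1// FA//.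
rewrite (split_connE oP sP i Ux dA) /split_connEnd [RHS]complexifyD (complexifyM (N i x)).
by rewrite mulNmx opprK.
Qed.

Lemma dDE (omega : 'I_2 -> T -> 'M[R]_n.+2) (F : 'I_2 -> T -> 'M[C]_n.+2) x :
  (forall i y, U y -> F i y = complexify (omega i y)) -> U x ->
  (forall i, differentiable (omega i) x) ->
  dD sigma F x = complexify (split_dD P omega x).
Proof.
move=> FA Ux dO; rewrite /dD (conn_EndE 0 (FA 1) Ux (dO 1)) (conn_EndE 1 (FA 0) Ux (dO 0)).
by rewrite -complexifyB.
Qed.

Lemma hodgeE (omega : 'I_2 -> T -> 'M[R]_n.+2) (F : 'I_2 -> T -> 'M[C]_n.+2) i x :
  (forall j, F j x = complexify (omega j x)) ->
  hodge sigma F i x = complexify (- \sum_j complex_structure sigma x i j *: omega j x).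
Proof.
move=> FA; rewrite /hodge /comp_J complexifyN complexify_sum; congr (- _).
by apply: eq_bigr => j _; rewrite FA complexifyZ.
Qed.

End ComplexSplitting.

(** * Change of lift sigma = h f: conformal invariance of the complex structure and of S *)

Section Lift.
Variables (R : realType) (n : nat).
Local Notation T := ('rV[R]_2).
Local Notation V := ('rV[R]_n.+2).
Local Notation G := (lorentz_gram R n.+1).
Variables (U : set T) (oU : open U) (sigma : T -> V).
Hypothesis lift : lift_of_surface U sigma.
Variables (f : T -> V) (h : T -> R).
Hypotheses (sf : smooth U f) (ff : forall x, U x -> lorentz (f x) (f x) = 0).
Hypotheses (sh : smooth_fun U h) (h0 : forall x, U x -> h x != 0).
Hypothesis liftE : forall x, U x -> sigma x = h x *: f x.
Implicit Types (x : T) (i j k : 'I_2).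

Let ss : smooth U sigma. Proof. exact: lift.1. Qed.
Let dh x : U x -> differentiable h x.
Proof. exact: ksmooth_diff (sh 0). Qed.

Lemma partial_lift i x : U x ->
  partial i sigma x = h x *: partial i f x + spartial i h x *: f x.
Proof.
move=> Ux; rewrite (partial_eq i oU liftE Ux).
exact: partial_scale (dh Ux) (smooth_diff sf Ux).
Qed.

Let fdf i x : U x -> lorentz (f x) (partial i f x) = 0.
Proof.
move=> Ux; have := spartial_lorentz i (smooth_diff sf Ux) (smooth_diff sf Ux).
rewrite (spartial_cst_eq oU i ff Ux) lorentzC => /esym/eqP.
by rewrite -mulr2n mulrn_eq0 /= => /eqP.
Qed.

Lemma metric_lift x : U x -> metric sigma x = (h x) ^+ 2 *: metric f x.
Proof.
move=> Ux; have alg (a b p : V) (r c d : R) : lorentz p p = 0 -> lorentz p a = 0 ->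
    lorentz p b = 0 -> lorentz (r *: a + c *: p) (r *: b + d *: p) = r ^+ 2 * lorentz a b.
  move=> pp pa pb; rewrite !(lorentzDl, lorentzDr, lorentzZl, lorentzZr) pp pb (lorentzC a p) pa.
  by rewrite !mulr0 !addr0 mulrA.
have sc (c : R) (M : 'M[R]_2) k l : c * M k l = (c *: M) k l by rewrite mxE.
apply/matrixP => i j; apply: etrans _ (sc _ _ _ _).
apply: etrans _ (congr1 ( *%R _) (esym (metric_entry f x i j))).
apply: (etrans (metric_entry sigma x i j)).
apply: (etrans (congr2 (@lorentz _ _) (partial_lift i Ux) (partial_lift j Ux))).
exact: alg (ff Ux) (fdf i Ux) (fdf j Ux).
Qed.

Lemma det_metric_lift x : U x -> \det (metric sigma x) = (h x) ^+ 4 * \det (metric f x).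
Proof. by move=> Ux; rewrite metric_lift// detZ -exprM. Qed.

(** For nonzero X, df(X) is orthogonal to the null vector [f] and, by the immersion condition on
    sigma, not a multiple of it; hence it is spacelike and the metric is positive definite. *)
Lemma det_metric_gt0 x : U x -> 0 < \det (metric f x).
Proof.
move=> Ux; apply: det2_gt0 (metric_tr f x) _ => X X0.
have [s0 _ im] := lift.2 x Ux.
pose w := X 0 0 *: partial 0 f x + X 0 1 *: partial 1 f x.
have wE : X *m Defs.jacobian f x = w.
  by rewrite mulmx_sum_row ord2_sum !(row_jacobian f x).
have -> : (X *m metric f x *m X^T) 0 0 = lorentz w w.
  by rewrite metricE -wE /lorentz trmx_mul !mulmxA.
have f0 : f x != 0.
  by apply: contraNneq s0 => f0; rewrite liftE// f0 scaler0.
apply: (lorentz_null_perp_gt0 f0 (ff Ux)).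
  have wf k : lorentz (partial k f x) (f x) = 0 by rewrite lorentzC; exact: fdf.
  have alg (a b p : V) (c d : R) : lorentz a p = 0 -> lorentz b p = 0 ->
      lorentz (c *: a + d *: b) p = 0.
    by move=> ap bp; rewrite lorentzDl !lorentzZl ap bp !mulr0 addr0.
  exact: alg (wf 0) (wf 1).
apply: contra (im X X0) => wf.
have fs : (f x <= sigma x)%MS.
  by rewrite liftE// (eqmx_scale _ (h0 Ux)).
have alg (a b p : V) (r c d x0 x1 : R) :
    x0 *: (r *: a + c *: p) + x1 *: (r *: b + d *: p)
    = r *: (x0 *: a + x1 *: b) + (x0 * c + x1 * d) *: p.
  rewrite !scalerDr addrACA !scalerA ![_ * r]mulrC; congr (_ + _).
  by rewrite scalerDl.
rewrite (derive_partial X (smooth_diff ss Ux)) (partial_lift 0 Ux) (partial_lift 1 Ux) alg.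
by rewrite addmx_sub// scalemx_sub// (submx_trans wf).
Qed.

Variable v : V.
Hypothesis fv : forall x, U x -> lorentz (f x) v = -1.

Lemma null_immersion_lift : null_immersion U f v.
Proof.
by split=> // x Ux; exact: det_metric_gt0.
Qed.

Let Hf := null_immersion_lift.

Lemma area_lift x : U x -> area sigma x = (h x) ^+ 2 * area f x.
Proof.
have alg (d d' c : R) : d' = c ^+ 4 * d -> Num.sqrt d' = c ^+ 2 * Num.sqrt d.
  move=> ->; rewrite sqrtrM ?exprn_even_ge0//.
  by rewrite (exprM _ 2 2) sqrtr_sqr ger0_norm// sqr_ge0.
by move=> Ux; exact: alg (det_metric_lift Ux).
Qed.

Lemma complex_structure_lift x : U x -> complex_structure sigma x = complex_structure f x.
Proof.
have alg (a a' c : R) (M M' E : 'M[R]_2) : a' = c ^+ 2 * a -> M' = c ^+ 2 *: M -> c != 0 ->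
    a'^-1 *: (M' *m E) = a^-1 *: (M *m E).
  move=> -> -> c0; rewrite -scalemxAl scalerA.
  by rewrite invfM mulrAC mulVf ?mul1r// sqrf_eq0.
by move=> Ux; exact: alg (area_lift Ux) (metric_lift Ux) (h0 Ux).
Qed.

Local Notation t x := (col_mx (f x) (Defs.jacobian f x)).

Lemma partial_lift_tangent j x : U x -> (partial j sigma x <= t x)%MS.
Proof.
move=> Ux; rewrite partial_lift// addmx_sub// scalemx_sub//.
  exact: sub_tangent_df.
exact: sub_tangent_f.
Qed.

Lemma ddlift_tangent i j x : U x ->
  (partial i (partial j sigma) x - h x *: partial i (partial j f) x <= t x)%MS.
Proof.
move=> Ux; have sdh : differentiable (spartial j h) x.
  have : ksmooth U 0 (spartial j h) by case: (sh 1) => _; exact.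
  by move/ksmooth_diff; exact.
have dfj := smooth_diff (smooth_partial j sf) Ux.
have d1 := differentiable_scale (dh Ux) dfj.
have d2 := differentiable_scale sdh (smooth_diff sf Ux).
have fs := sub_tangent_f f x; have dfs k := sub_tangent_df f k x.
rewrite (partial_eq i oU (partial_lift j) Ux) (partialD i d1 d2).
rewrite (partial_scale i (dh Ux) dfj) (partial_scale i sdh (smooth_diff sf Ux)).
move: (partial i (partial j f) x) (partial i f x) (partial j f x) (dfs i) (dfs j) => a b c b0 c0.
have alg (A B C D : V) : A + B + (C + D) - A = B + (C + D).
  by rewrite -(addrA A) (addrC A) addrK.
by rewrite alg !addmx_sub ?scalemx_sub.
Qed.

(** Modulo <f, df> only second derivatives of [f] count. In dimension 2 the area density times the
    inverse metric is conformally invariant; the remaining factor is h from sigma = h f times h^-2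
    from the inverse area. *)
Lemma laplacian_lift x : U x ->
  (laplacian sigma sigma x - (h x)^-1 *: trace_ddf f x <= t x)%MS.
Proof.
move=> Ux; have A0 := area_gt0 Hf Ux.
have unit_m y : U y -> metric sigma y \in unitmx.
  move=> Uy; rewrite unitmxE unitfE det_metric_lift// mulf_neq0 ?expf_neq0 ?h0//.
  by rewrite gt_eqF ?det_metric_gt0.
have sm : smooth_mx U (metric sigma).
  by move=> i j; under eq_fun do rewrite metric_entry; apply: (smooth_lorentz oU); exact: smooth_partial.
have dw i j : differentiable (fun y => area sigma y * invmx (metric sigma y) i j) x.
  have dA : differentiable (fun y => h y ^+ 2 * area f y) x.
    apply: differentiableM; last exact: (differentiable_area oU Hf).
    by under eq_fun do rewrite expr2; apply: differentiableM; exact: dh.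
  apply: (differentiableM (f := area sigma)).
    apply: differentiable_near_eq dA; apply: (near_open oU) => // y Uy.
    by rewrite area_lift.
  exact: ksmooth_diff (smooth_mxinv oU unit_m sm i j 0) Ux.
have dds j : differentiable (partial j sigma) x.
  exact: smooth_diff (smooth_partial j ss) Ux.
have E i j : (partial i (fun y => (area sigma y * invmx (metric sigma y) i j) *: partial j sigma y) x
    - (area f x * h x * invmx (metric f x) i j) *: partial i (partial j f) x <= t x)%MS.
  rewrite (partial_scale i (dw i j) (dds j)).
  have wE : area sigma x * invmx (metric sigma x) i j = area f x * invmx (metric f x) i j.
    have alg (a a' c : R) (M M' : 'M[R]_2) : a' = c ^+ 2 * a -> M' = c ^+ 2 *: M ->
        c != 0 -> M \in unitmx -> a' * invmx M' i j = a * invmx M i j.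
      move=> -> -> c0 uM; have c2 : c ^+ 2 != 0 by rewrite expf_neq0.
      rewrite invmxZ; last by rewrite unitmxZ ?unitfE.
      by rewrite mxE mulrACA divff ?mul1r.
    exact: alg (area_lift Ux) (metric_lift Ux) (h0 Ux) (unit_metric Hf Ux).
  have alg r (M : 'M[R]_(r, n.+2)) (a b p : V) (w c A H W : R) :
      (a - H *: b <= M)%MS -> (p <= M)%MS ->
      w = A * W -> (w *: a + c *: p - (A * H * W) *: b <= M)%MS.
    move=> ab pt ->; rewrite addrAC; apply: addmx_sub; last exact: scalemx_sub.
    by rewrite mulrAC -(scalerA (A * W)) -scalerBr scalemx_sub.
  exact: alg (ddlift_tangent i j Ux) (partial_lift_tangent j Ux) wE.
have alg r (M : 'M[R]_(r, n.+2)) (L Y : 'I_2 -> 'I_2 -> V) (W : 'I_2 -> 'I_2 -> R) (a a' c : R) :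
    a' = c ^+ 2 * a -> a != 0 -> c != 0 ->
    (forall i j, (L i j - (a * c * W i j) *: Y i j <= M)%MS) ->
    (a'^-1 *: (\sum_i \sum_j L i j) - c^-1 *: (\sum_i \sum_j W i j *: Y i j) <= M)%MS.
  move=> aE a0 c0 Lt.
  have -> : a'^-1 *: (\sum_i \sum_j L i j) - c^-1 *: (\sum_i \sum_j W i j *: Y i j)
      = a'^-1 *: (\sum_i \sum_j (L i j - (a * c * W i j) *: Y i j)).
    under [in RHS]eq_bigr do rewrite sumrB; rewrite sumrB scalerBr.
    congr (_ - _); rewrite scaler_sumr [RHS]scaler_sumr; apply: eq_bigr => i _.
    rewrite scaler_sumr [RHS]scaler_sumr; apply: eq_bigr => j _.
    by rewrite !scalerA aE; congr (_ *: _); field; rewrite a0 c0.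
  by apply: scalemx_sub; apply: summx_sub => i _; apply: summx_sub => j _; exact: Lt.
exact: alg (area_lift Ux) (lt0r_neq0 A0) (h0 Ux) E.
Qed.

(** This entry is g00 / area. Its nonvanishing makes e_0 and J e_0 a basis of the tangent plane. *)
Lemma complex_structure01_neq0 x : U x -> complex_structure sigma x 0 1 != 0.
Proof.
move=> Ux; have alg (a : R) (M : 'M[R]_2) : a != 0 -> M^T = M -> 0 < \det M ->
    (a^-1 *: (M *m eps2 R)) 0 1 != 0.
  move=> a0 MT; have M10 : M 1 0 = M 0 1 by rewrite -[in LHS]MT mxE.
  rewrite det2 M10 subr_gt0 => M0; rewrite mxE mul_eps2 mulf_neq0 ?invr_eq0//.
  by apply: contraTneq M0 => ->; rewrite mul0r -leNgt -expr2 sqr_ge0.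
rewrite complex_structure_lift//.
exact: alg (lt0r_neq0 (area_gt0 Hf Ux)) (metric_tr f x) (det_metric_gt0 Ux).
Qed.

Local Notation Js x := (\sum_j complex_structure sigma x 0 j *: partial j sigma x).

Lemma tangent_lift x : U x ->
  (sigma x + partial 0 sigma x + Js x :=: t x)%MS.
Proof.
move=> Ux; have alg (s p a b fa fb : V) (j0 j1 c r r' : R) :
    s = c *: p -> a = c *: fa + r *: p -> b = c *: fb + r' *: p -> c != 0 -> j1 != 0 ->
    (s + a + (j0 *: a + j1 *: b)%R :=: p + fa + fb)%MS.
  move=> sE aE bE c0 J0; apply/eqmxP/andP; split.
    set B := (_ + fb)%MS.
    have pB : (p <= B)%MS by rewrite /B -addsmxA addsmxSl.
    have aB : (a <= B)%MS.
      rewrite aE addmx_sub ?scalemx_sub//.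
      by apply: submx_trans (addsmxSl _ _); exact: addsmxSr.
    have bB : (b <= B)%MS by rewrite bE addmx_sub ?scalemx_sub// addsmxSr.
    have wB : ((j0 *: a + j1 *: b)%R <= B)%MS by apply: addmx_sub; exact: scalemx_sub.
    have sB : (s <= B)%MS by rewrite sE scalemx_sub.
    by rewrite !addsmx_sub sB aB wB.
  set A := (_ + (_ *: a + _)%R)%MS.
  have sA : (s <= A)%MS by rewrite /A -addsmxA addsmxSl.
  have aA : (a <= A)%MS by apply: submx_trans (addsmxSl _ _); exact: addsmxSr.
  have wA : ((j0 *: a + j1 *: b)%R <= A)%MS by exact: addsmxSr.
  have bA : (b <= A)%MS.
    rewrite -(eqmx_scale b J0) -[X in (X <= _)%MS](addKr (j0 *: a)).
    by rewrite addmx_sub ?eqmx_opp ?scalemx_sub.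
  have pA : (p <= A)%MS by rewrite -(eqmx_scale p c0) -sE.
  rewrite !addsmx_sub pA -(eqmx_scale fa c0) -(eqmx_scale fb c0).
  rewrite -[c *: fa](addrK (r *: p)) -aE -[c *: fb](addrK (r' *: p)) -bE.
  by rewrite !addmx_sub ?eqmx_opp ?scalemx_sub.
rewrite ord2_sum.
apply: (eqmx_trans (alg _ _ _ _ _ _ _ _ _ _ _ (liftE Ux) (partial_lift 0 Ux)
  (partial_lift 1 Ux) (h0 Ux) (complex_structure01_neq0 Ux))).
have frame (p : V) (M : 'M[R]_(2, n.+2)) : (p + row 0 M + row 1 M :=: col_mx p M)%MS.
  apply/eqmxP/andP; split.
    by rewrite -addsmxE !addsmx_sub addsmxSl !(submx_trans (row_sub _ _) (addsmxSr _ _)).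
  rewrite -addsmxE addsmx_sub -{1}addsmxA addsmxSl; apply/row_subP => i.
  have [-> | ->] := ord2_cases i; last exact: addsmxSr.
  by apply: submx_trans (addsmxSl _ _); exact: addsmxSr.
have := frame (f x) (Defs.jacobian f x).
by rewrite (row_jacobian f x 0) (row_jacobian f x 1).
Qed.

Lemma csc_frame_lift x : U x ->
  (sigma x + partial 0 sigma x + Js x + laplacian sigma sigma x :=: csc_frame f x)%MS.
Proof.
move=> Ux; have alg p (M : 'M[R]_(p, n.+2)) (L : 'M[R]_n.+2) (l y : V) (c : R) : (L :=: M)%MS ->
    (l - c *: y <= M)%MS -> c != 0 -> (L + l :=: M + y)%MS.
  move=> LM ly c0; apply: (eqmx_trans (adds_eqmx LM (eqmx_refl _))).
  apply/eqmxP/andP; split; rewrite addsmx_sub addsmxSl /=.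
    rewrite -[l](subrK (c *: y)) addmx_sub//; last by rewrite scalemx_sub// addsmxSr.
    exact: submx_trans ly (addsmxSl _ _).
  rewrite -(eqmx_scale y c0) -[c *: y](subKr l) addmx_sub ?addsmxSr// eqmx_opp.
  exact: submx_trans ly (addsmxSl _ _).
have c0 : (h x)^-1 != 0 by rewrite invr_eq0 h0.
apply: (eqmx_trans (alg _ _ _ _ _ _ (tangent_lift Ux) (laplacian_lift Ux) c0)).
apply: eqmx_sym; apply: (eqmx_trans (null_frame_sub _ _ _)).
by apply: adds_eqmx (eqmx_refl _); exact: addsmxE.
Qed.

End Lift.

(** * The complex spans defining S are complexifications of real ones *)

Section CentralSphere.
Variables (R : realType) (n : nat) (sigma : 'rV[R]_2 -> 'rV[R]_n.+2).
Local Notation T := ('rV[R]_2).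
Local Notation C := (R[i]).
Implicit Types (x : T) (i j : 'I_2).

Lemma comp_JE (omega : 'I_2 -> T -> 'rV[R]_n.+2) (F : 'I_2 -> T -> 'rV[C]_n.+2) i x :
  (forall j, F j x = complexify (omega j x)) ->
  comp_J sigma F i x = complexify (\sum_j complex_structure sigma x i j *: omega j x).
Proof.
move=> FE; rewrite /comp_J complexify_sum; apply: eq_bigr => j _.
by rewrite FE complexifyZ.
Qed.

(** Used with [a] = d sigma(e_0) and [b] = d sigma(J e_0): the two half-combinations are the parts
    of type (1,0) and (0,1). Their sum is [a] and their difference is i [b] up to sign, so they span
    the same complex plane. *)
Lemma adds_conj_eqmx p (L : 'M[C]_(p, n.+2)) (a b : 'rV[C]_n.+2) :
  ((L + (2^-1 *: (a - 'i *: b))%R) + (L + (2^-1 *: (a + 'i *: b))%R) :=: L + a + b)%MS.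
Proof.
have i0 : 'i != 0 :> C by exact: neq0Ci.
have h0 : 2^-1 != 0 :> C by rewrite invr_eq0 pnatr_eq0.
apply/eqmxP/andP; split.
  have aB : (a <= L + a + b)%MS by apply: submx_trans (addsmxSl _ _); exact: addsmxSr.
  have bB : (b <= L + a + b)%MS by exact: addsmxSr.
  have LB : (L <= L + a + b)%MS by rewrite -addsmxA addsmxSl.
  have mB : ((2^-1 *: (a - 'i *: b))%R <= L + a + b)%MS.
    by apply: scalemx_sub; apply: addmx_sub => //; rewrite eqmx_opp scalemx_sub.
  have pB : ((2^-1 *: (a + 'i *: b))%R <= L + a + b)%MS.
    by apply: scalemx_sub; apply: addmx_sub => //; rewrite scalemx_sub.
  by rewrite !addsmx_sub LB mB pB.
set u := (2^-1 *: (a - _)); set w := (2^-1 *: (a + _)); set A := (X in (_ <= X)%MS).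
have LA : (L <= A)%MS by apply: submx_trans (addsmxSl _ _); exact: addsmxSl.
have uA : (u <= A)%MS by apply: submx_trans (addsmxSl _ _); exact: addsmxSr.
have wA : (w <= A)%MS by apply: submx_trans (addsmxSr _ _); exact: addsmxSr.
have hh : 2^-1 + 2^-1 = 1 :> C by rewrite -mulr2n -[2^-1 *+ 2]mulr_natr mulVf // pnatr_eq0.
have half (c d : 'rV[C]_n.+2) : 2^-1 *: (c - d) + 2^-1 *: (c + d) = c.
  rewrite -scalerDr addrACA addNr addr0 scalerDr -scalerDl.
  by apply: (etrans (congr1 ( *:%R^~ c) hh)); exact: scale1r.
have aE : u + w = a by exact: half.
have bE : w - u = 'i *: b.
  rewrite /u /w -scalerN opprB addrC [a + _]addrC.
  exact: half.
by rewrite !addsmx_sub LA -(eqmx_scale b i0) -bE -{1}aE !addmx_sub ?eqmx_opp.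
Qed.

Local Notation Js x := (\sum_j complex_structure sigma x 0 j *: partial j sigma x).

Lemma Lambda1E x :
  (Lambda1 sigma x :=: complexify (sigma x + partial 0 sigma x + Js x)%MS)%MS.
Proof.
have FE j : cpartial j (Lambda sigma) x = complexify (partial j sigma x).
  exact: (cpartial_complexify j sigma x).
have JE := comp_JE 0 (omega := fun j => partial j sigma) (F := fun j => cpartial j (Lambda sigma)) FE.
rewrite /Lambda1 /Lambda10 /Lambda01 /part10 /part01 JE FE.
apply: (eqmx_trans (adds_conj_eqmx _ _ _)).
apply: eqmx_sym; apply: (eqmx_trans (map_addsmx _ _ _)).
by apply: adds_eqmx (eqmx_refl _); exact: map_addsmx.
Qed.

Lemma cscE x : (csc sigma x :=:
  complexify (sigma x + partial 0 sigma x + Js x + laplacian sigma sigma x)%MS)%MS.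
Proof.
apply: eqmx_sym; apply: (eqmx_trans (map_addsmx _ _ _)); apply: eqmx_sym.
by apply: adds_eqmx (eqmx_refl _); exact: Lambda1E.
Qed.

End CentralSphere.

(** * The lift in S_v and the real description of S and of its complement *)

Section SpaceFormLift.
Variables (R : realType) (n : nat).
Local Notation T := ('rV[R]_2).
Local Notation V := ('rV[R]_n.+2).
Variables (U : set T) (oU : open U) (sigma : T -> V) (v : V).
Hypotheses (lift : lift_of_surface U sigma)
  (hv : forall x, U x -> lorentz (sigma x) v != 0).
Implicit Types (x : T) (i j k : 'I_2).

Definition height x : R := - lorentz (sigma x) v.
Local Notation f := (surface_in_space_form v sigma).

Lemma height_neq0 x : U x -> height x != 0.
Proof. by move=> Ux; rewrite oppr_eq0 hv. Qed.

Lemma heightE x : U x -> sigma x = height x *: f x.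
Proof.
move=> Ux; rewrite /surface_in_space_form /height scalerA mulrNN divff ?hv//.
by rewrite scale1r.
Qed.

Lemma smooth_height : smooth_fun U height.
Proof.
have sc : smooth U (fun=> v : V) by exact/(smoothP oU _)/smooth_mxcst.
move=> k; apply: (ksmooth_eq oU (h := fun x => (-1) * lorentz (sigma x) v)).
  by move=> x _; rewrite mulN1r.
by apply: (ksmoothM oU (ksmooth_cst oU k (-1))); exact: (smooth_lorentz oU lift.1 sc).
Qed.

Lemma smooth_space_form : smooth U f.
Proof.
apply: (smooth_eq oU (M := fun x => (height x)^-1 *: sigma x)).
  by move=> x Ux; rewrite /surface_in_space_form /height invrN.
apply/(smoothP oU _); apply: (smooth_mxscale oU); last exact/(smoothP oU _)/lift.1.
by move=> k; apply: (ksmoothV oU height_neq0); exact: smooth_height.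
Qed.

Lemma space_form_null x : U x -> lorentz (f x) (f x) = 0.
Proof. by case/lift.2 => _ ss _; rewrite lorentzZl lorentzZr ss !mulr0. Qed.

Lemma space_form_height x : U x -> lorentz (f x) v = -1.
Proof. by move=> Ux; rewrite lorentzZl mulNr mulVf ?hv. Qed.

Lemma null_immersion_space_form : null_immersion U f v.
Proof.
exact (null_immersion_lift oU lift smooth_space_form space_form_null smooth_height
  height_neq0 heightE space_form_height).
Qed.
Let Hf := null_immersion_space_form.

Local Notation P := (csc_proj f).

Lemma csc_complexify x : U x -> (csc sigma x :=: complexify (P x))%MS.
Proof.
move=> Ux; apply: (eqmx_trans (cscE sigma x)); apply/map_eqmx.
apply: (eqmx_trans (csc_frame_lift oU lift smooth_space_form space_form_null smooth_height
  height_neq0 heightE space_form_height Ux)).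
exact: gram_proj_eqmx (csc_frame_nondeg oU Hf Ux).
Qed.

Lemma orthoproj_cscC x : U x -> orthoproj (complexify (P x)).
Proof. by move=> Ux; apply: orthoproj_complexify; exact: (orthoproj_csc oU Hf Ux). Qed.

Lemma oproj_csc x : U x -> oproj (csc sigma x) = complexify (P x).
Proof. by move=> Ux; apply: oprojE (orthoproj_cscC Ux) (csc_complexify Ux). Qed.

Lemma Lambda1_complexify x : U x ->
  (Lambda1 sigma x :=: complexify (col_mx (f x) (Defs.jacobian f x)))%MS.
Proof.
move=> Ux; apply: (eqmx_trans (Lambda1E sigma x)); apply/map_eqmx.
exact (tangent_lift oU lift smooth_space_form space_form_null smooth_height
  height_neq0 heightE space_form_height Ux).
Qed.

Lemma sub_csc_perp p (w : 'M[R[i]]_(p, n.+2)) x : U x ->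
  reflect (w *m complexify (P x) = 0) (w <= csc_perp sigma x)%MS.
Proof. by move=> Ux; apply: sub_perp_orthoproj (orthoproj_cscC Ux) (csc_complexify Ux). Qed.

Lemma sub_csc p (w : 'M[R[i]]_(p, n.+2)) x : U x ->
  reflect (w *m complexify (P x) = w) (w <= csc sigma x)%MS.
Proof. by move=> Ux; apply: sub_orthoproj (orthoproj_cscC Ux) (csc_complexify Ux). Qed.

End SpaceFormLift.

(** * Laurent polynomials of type 1 and type components *)

Section LaurentForms.
Variables (R : realType) (n : nat) (sigma : 'rV[R]_2 -> 'rV[R]_n.+2).
Local Notation T := ('rV[R]_2).
Local Notation C := (R[i]).
Implicit Types (x : T) (i j : 'I_2).

Lemma laurent1E (p : int -> T -> 'rV[C]_n.+2) (l : C) x :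
  laurent 1 p l x = l^-1 *: p (-1) x + p 0 x + l *: p 1 x.
Proof.
rewrite /laurent !big_ord_recl big_ord0 addr0 addrA.
transitivity (l ^ (-1) *: p (-1) x + l ^ 0 *: p 0 x + l ^ 1 *: p 1 x); first by [].
by rewrite expr0z expr1z scale1r.
Qed.

Lemma scale_form_part (W : lmodType C) (c r u : C) (a b : W) :
  r *: (c *: a + u *: (c *: b)) = c *: (r *: (a + u *: b)).
Proof.
rewrite [RHS]scalerA [c * r]mulrC -[RHS]scalerA; congr (_ *: _).
by rewrite [RHS]scalerDr !scalerA [c * u]mulrC.
Qed.

Section Part.
Variables (omega : 'I_2 -> T -> 'M[C]_n.+2) (b : 'I_2 -> 'rV[C]_n.+2).
Variables (s : 'rV[C]_n.+2) (c : C) (x : T).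
Hypothesis sE : forall j, s *m omega j x = c *: b j.

Lemma mul_comp_J i : s *m comp_J sigma omega i x = c *: comp_J sigma (fun j _ => b j) i x.
Proof.
have sca (W : lmodType C) (a d : C) (w : W) : a *: (d *: w) = d *: (a *: w).
  by rewrite !scalerA mulrC.
rewrite /comp_J mulmx_sumr scaler_sumr; apply: eq_bigr => j _.
by rewrite -scalemxAr sE; exact: sca.
Qed.

(** The type decomposition acts only on the form index, so it commutes with evaluation at a fixed
    vector. For p(lambda) this lets N and q be compared as multiples of one form dw. *)
Lemma mul_part10 i : s *m part10 sigma omega i x = c *: part10 sigma (fun j _ => b j) i x.
Proof.
have E : s *m part10 sigma omega i x
    = 2^-1 *: (c *: b i - 'i *: (c *: comp_J sigma (fun j _ => b j) i x)).
  by rewrite -mul_comp_J -sE scalemxAr -mulmxBr scalemxAr.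
have alg (W : lmodType C) (r u : C) (a d : W) :
    r *: (c *: a - u *: (c *: d)) = c *: (r *: (a - u *: d)).
  by rewrite -!scaleNr scale_form_part.
by apply: (etrans E); exact: alg.
Qed.

Lemma mul_part01 i : s *m part01 sigma omega i x = c *: part01 sigma (fun j _ => b j) i x.
Proof.
have E : s *m part01 sigma omega i x
    = 2^-1 *: (c *: b i + 'i *: (c *: comp_J sigma (fun j _ => b j) i x)).
  by rewrite -mul_comp_J -sE scalemxAr -mulmxDr scalemxAr.
by apply: (etrans E); exact: scale_form_part.
Qed.

End Part.

Lemma part10D01 (b : 'I_2 -> 'rV[C]_n.+2) i x :
  part10 sigma (fun j _ => b j) i x + part01 sigma (fun j _ => b j) i x = b i.
Proof.
have alg (W : lmodType C) (a d : W) : 2^-1 *: (a - d) + 2^-1 *: (a + d) = a.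
  have hh : 2^-1 + 2^-1 = 1 :> C by rewrite -mulr2n -[2^-1 *+ 2]mulr_natr mulVf // pnatr_eq0.
  by rewrite -scalerDr addrACA addNr addr0 scalerDr -scalerDl hh scale1r.
exact: alg.
Qed.

End LaurentForms.

(** * Conserved quantities of type 1 and parallel mean curvature *)

Section ConstrainedWillmore.
Variables (R : realType) (n : nat).
Local Notation T := ('rV[R]_2).
Local Notation V := ('rV[R]_n.+2).
Local Notation C := (R[i]).
Variables (U : set T) (oU : open U) (sigma : T -> V) (v : V).
Hypotheses (lift : lift_of_surface U sigma)
  (hv : forall x, U x -> lorentz (sigma x) v != 0).
Implicit Types (x : T) (i j : 'I_2).

Local Notation f := (surface_in_space_form v sigma).
Local Notation P := (csc_proj f).
Local Notation N := (split_form P).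
Local Notation vp := (vperp f v).
Local Notation z := (vtan f v).

Let Hf : null_immersion U f v. Proof. exact (null_immersion_space_form oU lift hv). Qed.
Let oP x : U x -> orthoproj (P x). Proof. exact: (orthoproj_csc oU Hf). Qed.
Let sP : smooth U P. Proof. exact: (smooth_csc_proj oU Hf). Qed.
Let cscP x : U x -> oproj (csc sigma x) = complexify (P x).
Proof. exact: (oproj_csc oU lift hv). Qed.
Let svp : smooth U vp. Proof. exact: (smooth_vperp oU Hf). Qed.
Let sz : smooth U z. Proof. exact: (smooth_vtan oU Hf). Qed.

(** As p_0 lies in S, the S^perp-component of p(1) = v reads p_1 + conj p_1 = w. P is real, so D p_1
    = 0 passes to the real part w/2. *)
Lemma parallel_vperp_of_conserved q p :
  polynomial_conserved_quantity sigma U q 1 p ->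
  (forall i x, U x -> conn sigma i (p 1) x = 0) ->
  (forall x, U x -> laurent 1 p 1 x = complexify v) ->
  forall i x, U x -> partial i vp x *m (1%:M - P x) = 0.
Proof.
move=> [coef _] par1 lv i x Ux.
have re1 y : U y -> re_mx (p 1 y) = 2^-1 *: vp y.
  move=> Uy; have [_ /(_ y Uy) conj1 /(_ y Uy)/(sub_csc_perp oU lift hv _ Uy) p1P] := coef 1 isT.
  have [_ _ /(_ y Uy)/(sub_csc oU lift hv _ Uy) p0P] := coef 0 isT.
  have [_ _ /(_ y Uy)/(sub_csc_perp oU lift hv _ Uy) pNP] := coef (-1) isT.
  have := lv y Uy; rewrite laurent1E invr1 !scale1r.
  move=> /(congr1 (fun w => re_mx (w *m complexify (1%:M - P y)))).
  rewrite -complexifyM complexify_re !mulmxDl complexifyB complexify1.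
  rewrite !(mulmxBr _ 1%:M) !mulmx1 p1P p0P pNP subrr !subr0 addr0.
  have -> : p (-1) y = conj_mx (p 1 y) by exact: conj1.
  move=> E; apply: (scalerI (_ : (2 : R) != 0)); first by rewrite pnatr_eq0.
  rewrite scalerA divff ?pnatr_eq0// scale1r /vperp mulmxBr mulmx1 -E.
  apply/matrixP => a b; rewrite !mxE; case: (p 1 y a b) => r s /=.
  by ring.
have svp2 : differentiable (fun y => 2^-1 *: vp y) x.
  exact: differentiable_scale (differentiable_cst _ x) (smooth_diff svp Ux).
have := congr1 (@re_mx R _ _) (par1 i x Ux); rewrite (connE oU cscP i _ Ux).
have reE (A B : V) : re_mx (complexify A + 'i *: complexify B) = A.
  rewrite -[RHS](complexify_re A); apply/matrixP => a b; rewrite -complexiE !mxE.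
  by rewrite /= !mul0r mulr0 subr0 addr0.
rewrite reE /split_conn.
have e1 y : U y -> re_mx (p 1 y) *m P y = 0.
  by move=> Uy; rewrite re1// -scalemxAl (vperp_proj oU Hf Uy) scaler0.
have e2 y : U y -> re_mx (p 1 y) *m (1%:M - P y) = 2^-1 *: vp y.
  by move=> Uy; rewrite mulmxBr mulmx1 e1// re1// subr0.
rewrite (partial_eq i oU e1 Ux) (partial_eq i oU e2 Ux) partial_cst mul0mx add0r.
rewrite (partialZ 2^-1 i (smooth_diff svp Ux)) -scalemxAl => E.
have /eqP : 2^-1 *: (partial i vp x *m (1%:M - P x)) = 0.
  by apply: (etrans E); apply/matrixP => a b; rewrite !mxE.
by rewrite scaler_eq0 invr_eq0 pnatr_eq0 /= => /eqP.
Qed.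

Lemma hodge_NformE i x : U x -> hodge sigma (Nform sigma) i x = complexify (hodge_form f i x).
Proof.
move=> Ux; have Jf := complex_structure_lift oU (smooth_space_form oU lift hv)
  (space_form_null v lift) (smooth_height oU v lift) (height_neq0 hv) (heightE hv) Ux.
exact (etrans (hodgeE sigma (omega := N) i (fun j => NformE oU oP sP cscP j Ux))
  (congr1 (fun J : 'M[R]_2 => complexify (- \sum_j J i j *: N j x)) Jf)).
Qed.

Section Parallel.
Hypothesis par : forall i x, U x -> partial i vp x *m (1%:M - P x) = 0.

Definition pmc_multiplierC i x := complexify (pmc_multiplier f v i x).
Local Notation q := pmc_multiplierC.

Lemma smooth_pmc_multiplier i : smooth U (pmc_multiplier f v i).
Proof.
have sc : smooth_mx U (fun=> lorentz_gram R n.+1) by exact: smooth_mxcst.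
have s1 : smooth_mx U f by apply/(smoothP oU _); exact: null_immersion_smooth Hf.
have s2 : smooth_mx U (fun x => 2^-1 *: partial i vp x).
  apply: (smooth_mxscale oU) => [p|]; first exact: ksmooth_cst.
  by apply/(smoothP oU _); exact: smooth_partial.
apply/(smoothP oU _); apply: (smooth_mxM oU) => //.
by apply: (smooth_mxB oU); apply: (smooth_mxM oU) => //; exact: smooth_mxtr.
Qed.

Lemma multiplier_pmc : multiplier sigma U q.
Proof.
split.
- by move=> i; apply: (csmooth_complexify oU); exact: smooth_pmc_multiplier.
- move=> i x Ux; pose h := height sigma v x.
  have h0 : h != 0 by exact: (height_neq0 hv).
  (* The multiplier is a wedge with [f], whereas sigma = h f is required in the first slot: the
     factor h^-1 goes to the second. *)
  exists (complexify (h^-1 *: (2^-1 *: partial i vp x))).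
    rewrite (Lambda1_complexify oU lift hv Ux) /complexify map_submx.
    do 2!apply: scalemx_sub; rewrite (dvperp_tangent oU Hf par i Ux).
    by apply: (submx_trans (submxMl _ _)); rewrite -addsmxE addsmxSr.
  have sE : sigma x = h *: f x by exact: (heightE hv).
  have alg (u w : V) (c : R) : c != 0 -> wedge u w = wedge (c *: u) (c^-1 *: w).
    by move=> c0; rewrite wedgeZl wedgeZr scalerA divff// scale1r.
  rewrite /q /pmc_multiplier /Lambda sE -complexify_wedge.
  by apply: (congr1 (@complexify R _ _)); exact: alg.
- by move=> i x _; exact: complexify_conj.
- move=> x Ux; rewrite (dDE oU oP sP cscP (omega := pmc_multiplier f v))//.
    by rewrite (split_dD_pmc_multiplier oU Hf par Ux) complexify0.
  by move=> i; exact: (differentiable_pmc_multiplier oU Hf).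
- move=> x Ux; rewrite (dDE oU oP sP cscP (omega := hodge_form f)); last 2 first.
  + exact: Ux.
  + by move=> i; exact: (differentiable_hodge_form oU Hf).
    rewrite (pmc_constrained_willmore oU Hf par Ux) complexifyZ complexifyB.
    rewrite !complexify_commutator /bracket !hodge_NformE//.
    by congr (_ *: _); rewrite rmorph_nat.
  by move=> i y Uy; exact: hodge_NformE.
Qed.

(** Every nonzero index carries w/2; a Laurent polynomial of type 1 reads only the indices -1, 0 and
    1. *)
Definition pmc_conserved (k : int) x : 'rV[C]_n.+2 :=
  if k == 0 then complexify (z x) else complexify (2^-1 *: vp x).
Local Notation p := pmc_conserved.

Let svp2 : smooth U (fun x => 2^-1 *: vp x).
Proof.
apply/(smoothP oU _); apply: (smooth_mxscale oU) => [k|]; first exact: ksmooth_cst.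
exact/(smoothP oU _).
Qed.

Lemma laurent_pmcE (l : C) x :
  laurent 1 p l x = complexify (z x) + ((l + l^-1) / 2) *: complexify (vp x).
Proof.
rewrite laurent1E /p /= complexifyZ !scalerA addrAC addrC -scalerDl -mulrDl.
by rewrite [l^-1 + l]addrC fmorphV rmorph_nat.
Qed.

Lemma laurent_pmc1 x : laurent 1 p 1 x = complexify v.
Proof.
rewrite laurent_pmcE invr1 -[1 + 1]/(2 : C) divff ?pnatr_eq0// scale1r -complexifyD.
by rewrite vtanD.
Qed.

Lemma conn_pmc_top i x : U x -> conn sigma i (p 1) x = 0.
Proof.
move=> Ux; rewrite (conn_complexify oU cscP i (A := fun y => 2^-1 *: vp y) _ Ux)//.
rewrite (split_connE oP sP i Ux (smooth_diff svp2 Ux)).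
rewrite (partialZ 2^-1 i (smooth_diff svp Ux)) -scalemxAl.
by rewrite (vperp_split_form oU Hf par i Ux) subrr complexify0.
Qed.

(** Here p(lambda) = z + m w with m complex. The real and imaginary multiples of w are parallel, so
    D z = - dw alone remains. *)
Lemma conn_laurent_pmc (l : C) i x : U x ->
  conn sigma i (laurent 1 p l) x = - complexify (partial i vp x).
Proof.
move=> Ux; pose m := (l + l^-1) / 2.
have dz := smooth_diff sz Ux; have dvp := smooth_diff svp Ux.
have E c : split_conn P i (fun y => z y + c *: vp y) x = - partial i vp x.
  have dc := differentiable_scale (differentiable_cst c x) dvp.
  rewrite (split_connE oP sP i Ux (differentiableD dz dc)) (partialD i dz dc).
  rewrite (partialZ c i dvp) mulmxDl -scalemxAl (vperp_split_form oU Hf par i Ux).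
  by rewrite (vtan_split_form oU Hf par i Ux) add0r addrK (dvtan oU Hf i Ux).
have E0 c : split_conn P i (fun y => c *: vp y) x = 0.
  have dc := differentiable_scale (differentiable_cst c x) dvp.
  rewrite (split_connE oP sP i Ux dc) (partialZ c i dvp) -scalemxAl.
  by rewrite (vperp_split_form oU Hf par i Ux) subrr.
have reE : (fun y => re_mx (laurent 1 p l y)) = fun y => z y + complex.Re m *: vp y.
  apply/funext => y; rewrite laurent_pmcE -/m; apply/matrixP => a b; rewrite !mxE.
  by case: (m) => r s /=; rewrite mulr0 subr0.
have imE : (fun y => im_mx (laurent 1 p l y)) = fun y => complex.Im m *: vp y.
  apply/funext => y; rewrite laurent_pmcE -/m; apply/matrixP => a b; rewrite !mxE.
  by case: (m) => r s /=; rewrite mulr0 !add0r.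
rewrite (connE oU cscP i _ Ux) reE imE E E0 complexify0 scaler0 addr0.
exact: complexifyN.
Qed.

Let pz : p 0 = fun x => complexify (z x). Proof. by []. Qed.
Let p1 : p 1 = fun x => complexify (2^-1 *: vp x). Proof. by []. Qed.
Let pN1 : p (-1) = fun x => complexify (2^-1 *: vp x). Proof. by []. Qed.

Lemma conserved_pmc_coef (k : int) : (`|k| <= 1)%N ->
  [/\ csmooth U (p k), forall x, U x -> p (- k) x = conj_mx (p k x) &
      forall x, U x -> (p k x <= if odd `|k| == odd 1 then csc_perp sigma x else csc sigma x)%MS].
Proof.
have top x : U x -> (complexify (2^-1 *: vp x) <= csc_perp sigma x)%MS.
  move=> Ux; apply/(sub_csc_perp oU lift hv _ Ux).
  by rewrite -complexifyM -scalemxAl (vperp_proj oU Hf Ux) scaler0 complexify0.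
have c0 : csmooth U (p 0) by rewrite pz; exact: (csmooth_complexify oU).
have c1 : csmooth U (p 1) by rewrite p1; exact: (csmooth_complexify oU).
have cN1 : csmooth U (p (-1)) by rewrite pN1; exact: (csmooth_complexify oU).
have bottom x : U x -> (complexify (z x) <= csc sigma x)%MS.
  move=> Ux; apply/(sub_csc oU lift hv _ Ux).
  by rewrite -complexifyM (vtan_proj oU Hf Ux).
case: k => [[|[|k]]|[|k]]// _.
- by split=> // x Ux; rewrite ?complexify_conj//; exact: bottom.
- by split=> // x Ux; rewrite ?complexify_conj//; exact: top.
- by split=> // x Ux; rewrite ?complexify_conj//; exact: top.
Qed.

(** With m = (lambda + lambda^-1)/2 one has D p = - dw, N p = m dw and q p = - dw/2. The coefficient
    of the (1,0)-part of dw is -1 + lambda m - (lambda^2 - 1)/2 = 0, and that of the (0,1)-part is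
    the same with lambda inverted. *)
Lemma dlambda_pmc (l : C) i x : l != 0 -> U x -> dlambda sigma q l i (laurent 1 p l) x = 0.
Proof.
move=> l0 Ux; pose b j := complexify (partial j vp x).
pose m := (l + l^-1) / 2.
have sN j : laurent 1 p l x *m Nform sigma j x = m *: b j.
  rewrite (NformE oU oP sP cscP j Ux) laurent_pmcE mulmxDl -scalemxAl -!complexifyM.
  by rewrite (vtan_split_form oU Hf par j Ux) (vperp_split_form oU Hf par j Ux) complexify0 add0r.
have sq j : laurent 1 p l x *m q j x = (- 2^-1) *: b j.
  have zq : z x *m pmc_multiplier f v j x = - 2^-1 *: partial j vp x.
    rewrite mulmx_wedge lorentzC (lorentz_f_vtan oU Hf Ux) lorentzZr lorentzC.
    by rewrite (dvperp_perp_vtan oU Hf par j Ux) mulr0 scale0r subr0 scaleN1r scaleNr.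
  have vq : vp x *m pmc_multiplier f v j x = 0.
    exact (perp_q oU Hf par j Ux (vperp_proj oU Hf Ux)).
  rewrite laurent_pmcE mulmxDl -scalemxAl -!complexifyM zq vq complexify0 scaler0 addr0.
  by rewrite complexifyZ rmorphN fmorphV rmorph_nat.
have l2 : l ^ 2 = l * l by rewrite -[l ^ 2]/(l ^+ 2) expr2.
have lN2 : l ^ (-2) = l^-1 * l^-1 by rewrite -[l ^ (-2)]/((l ^+ 2)^-1) expr2 invfM.
have alg (W : lmodType C) (u w c t0 t1 t2 t3 t4 : W) : u + w = c -> t0 = - c ->
    t1 = m *: u -> t2 = m *: w -> t3 = (- 2^-1) *: u -> t4 = (- 2^-1) *: w ->
    t0 + l *: t1 + l^-1 *: t2 + (l ^ 2 - 1) *: t3 + (l ^ (-2) - 1) *: t4 = 0.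
  move=> <- -> -> -> -> ->; rewrite l2 lN2 !scalerA opprD -[- u]scaleN1r -[- w]scaleN1r.
  have e1 : -1 + l * m + (l * l - 1) * (- 2^-1) = 0 by rewrite /m; field.
  have e2 : -1 + l^-1 * m + (l^-1 * l^-1 - 1) * (- 2^-1) = 0 by rewrite /m; field.
  have col (r1 r2 r3 : C) (y : W) : r1 + r2 + r3 = 0 -> r1 *: y + r2 *: y + r3 *: y = 0.
    by move=> E; rewrite -!scalerDl E scale0r.
  rewrite [LHS](ACl (1*3*5*(2*4*6))).
  by apply: (etrans (congr2 +%R (col _ _ _ u e1) (col _ _ _ w e2))); exact: addr0.
exact (alg _ _ _ _ _ _ _ _ _ (part10D01 sigma b i x) (conn_laurent_pmc l i Ux)
  (mul_part10 sigma sN i) (mul_part01 sigma sN i) (mul_part10 sigma sq i) (mul_part01 sigma sq i)).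
Qed.

Lemma conserved_pmc (x0 : T) : U x0 -> polynomial_conserved_quantity sigma U q 1 p.
Proof.
move=> Ux0; split; first exact: conserved_pmc_coef.
split.
  by move=> x Ux; have [_ _] := conserved_pmc_coef (k := 1) isT; apply.
split; last by move=> l l0 i x Ux; exact: dlambda_pmc.
(* Here p(1) = v, and v = 0 would contradict that (sigma, v) is nonzero at [x0]. *)
move=> /(_ x0 Ux0); rewrite laurent_pmc1 -(complexify0 R 1 n.+2) => /complexify_inj v0.
by have := hv Ux0; rewrite v0 lorentz0r eqxx.
Qed.

End Parallel.

End ConstrainedWillmore.

Theorem theorem3p10 (R : realType) (n : nat) (hn : (3 <= n)%N)
    (U : set 'rV[R]_2) (hUo : open U) (hU : U !=set0)
    (sigma : 'rV[R]_2 -> 'rV[R]_n.+2) (hsigma : lift_of_surface U sigma)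
    (v : 'rV[R]_n.+2) (hv : forall x, U x -> lorentz (sigma x) v != 0) :
  (exists q : 'I_2 -> 'rV[R]_2 -> 'M[R[i]]_n.+2,
     multiplier sigma U q /\
     exists p : int -> 'rV[R]_2 -> 'rV[R[i]]_n.+2,
       [/\ polynomial_conserved_quantity sigma U q 1 p,
           forall i x, U x -> conn sigma i (p 1) x = 0 &
           forall x, U x -> laurent 1 p 1 x = complexify v])
  <-> parallel_mean_curvature v U (surface_in_space_form v sigma).
Proof.
have Hf := null_immersion_space_form hUo hsigma hv.
split=> [[q [_ [p [pcq top pv]]]]|/(parallel_mean_curvatureP hUo Hf) par].
  apply/(parallel_mean_curvatureP hUo Hf).
  exact: (parallel_vperp_of_conserved hUo hsigma hv pcq top pv).
have [x0 Ux0] := hU.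
exists (pmc_multiplierC sigma v); split; first exact: multiplier_pmc.
exists (pmc_conserved sigma v); split.
- exact: conserved_pmc Ux0.
- by move=> i x Ux; exact: (conn_pmc_top hUo hsigma hv par).
- by move=> x _; exact: laurent_pmc1.
Qed.
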